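(* Let $(G,\mathbf{c})$ be an edge-colored graph, $G=(V,E)$, with exactly two colors ($|C|=2$ where $C=\mathbf{c}(E)$). Then the following are equivalent: (1) $(G,\mathbf{c})$ is minimally angle-rigid. (2) $|E|=2|V|-2$, and $G$ contains a unique $\mathcal{R}_2$-circuit, and this circuit contains edges of both colors. (3) $(G,\mathbf{c})$ can be constructed from a bichromatic copy of $K_4$ (a copy of $K_4$ whose edges use exactly two colors) by a (possibly empty) sequence of 0-extensions and color-preserving 1-extensions.
   Context: Graphs are finite and simple. A realization of $G=(V,E)$ is an injective map $p:V\to\mathbb{R}^2$. An edge-colored graph $(G,\mathbf{c})$ is a graph with a map $\mathbf{c}$ assigning a color to every edge; $C=\mathbf{c}(E)$. An angle framework is a triple $(G,\mathbf{c},p)$ with $p$ a realization. Write $P_{vw}=p_v-p_w$. Two angle frameworks $(G,\mathbf{c},p)$ and $(G,\mathbf{c},q)$ are equivalent if for any two edges of the same color the angle between the two lines spanned by these edges is the same in $p$ and in $q$ (the two lines determine the same set of angles, i.e. the absolute value of the cosine is the same). They are similar if there are a linear isometry $T$ of $\mathbb{R}^2$, $z\in\mathbb{R}^2$ and $\lambda>0$ with $q_v=\lambda T(p_v)+z$ for all $v\in V$. $(G,\mathbf{c},p)$ is locally angle-rigid if all angle frameworks $(G,\mathbf{c},q)$ equivalent to it with $q$ sufficiently close to $p$ are similar to it. The angle-rigidity matrix is the $|E|\times(2|V|+|C|)$ matrix $R(G,\mathbf{c},p)=[\,R(G,p)\;\;M(G,\mathbf{c},p)\,]$, where $R(G,p)$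 is the standard 2-dimensional rigidity matrix (row $vw$ has $P_{vw}$ in the columns of $v$, $-P_{vw}$ in the columns of $w$, zeros elsewhere) and $M(G,\mathbf{c},p)$ has entry $-P_{vw}\cdot P_{vw}$ in row $vw$ and column $\mathbf{c}(vw)$, and $0$ elsewhere. $(G,\mathbf{c},p)$ is independent if the rows of $R(G,\mathbf{c},p)$ are linearly independent. $(G,\mathbf{c})$ is minimally angle-rigid if there is a non-empty Zariski open set $S\subset\mathbb{R}^{2|V|}$ of realizations such that for every $p\in S$, $(G,\mathbf{c},p)$ is locally angle-rigid and independent. $\mathcal{R}_2$ is the generic 2-dimensional rigidity matroid: an edge set $E$ is independent iff $|E'|\le 2|V(E')|-3$ for every non-empty $E'\subseteq E$, where $V(E')$ is the set of vertices incident with $E'$. An $\mathcal{R}_2$-circuit is a graph (here a subgraph of $G$) whose edge set is a circuit (minimal dependent set) of $\mathcal{R}_2$. A 0-extension of $(G,\mathbf{c})$ adds one new vertex $w$ and two new edges joining $w$ to two distinct vertices of $G$; the new edges are given colors from $C$. A 1-extension of $(G,\mathbf{c})$ deletes an edge $xy$, adds a new vertex $w$ and three new edges $wx,wy,wz$, where $z\ne x,y$ is another vertex of $G$; the new edges are given colors from $C$; all other edges keep their colors. Writing $\mathbf{c}'$ for the resulting coloring, the 1-extension is color-preserving if $\mathbf{c}'(wx)=\mathbf{c}(xy)$ or $\mathbf{c}'(wy)=\mathbf{c}(xy)$. *)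

(* Defs.v *)
From mathcomp Require Import all_boot all_order all_algebra.
From mathcomp Require Import reals.
From mathcomp Require Import mpoly.

Set Implicit Arguments.
Unset Strict Implicit.
Unset Printing Implicit Defensive.

Import Order.TTheory GRing.Theory Num.Theory.
Local Open Scope ring_scope.

Section Euclidean.
Variable R : realType.
Implicit Types u v : 'rV[R]_2.

Definition dotv u v : R := \sum_(k < 2) u 0 k * v 0 k.

Definition enorm u : R := Num.sqrt (dotv u u).

(* |cos| of the angles between the lines directed by u and v. *)
Definition line_cos u v : R := `|dotv u v| / (enorm u * enorm v).

End Euclidean.

(* A simple graph on the vertex set V is a set of two-element subsets of V. *)
Definition simple_graph (V : finType) (E : {set {set V}}) : Prop :=
  forall e, e \in E -> #|e| = 2%N.

(* A coloring of E is a function c on all subsets of V; only its values on E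
   matter, and the set C of colors is c @: E. *)
Section AngleFrameworks.
Variables (R : realType) (V K : finType).
Variables (E : {set {set V}}) (c : {set V} -> K).
Implicit Types p q : V -> 'rV[R]_2.

Definition realization p : Prop := injective p.

Definition angle_equivalent p q : Prop :=
  forall v w x y : V,
    [set v; w] \in E -> [set x; y] \in E -> c [set v; w] = c [set x; y] ->
    line_cos (p v - p w) (p x - p y) = line_cos (q v - q w) (q x - q y).

Definition similar p q : Prop :=
  exists (T : {linear 'rV[R]_2 -> 'rV[R]_2}) (z : 'rV[R]_2) (lambda : R),
    [/\ forall u, enorm (T u) = enorm u, 0 < lambda
      & forall v, q v = lambda *: T (p v) + z].

Definition locally_angle_rigid p : Prop :=
  exists2 eps : R, 0 < eps &
    forall q, realization q -> (forall v, enorm (q v - p v) < eps) ->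
      angle_equivalent p q -> similar p q.

(* enum e lists the two ends v, w of an edge e; exchanging them changes
   neither the row of e below nor its squared length. *)
Definition rigidity_row p (e : {set V}) : 'rV[R]_(#|V| * 2) :=
  if enum e is [:: v; w] then
    mxvec (\matrix_(i < #|V|, k < 2)
      (((enum_val i == v)%:R - (enum_val i == w)%:R) * (p v - p w) 0 k))
  else 0.

Definition sqlen p (e : {set V}) : R :=
  if enum e is [:: v; w] then dotv (p v - p w) (p v - p w) else 0.

Definition rigidity_mx p : 'M[R]_(#|E|, #|V| * 2) :=
  \matrix_(i < #|E|) rigidity_row p (enum_val i).

Definition color_mx p : 'M[R]_(#|E|, #|c @: E|) :=
  \matrix_(i < #|E|, j < #|c @: E|)
    (if c (enum_val i) == enum_val j then - sqlen p (enum_val i) else 0).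

Definition angle_rigidity_mx p : 'M[R]_(#|E|, #|V| * 2 + #|c @: E|) :=
  row_mx (rigidity_mx p) (color_mx p).

Definition independent p : Prop := row_free (angle_rigidity_mx p).

Definition coords p : 'I_(#|V| * 2) -> R :=
  mxvec (\matrix_(i < #|V|, k < 2) p (enum_val i) 0 k) 0.

(* The complement of S is the common zero set of a family F of polynomials. *)
Definition zariski_open (S : (V -> 'rV[R]_2) -> Prop) : Prop :=
  exists F : {mpoly R[#|V| * 2]} -> Prop,
    forall p, S p <-> exists2 f, F f & f.@[coords p] != 0.

Definition minimally_angle_rigid : Prop :=
  exists S : (V -> 'rV[R]_2) -> Prop,
    [/\ zariski_open S, exists p, S p, forall p, S p -> realization p
      & forall p, S p -> locally_angle_rigid p /\ independent p].

End AngleFrameworks.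

Section RigidityMatroid.
Variable V : finType.
Implicit Types D : {set {set V}}.

(* cover D' is the set of vertices incident with D'. *)
Definition R2_independent D : bool :=
  [forall (D' : {set {set V}} | (D' \subset D) && (D' != set0)),
     #|D'| + 3 <= 2 * #|cover D'|]%N.

Definition R2_circuit D : bool := minset (fun D' => ~~ R2_independent D') D.

Definition R2_circuit_in (E : {set {set V}}) D : Prop :=
  D \subset E /\ R2_circuit D.

End RigidityMatroid.

(* Vertices are never removed by an extension, so a construction of a graph on
   V takes place among colored graphs whose vertex sets are subsets of V. *)
Record cgraph (V K : finType) := CGraph {
  vset : {set V};
  eset : {set {set V}};
  col : {set V} -> K
}.

Section Extensions.
Variables V K : finType.
Implicit Types G H : cgraph V K.

Definition colors G : {set K} := col G @: eset G.

Definition bichromatic_K4 G : Prop :=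
  [/\ #|vset G| = 4%N,
      eset G = [set e : {set V} | (e \subset vset G) && (#|e| == 2%N)]
    & #|colors G| = 2%N].

Definition zero_extension G H : Prop :=
  exists w x y : V,
    [/\ w \notin vset G, [/\ x \in vset G, y \in vset G & x != y],
        vset H = w |: vset G,
        eset H = eset G :|: [set [set w; x]; [set w; y]]
      & [/\ {in eset G, col H =1 col G},
            col H [set w; x] \in colors G
          & col H [set w; y] \in colors G]].

Definition color_preserving_one_extension G H : Prop :=
  exists w x y z : V,
    [/\ w \notin vset G,
        [/\ [set x; y] \in eset G, z \in vset G, x != y, z != x & z != y],
        vset H = w |: vset G,
        eset H = (eset G :\ [set x; y])
                   :|: [set [set w; x]; [set w; y]; [set w; z]]
      & [/\ {in eset G :\ [set x; y], col H =1 col G},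
            col H [set w; x] \in colors G,
            col H [set w; y] \in colors G,
            col H [set w; z] \in colors G
          & col H [set w; x] = col G [set x; y]
            \/ col H [set w; y] = col G [set x; y]]].

Inductive constructible : cgraph V K -> Prop :=
| Constr_K4 G : bichromatic_K4 G -> constructible G
| Constr_zero G H : constructible G -> zero_extension G H -> constructible H
| Constr_one G H : constructible G -> color_preserving_one_extension G H ->
    constructible H.

End Extensions.

(* Main.v *)
Require Import Defs.
From mathcomp Require Import all_boot all_order all_algebra.
From mathcomp Require Import ring lra zify.
From mathcomp Require boolp.
From mathcomp Require Import reals mpoly.

(** Let [p] be injective and [q] near [p].  Equal [|cos|] then mean that the
edges of one color are all turned by the same angle ([line_cos_tangent]).  Turn
[q] so that the first color is not turned at all, and let [t] be the tangent of
the angle of the second color.  For an edge [ab] with [P = p a - p b] and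
[Q = q a - q b] the condition reads [cross P Q = 0] or [cross P Q = t * dotv P Q],
according to its color.  It is linear in [q] for fixed [t], so that local
rigidity is a matter of linear algebra.  The rows of the system obtained by
differentiating in [q] and [t] at [p] are those of the angle-rigidity matrix up
to a quarter turn, and their dependencies are the angle stresses: equilibrium
stresses [w] of [p] for which the terms [w e * sqlen p e] of each color sum to zero.

Rigidity implies the count ([minimally_angle_rigid_count]).  Counting equations
shows that a nonempty edge set [X] has a nonzero stress if
[#|X| > 2 * #|cover X| - 3], and a nonzero angle stress if
[#|X| > 2 * #|cover X| - 2] ([stress_exists]).  Hence an independent framework has
at most [2 * #|V| - 2] edges; its circuits have edges of both colors, because a
stress of a monochromatic circuit is an angle stress; and two circuits would
either be joined in too dense a set or have stresses that combine to an angle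
stress.  If there are fewer than [2 * #|V| - 2] edges, the linear system has,
for generic [p], solutions near [p] that are not similar to [p] ([few_edges_flexible]).

The count implies constructibility ([reducible_constructible]) by induction on
the vertices.  If the circuit [D] is not the whole graph, some vertex outside
[D] has degree two or three, and removing it, or splitting it off, leaves [D]
intact ([reduction_outside]).  If the graph is a circuit with more than four
vertices, splitting off a vertex of degree three at two non-adjacent neighbors
always leaves a unique circuit; what can fail is that it has two colors.  If it
fails everywhere, some edge lies in the closed neighborhood of every vertex of
degree three, which contradicts the edge count ([circuit_reduction]).

Constructibility implies rigidity.  Independence at one point is inherited by
extensions ([zero_extension_independent], [one_extension_independent]) and
spreads to a Zariski-open set.  With [2 * #|V| - 2] independent rows the system
above has no solutions near [p] but dilations and translations of [p]
([angle_independent_rigid]). *)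

Set Implicit Arguments.
Unset Strict Implicit.
Unset Printing Implicit Defensive.

Import Order.TTheory GRing.Theory Num.Theory.
Local Open Scope ring_scope.

(** * Linear systems indexed by finite sets *)

Section LinearSystems.
Variables (F : fieldType) (I J : finType).
Implicit Types (A : {set I}) (M : I -> J -> F).

Definition rows_independent A M : Prop :=
  forall w : I -> F, (forall j, \sum_(i in A) w i * M i j = 0) ->
  forall i, i \in A -> w i = 0.

Definition system_mx A M : 'M[F]_(#|A|, #|J|) :=
  \matrix_(i, j) M (enum_val i) (enum_val j).

Lemma extend_row A (v : 'rV[F]_#|A|) :
  exists w : I -> F, (forall k, w (enum_val k) = v 0 k)
    /\ forall i, i \notin A -> w i = 0.
Proof.
exists (fun i => \sum_(k < #|A| | enum_val k == i) v 0 k); split=> [k|i iA].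
  by rewrite (big_pred1 k) // => l; rewrite /= (inj_eq enum_val_inj).
by rewrite big_pred0 // => k; apply: contraNF iA => /eqP <-; apply: enum_valP.
Qed.

Lemma system_mxE A M (w : I -> F) (u : 'rV[F]_#|A|) :
  (forall k, u 0 k = w (enum_val k)) -> forall j,
  (u *m system_mx A M) 0 j = \sum_(i in A) w i * M i (enum_val j).
Proof.
move=> uE j; rewrite mxE [RHS]big_enum_val; apply: eq_bigr => k _.
by rewrite uE mxE.
Qed.

Lemma rows_independentP A M :
  rows_independent A M <-> row_free (system_mx A M).
Proof.
split=> [indM|/row_freeP[B MB] w wM i iA].
  rewrite -kermx_eq0; apply/rowV0P => v /sub_kermxP vM.
  have [w [wE _]] := extend_row v.
  apply/rowP => k; rewrite -wE mxE; apply: indM; last exact: enum_valP.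
  move=> j; rewrite -[j]enum_rankK -(@system_mxE _ M w v); first by rewrite vM mxE.
  by move=> l; rewrite wE.
pose u := \row_(k < #|A|) w (enum_val k).
have uM : u *m system_mx A M = 0.
  apply/rowP => j; rewrite (@system_mxE _ _ w) ?wM ?mxE // => k.
  by rewrite mxE.
have : u = 0 by rewrite -[u]mulmx1 -MB mulmxA uM mul0mx.
move/rowP => /(_ (enum_rank_in iA i)); rewrite !mxE enum_rankK_in //.
Qed.

Lemma more_unknowns (A : {set I}) (B : {set J}) M : (#|B| < #|A|)%N ->
  exists w : I -> F, [/\ exists2 i, i \in A & w i != 0,
    forall i, i \notin A -> w i = 0
    & forall j, j \in B -> \sum_(i in A) w i * M i j = 0].
Proof.
move=> ltBA; pose N := \matrix_(i < #|A|, j < #|B|) M (enum_val i) (enum_val j).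
have : kermx N != 0.
  rewrite kermx_eq0 /row_free neq_ltn; apply/orP; left.
  exact: leq_ltn_trans (rank_leq_col N) ltBA.
case/rowV0Pn => v /sub_kermxP vN v0; have [w [wE wA]] := extend_row v.
exists w; split=> // [|j jB].
  have [k vk] : exists k, v 0 k != 0.
    by apply/existsP; apply: contraNT v0 => /existsPn v0;
       apply/eqP/rowP => k; rewrite mxE; apply/eqP/negbNE/v0.
  by exists (enum_val k); [apply: enum_valP | rewrite wE].
move/rowP/(_ (enum_rank_in jB j)): vN; rewrite !mxE => vN.
rewrite -[RHS]vN [LHS]big_enum_val; apply: eq_bigr => k _.
by rewrite wE !mxE enum_rankK_in.
Qed.

End LinearSystems.

Section SolutionSpace.
Variables (F : fieldType) (I J D : finType).
Variables (A : {set I}) (M : I -> J -> F) (K : D -> J -> F).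
Implicit Types y : J -> F.

Definition solution y : Prop := forall i, i \in A -> \sum_j M i j * y j = 0.

Definition combination y : Prop :=
  exists a : D -> F, forall j, y j = \sum_d a d * K d j.

Hypotheses (solK : forall d, solution (K d))
           (indK : rows_independent [set: D] K).

Let Mt := (system_mx A M)^T.
Let Km := system_mx [set: D] K.
Let vecJ y : 'rV[F]_#|J| := \row_j y (enum_val j).

Let solutionP y : solution y <-> vecJ y *m Mt = 0.
Proof.
have E k : (vecJ y *m Mt) 0 k = \sum_j M (enum_val k) j * y j.
  rewrite mxE (big_enum_val (A := J)); apply: eq_bigr => j _.
  by rewrite !mxE mulrC.
split=> [sol|/rowP sol i iA].
  by apply/rowP => k; rewrite E sol ?enum_valP ?mxE.
by have := sol (enum_rank_in iA i); rewrite E mxE enum_rankK_in.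
Qed.

Let combinationP y : (vecJ y <= Km)%MS <-> combination y.
Proof.
split=> [/submxP[a aE]|[a aE]].
  have [w [wE _]] := extend_row a.
  exists w => j; move/rowP/(_ (enum_rank j)): aE; rewrite mxE enum_rankK => ->.
  rewrite (@system_mxE _ _ _ _ _ w) => [|k]; last by rewrite wE.
  by rewrite enum_rankK; apply: eq_bigl => d; rewrite inE.
apply/submxP; exists (\row_k a (enum_val k)); apply/rowP => j.
rewrite (@system_mxE _ _ _ _ _ a) => [|k]; last by rewrite mxE.
by rewrite mxE aE; apply: eq_bigl => d; rewrite inE.
Qed.

Let KM : Km *m Mt = 0.
Proof.
apply/row_matrixP => d; rewrite row_mul row0; have /solutionP := solK (enum_val d).
by congr (_ *m _ = _); apply/rowP => j; rewrite !mxE.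
Qed.

Let rankK : \rank Km = #|D|.
Proof. by have /rows_independentP/eqP -> := indK; rewrite cardsT. Qed.

(** The solutions form a space of dimension [#|J| - #|A|], which is at most the
dimension [#|D|] of the space spanned by the [K d]. *)
Lemma solution_combination y :
  rows_independent A M -> (#|J| <= #|A| + #|D|)%N -> solution y -> combination y.
Proof.
move=> /rows_independentP indM leJ /solutionP yM; apply/combinationP.
have kerE : (kermx Mt <= Km)%MS.
  have sK : (Km <= kermx Mt)%MS by apply/sub_kermxP; exact: KM.
  have [_ <-] := mxrank_leqif_sup sK.
  rewrite eqn_leq mxrankS //= mxrank_ker mxrank_tr (eqP indM) rankK.
  by rewrite leq_subLR.
by apply: submx_trans kerE; apply/sub_kermxP.
Qed.

(** If every solution is a combination, the solutions form a space of dimension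
at most [#|D|], so the rank of [M] is at least [#|J| - #|D|], hence [#|A|]. *)
Lemma independent_or_solution :
  (#|A| + #|D| <= #|J|)%N ->
  rows_independent A M /\ (#|A| + #|D|)%N = #|J|
  \/ exists2 y, solution y & ~ combination y.
Proof.
move=> leJ; have [|sub] := boolP (kermx Mt <= Km)%MS.
  move=> /mxrankS; rewrite mxrank_ker mxrank_tr rankK leq_subLR => leJ'.
  have leA := rank_leq_row (system_mx A M).
  left; split; last by lia.
  by apply/rows_independentP; rewrite /row_free; apply/eqP; lia.
right; move: sub.
case/row_subPn => k yK.
pose y j := kermx Mt k (enum_rank j).
have vy : vecJ y = row k (kermx Mt).
  by apply/rowP => j; rewrite /vecJ mxE /y enum_valK [RHS]mxE.
exists y; first by apply/solutionP; rewrite vy -row_mul mulmx_ker row0.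
by move/combinationP; rewrite vy; apply/negP.
Qed.

End SolutionSpace.

Section Perturbation.
Variables (R : realFieldType).

(** The entrywise sum norm, chosen because it is submultiplicative. *)
Definition mxsize m n (A : 'M[R]_(m, n)) : R := \sum_i \sum_j `|A i j|.

Lemma mxsize_ge0 m n (A : 'M[R]_(m, n)) : 0 <= mxsize A.
Proof. by apply: sumr_ge0 => i _; apply: sumr_ge0. Qed.

Lemma mxsize_entry m n (A : 'M[R]_(m, n)) i j : `|A i j| <= mxsize A.
Proof.
rewrite /mxsize (bigD1 i) //= (bigD1 j) //= -addrA lerDl.
by apply: addr_ge0; apply: sumr_ge0 => // k _; apply: sumr_ge0.
Qed.

Lemma mxsize_eq0 m n (A : 'M[R]_(m, n)) : mxsize A <= 0 -> A = 0.
Proof.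
move=> A0; apply/matrixP => i j; rewrite mxE; apply/normr0_eq0/le_anti.
by rewrite normr_ge0 andbT (le_trans (mxsize_entry A i j)).
Qed.

Lemma mxsizeD m n (A B : 'M[R]_(m, n)) : mxsize (A + B) <= mxsize A + mxsize B.
Proof.
rewrite /mxsize -big_split ler_sum // => i _.
by rewrite -big_split ler_sum // => j _; rewrite mxE ler_normD.
Qed.

Lemma mxsizeZ m n a (A : 'M[R]_(m, n)) : mxsize (a *: A) = `|a| * mxsize A.
Proof.
rewrite /mxsize mulr_sumr; apply: eq_bigr => i _.
by rewrite mulr_sumr; apply: eq_bigr => j _; rewrite mxE normrM.
Qed.

Lemma mxsizeM m n p (A : 'M[R]_(m, n)) (B : 'M[R]_(n, p)) :
  mxsize (A *m B) <= mxsize A * mxsize B.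
Proof.
rewrite /mxsize mulr_suml ler_sum // => i _.
apply: (@le_trans _ _ (\sum_k \sum_j `|A i j| * `|B j k|)).
  apply: ler_sum => k _; rewrite mxE; apply: le_trans (ler_norm_sum _ _ _) _.
  by apply: ler_sum => j _; rewrite normrM.
rewrite exchange_big mulr_suml; apply: ler_sum => j _ /=.
rewrite -mulr_sumr ler_wpM2l //.
rewrite [leRHS](bigD1 j) //= lerDl.
by apply: sumr_ge0 => k _; apply: sumr_ge0.
Qed.

(** A matrix within distance less than one of the identity has trivial
kernel, because [u = u *m (1 - A)] would make [u] shrink. *)
Lemma near1_row_free n (A : 'M[R]_n) : mxsize (1%:M - A) < 1 -> row_free A.
Proof.
move=> A1; rewrite -kermx_eq0; apply/rowV0P => u /sub_kermxP uA.
have uE : u = u *m (1%:M - A) by rewrite mulmxBr uA mulmx1 subr0.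
apply: mxsize_eq0; have := mxsizeM u (1%:M - A); rewrite -uE => le_u.
rewrite leNgt; apply/negP => u0.
by move: le_u; rewrite leNgt -{2}[mxsize u]mulr1 ltr_pM2l // A1.
Qed.

Variables (I J : finType) (A : {set I}).

(** For a right inverse [B] of [M], the product [M' *m B] stays near the
identity. *)
Lemma rows_independent_open (M : I -> J -> R) : rows_independent A M ->
  exists2 eps, 0 < eps &
    forall M', (forall i j, i \in A -> `|M' i j - M i j| < eps) ->
    rows_independent A M'.
Proof.
move=> /rows_independentP/row_freeP[B MB].
have C0 : 0 <= (#|A| * #|J|)%:R * mxsize B by rewrite mulr_ge0 ?mxsize_ge0.
exists ((1 + (#|A| * #|J|)%:R * mxsize B)^-1); first by rewrite invr_gt0; lra.
move=> M' closeM; apply/rows_independentP.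
suff: row_free (system_mx A M' *m B).
  by move=> /row_freeP[C MC]; apply/row_freeP; exists (B *m C); rewrite mulmxA.
apply: near1_row_free.
have -> : 1%:M - system_mx A M' *m B = (system_mx A M - system_mx A M') *m B.
  by rewrite mulmxBl MB.
apply: le_lt_trans (mxsizeM _ _) _.
set e := _^-1 in closeM *; set S := mxsize B in C0 *; set c := _%:R in C0 *.
have leS : mxsize (system_mx A M - system_mx A M') <= c * e.
  apply: (@le_trans _ _ (\sum_(i < #|A|) \sum_(j < #|J|) e)).
    apply: ler_sum => i _; apply: ler_sum => j _; rewrite !mxE distrC ltW //.
    by apply: closeM; apply: enum_valP.
  by rewrite !sumr_const !card_ord -mulrnA -mulr_natl /c mulnC.
apply: le_lt_trans (ler_wpM2r (mxsize_ge0 B) leS) _.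
rewrite -/S mulrAC /e -[c * S]/(c * S) ltr_pdivrMr; lra.
Qed.

(** The solution [q = p + s B], with [B] a right inverse of [M], amounts to
the equation [s (1 + t N B) = - t N p], which is solvable with [s] of
size at most [2 t |N p|] once [t N B] is small. *)
Lemma solution_perturbed (M N : I -> J -> R) (p : J -> R) :
  rows_independent A M -> solution A M p -> forall eps, 0 < eps ->
  exists2 delta, 0 < delta & forall t, `|t| < delta ->
    exists2 q, forall j, `|q j - p j| < eps &
      solution A (fun i j => M i j + t * N i j) q.
Proof.
move=> /rows_independentP/row_freeP[B0 MB0] solp eps eps0.
pose Mt := (system_mx A M)^T; pose Nt := (system_mx A N)^T; pose B := B0^T.
have BM : B *m Mt = 1%:M by rewrite /B /Mt -trmx_mul MB0 trmx1.
pose pv : 'rV[R]_#|J| := \row_j p (enum_val j).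
have pM : pv *m Mt = 0.
  apply/rowP => k; rewrite !mxE -[RHS](solp (enum_val k)) ?enum_valP //.
  by rewrite (big_enum_val (A := J)); apply: eq_bigr => j _; rewrite !mxE mulrC.
pose c := mxsize (B *m Nt); pose d := mxsize (pv *m Nt); pose b := mxsize B.
have [c0 d0 b0] : [/\ 0 <= c, 0 <= d & 0 <= b] by split; apply: mxsize_ge0.
have D0 : 0 < 2 * c + 2 * d * b / eps + 1.
  have : 0 <= 2 * d * b / eps by rewrite divr_ge0 ?mulr_ge0 // ltW.
  by lra.
exists (2 * c + 2 * d * b / eps + 1)^-1; first by rewrite invr_gt0.
move=> t; rewrite -[_^-1]mul1r ltr_pdivlMr // => tD.
have tc : `|t| * c <= 2^-1.
  have : 0 <= `|t| * (2 * d * b / eps).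
    by rewrite mulr_ge0 // divr_ge0 ?mulr_ge0 // ltW.
  have := normr_ge0 t; lra.
have tb : `|t| * (2 * d * b) < eps.
  have : 0 <= `|t| * c by rewrite mulr_ge0.
  have := normr_ge0 t.
  move=> t0 tc0; have : `|t| * (2 * d * b / eps) < 1 by lra.
  by rewrite mulrA ltr_pdivrMr // mul1r.
pose W := 1%:M + t *: (B *m Nt).
have /row_freeP[W' WW'] : row_free W.
  apply: near1_row_free.
  have -> : 1%:M - W = (- t) *: (B *m Nt) by rewrite /W opprD addNKr scaleNr.
  by rewrite mxsizeZ normrN -/c; lra.
have W'W : W' *m W = 1%:M by apply: mulmx1C.
pose s := - (t *: (pv *m Nt *m W')).
have sW : s *m W = - (t *: (pv *m Nt)).
  by rewrite /s mulNmx -scalemxAl -(mulmxA _ W') W'W mulmx1.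
have s_small : mxsize s <= 2 * `|t| * d.
  have sE : s = (- t) *: (pv *m Nt) + (- t) *: (s *m (B *m Nt)).
    move: sW; rewrite /W mulmxDr mulmx1 -scalemxAr => sW.
    by rewrite !scaleNr -sW addrK.
  have := mxsizeD ((- t) *: (pv *m Nt)) ((- t) *: (s *m (B *m Nt))).
  rewrite -sE !mxsizeZ normrN -/d.
  have le1 := ler_wpM2l (normr_ge0 t) (mxsizeM s (B *m Nt)).
  have le2 := ler_wpM2l (mxsize_ge0 s) tc.
  by rewrite -/c in le1; lra.
pose qv := pv + s *m B.
have qMN : qv *m (Mt + t *: Nt) = 0.
  rewrite /qv mulmxDl !mulmxDr pM add0r -!scalemxAr -(mulmxA s) BM mulmx1.
  move: sW; rewrite /W mulmxDr mulmx1 -scalemxAr mulmxA => ->.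
  by rewrite subrr.
exists (fun j => qv 0 (enum_rank j)) => [j|i iA].
  rewrite !mxE enum_rankK addrAC subrr add0r.
  have -> : \sum_k s 0 k * B k (enum_rank j) = (s *m B) 0 (enum_rank j).
    by rewrite mxE.
  apply: le_lt_trans (mxsize_entry _ _ _) _.
  apply: le_lt_trans (mxsizeM _ _) _.
  apply: le_lt_trans (ler_wpM2r (mxsize_ge0 B) s_small) _.
  by rewrite -/b; move: tb; rewrite !mulrA [`|t| * 2]mulrC.
move/rowP/(_ (enum_rank_in iA i)): qMN; rewrite mxE [RHS]mxE; apply: etrans.
rewrite (big_enum_val (A := J)); apply: eq_bigr => j _.
by rewrite enum_valK !mxE enum_rankK_in // mulrC.
Qed.

End Perturbation.

(** * Plane geometry *)

Section Plane.
Variable R : realType.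
Implicit Types u v : 'rV[R]_2.

Definition quarter_turn u : 'rV[R]_2 :=
  \row_k (if k == 0 then - u 0 1 else u 0 0).

Definition cross u v : R := u 0 0 * v 0 1 - u 0 1 * v 0 0.

Lemma ord2_cases (k : 'I_2) : k = 0 \/ k = 1.
Proof. by case: k => [[|[|//]]] lt2; [left | right]; apply: val_inj. Qed.

Lemma sum_ord2 (V : nmodType) (F : 'I_2 -> V) : \sum_k F k = F 0 + F 1.
Proof.
rewrite big_ord_recl big_ord_recl big_ord0 addr0; congr (F _ + F _).
exact: val_inj.
Qed.

Lemma plane_eq u v : u 0 0 = v 0 0 -> u 0 1 = v 0 1 -> u = v.
Proof. by move=> e0 e1; apply/rowP => k; case: (ord2_cases k) => ->. Qed.

Lemma dotvE u v : dotv u v = u 0 0 * v 0 0 + u 0 1 * v 0 1.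
Proof. exact: sum_ord2. Qed.

Lemma quarter_turn0 u : quarter_turn u 0 0 = - u 0 1.
Proof. by rewrite mxE. Qed.

Lemma quarter_turn1 u : quarter_turn u 0 1 = u 0 0.
Proof. by rewrite mxE. Qed.

Definition planeE := (quarter_turn0, quarter_turn1, dotvE, mxE).

Lemma dotv_ge0 u : 0 <= dotv u u.
Proof. by rewrite dotvE addr_ge0 // -expr2 sqr_ge0. Qed.

Lemma dotv_eq0 u : dotv u u = 0 -> u = 0.
Proof.
rewrite dotvE => u0; have [] : u 0 0 = 0 /\ u 0 1 = 0.
  have := sqr_ge0 (u 0 0); have := sqr_ge0 (u 0 1); rewrite !expr2 => a0 b0.
  by split; apply/eqP; rewrite -sqrf_eq0 expr2; apply/eqP; lra.
by move=> u00 u01; apply: plane_eq; rewrite ?u00 ?u01 mxE.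
Qed.

Lemma dotv_gt0 u : u != 0 -> 0 < dotv u u.
Proof.
rewrite lt_def dotv_ge0 andbT; apply: contra_neq; exact: dotv_eq0.
Qed.

Lemma enorm_ge0 u : 0 <= enorm u.
Proof. exact: sqrtr_ge0. Qed.

Lemma enorm_sqr u : enorm u ^+ 2 = dotv u u.
Proof. by rewrite sqr_sqrtr ?dotv_ge0. Qed.

Lemma enorm_gt0 u : u != 0 -> 0 < enorm u.
Proof. by move=> u0; rewrite sqrtr_gt0 dotv_gt0. Qed.

Lemma coord_le_enorm u k : `|u 0 k| <= enorm u.
Proof.
rewrite -(ler_pXn2r (n := 2)) ?nnegrE ?normr_ge0 ?enorm_ge0 // enorm_sqr.
rewrite real_normK ?num_real // dotvE -!expr2.
by case: (ord2_cases k) => ->; rewrite ?lerDl ?lerDr sqr_ge0.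
Qed.

Lemma enorm_le_coords u : enorm u <= `|u 0 0| + `|u 0 1|.
Proof.
rewrite -(ler_pXn2r (n := 2)) ?nnegrE ?addr_ge0 ?enorm_ge0 // enorm_sqr dotvE.
rewrite -!expr2 -[u 0 0 ^+ 2]real_normK ?num_real //.
rewrite -[u 0 1 ^+ 2]real_normK ?num_real // sqrrD.
have := mulr_ge0 (normr_ge0 (u 0 0)) (normr_ge0 (u 0 1)); lra.
Qed.

Lemma cross_dot_sqr u v :
  dotv u v ^+ 2 + cross u v ^+ 2 = dotv u u * dotv v v.
Proof. by rewrite /cross !dotvE; ring. Qed.

Lemma cross0_parallel u v : u != 0 -> cross u v = 0 ->
  v = (dotv u v / dotv u u) *: u.
Proof.
move=> u0 uv; have d0 := dotv_gt0 u0.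
have d0' : dotv u u != 0 by rewrite gt_eqF.
apply: plane_eq; rewrite mxE; apply: (mulIf d0'); rewrite mulrAC divfK //;
  move: uv; rewrite /cross !dotvE => uv; apply/eqP; rewrite -subr_eq0; apply/eqP.
  have -> : v 0 0 * (u 0 0 * u 0 0 + u 0 1 * u 0 1) -
     (u 0 0 * v 0 0 + u 0 1 * v 0 1) * u 0 0 =
     - u 0 1 * (u 0 0 * v 0 1 - u 0 1 * v 0 0) by ring.
  by rewrite uv mulr0.
have -> : v 0 1 * (u 0 0 * u 0 0 + u 0 1 * u 0 1) -
     (u 0 0 * v 0 0 + u 0 1 * v 0 1) * u 0 1 =
     u 0 0 * (u 0 0 * v 0 1 - u 0 1 * v 0 0) by ring.
by rewrite uv mulr0.
Qed.

Lemma line_cos_scale a b u v : a != 0 -> b != 0 ->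
  line_cos (a *: u) (b *: v) = line_cos u v.
Proof.
move=> a0 b0; rewrite /line_cos.
have eZ (c : R) (w : 'rV[R]_2) : enorm (c *: w) = `|c| * enorm w.
  rewrite /enorm; have -> : dotv (c *: w) (c *: w) = c ^+ 2 * dotv w w.
    by rewrite !planeE; ring.
  by rewrite sqrtrM ?sqr_ge0 // sqrtr_sqr.
have -> : dotv (a *: u) (b *: v) = a * b * dotv u v by rewrite !planeE; ring.
by rewrite !eZ mulrACA !normrM -mulf_div divff ?mul1r // mulf_neq0 ?normr_eq0.
Qed.

(** Multiplication by the complex number [a + t i]. *)
Definition spin (a t : R) u : 'rV[R]_2 := a *: u + t *: quarter_turn u.

Lemma enorm_spin a t u : enorm (spin a t u) = Num.sqrt (a ^+ 2 + t ^+ 2) * enorm u.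
Proof.
rewrite -sqrtrM ?addr_ge0 ?sqr_ge0 //; congr Num.sqrt.
by rewrite /spin !planeE; ring.
Qed.

Lemma line_cos_spin a t u v : a ^+ 2 + t ^+ 2 != 0 ->
  line_cos (spin a t u) (spin a t v) = line_cos u v.
Proof.
move=> at0; have at_gt0 : 0 < a ^+ 2 + t ^+ 2.
  by rewrite lt_def at0 addr_ge0 ?sqr_ge0.
rewrite /line_cos !enorm_spin mulrACA -expr2 sqr_sqrtr ?ltW //.
have -> : dotv (spin a t u) (spin a t v) = (a ^+ 2 + t ^+ 2) * dotv u v.
  by rewrite /spin !planeE; ring.
by rewrite normrM gtr0_norm // -mulf_div divff // mul1r.
Qed.

(** For [u], [v] and their images [u'], [v'] as complex numbers, both sides
are the imaginary part of the product of [u], conj [u'], conj [v] and [v']. *)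
Lemma cross_dot_rotation u v u' v' :
  dotv u v * cross u' v' - cross u v * dotv u' v'
    = dotv u u' * cross v v' - cross u u' * dotv v v'.
Proof. by rewrite /cross !dotvE; ring. Qed.

(** Equal [|cos|] determine the tangent of the angle up to sign, and the two
sign conditions fix that sign. *)
Lemma line_cos_tangent u v u' v' : u != 0 -> v != 0 -> u' != 0 -> v' != 0 ->
  line_cos u v = line_cos u' v' ->
  (dotv u v != 0 -> 0 < dotv u v * dotv u' v') ->
  (cross u v != 0 -> 0 < cross u v * cross u' v') ->
  dotv u v * cross u' v' = cross u v * dotv u' v'.
Proof.
move=> u0 v0 u0' v0' cosE sgD sgX.
have lcE x y : x != 0 -> y != 0 ->
    line_cos x y ^+ 2 * (dotv x y ^+ 2 + cross x y ^+ 2) = dotv x y ^+ 2.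
  move=> x0 y0; rewrite cross_dot_sqr -!enorm_sqr -exprMn -exprMn /line_cos.
  rewrite divfK ?real_normK ?num_real //.
  by rewrite mulf_neq0 // gt_eqF ?enorm_gt0.
have E := lcE _ _ u0 v0; have E' := lcE _ _ u0' v0'; rewrite -cosE in E'.
have pos x y : x != 0 -> y != 0 -> dotv x y ^+ 2 + cross x y ^+ 2 != 0.
  by move=> x0 y0; rewrite cross_dot_sqr mulf_neq0 // gt_eqF ?dotv_gt0.
have P := pos _ _ u0 v0; have P' := pos _ _ u0' v0'.
move: (line_cos u v ^+ 2) E E' => l.
move: (dotv u v) (cross u v) (dotv u' v') (cross u' v') P P' sgD sgX.
move=> D X D' X' P P' sgD sgX E E'.
have sq : (D * X') ^+ 2 = (X * D') ^+ 2.
  have : D ^+ 2 * (D' ^+ 2 + X' ^+ 2) = D' ^+ 2 * (D ^+ 2 + X ^+ 2).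
    apply: (@etrans _ _ (l * (D ^+ 2 + X ^+ 2) * (D' ^+ 2 + X' ^+ 2))).
      by rewrite E.
    by rewrite mulrAC E'.
  by move=> h; rewrite !exprMn; lra.
have [D0|D0] := eqVneq D 0.
  move/eqP: sq; rewrite D0 mul0r expr0n /= eq_sym sqrf_eq0 => /eqP ->.
  by [].
have [X0|X0] := eqVneq X 0.
  by move/eqP: sq; rewrite X0 mul0r expr0n /= sqrf_eq0 => /eqP ->.
have pD := sgD D0; have pX := sgX X0.
move/eqP: sq; rewrite eqf_sqr => /orP[/eqP //|/eqP eN].
have : 0 < (D * D') * (X * X') by rewrite mulr_gt0.
have -> : (D * D') * (X * X') = (D * X') * (X * D') by ring.
by rewrite eN mulNr oppr_gt0 ltNge -expr2 sqr_ge0.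
Qed.

(** An isometry with two eigenvectors that are neither parallel nor orthogonal
is plus or minus the identity: the inner product of the eigenvectors forces
the eigenvalues to be inverse to each other. *)
Lemma isometry_scalar (T : {linear 'rV[R]_2 -> 'rV[R]_2}) a b u v :
  (forall w, enorm (T w) = enorm w) -> T u = a *: u -> T v = b *: v ->
  cross u v != 0 -> dotv u v != 0 -> a ^+ 2 = 1 /\ forall w, T w = a *: w.
Proof.
move=> isoT Tu Tv uv0 duv0.
have normT w : dotv (T w) (T w) = dotv w w by rewrite -!enorm_sqr isoT.
have dotT : dotv (T u) (T v) = dotv u v.
  have := normT (u + v); rewrite linearD.
  have E (x y : 'rV[R]_2) : dotv (x + y) (x + y) = dotv x x + 2 * dotv x y + dotv y y.
    by rewrite !planeE; ring.
  by rewrite !E !normT; lra.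
have u0 : u != 0.
  by apply: contra_neq uv0 => ->; rewrite /cross !mxE !mul0r subr0.
have a2 : a ^+ 2 = 1.
  have d0 : dotv u u != 0 by rewrite gt_eqF ?dotv_gt0.
  have /eqP := normT u; rewrite Tu.
  have -> : dotv (a *: u) (a *: u) = a ^+ 2 * dotv u u by rewrite !planeE; ring.
  by rewrite -[X in _ == X]mul1r (inj_eq (mulIf d0)) => /eqP.
have ab : a * b = 1.
  move/eqP: dotT; rewrite Tu Tv.
  have -> : dotv (a *: u) (b *: v) = a * b * dotv u v by rewrite !planeE; ring.
  by rewrite -[X in _ == X]mul1r (inj_eq (mulIf duv0)) => /eqP.
have ba : b = a by rewrite -[b]mul1r -a2 expr2 -mulrA ab mulr1.
split=> // w.
have -> : w = (cross w v / cross u v) *: u + (cross u w / cross u v) *: v.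
  by move: uv0; rewrite /cross => uv0; apply: plane_eq; rewrite !mxE; field.
by rewrite linearD !linearZ_LR /= Tu Tv ba scalerDr !scalerA ![a * _]mulrC.
Qed.

End Plane.

(** * Polynomial functions of a realization *)

Section PolynomialFunctions.
Variables (R : realType) (V : finType).
Implicit Types (p q d : V -> 'rV[R]_2) (F G : (V -> 'rV[R]_2) -> R).

Definition polyfun F : Prop :=
  exists f : {mpoly R[#|V| * 2]}, forall p, F p = f.@[coords p].

Lemma polyfun_ext F G : (forall p, F p = G p) -> polyfun F -> polyfun G.
Proof. by move=> FG [f fE]; exists f => p; rewrite -FG. Qed.

Lemma polyfun_const a : polyfun (fun=> a).
Proof. by exists a%:MP => p; rewrite mevalC. Qed.

Lemma polyfun_coord v k : polyfun (fun p => p v 0 k).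
Proof.
exists 'X_(mxvec_index (enum_rank v) k) => p.
by rewrite mevalXU /coords mxvecE mxE enum_rankK.
Qed.

Lemma polyfunD F G : polyfun F -> polyfun G -> polyfun (fun p => F p + G p).
Proof. by move=> [f fE] [g gE]; exists (f + g) => p; rewrite mevalD fE gE. Qed.

Lemma polyfunM F G : polyfun F -> polyfun G -> polyfun (fun p => F p * G p).
Proof. by move=> [f fE] [g gE]; exists (f * g) => p; rewrite mevalM fE gE. Qed.

Lemma polyfunN F : polyfun F -> polyfun (fun p => - F p).
Proof. by move=> [f fE]; exists (- f) => p; rewrite mevalN fE. Qed.

Lemma polyfun_sum (I : Type) (r : seq I) (P : pred I) (F : I -> _ -> R) :
  (forall i, polyfun (F i)) -> polyfun (fun p => \sum_(i <- r | P i) F i p).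
Proof.
move=> pF; elim: r => [|i r IH].
  by apply: polyfun_ext (polyfun_const 0) => p; rewrite big_nil.
case Pi: (P i).
  by apply: polyfun_ext (polyfunD (pF i) IH) => p; rewrite big_cons Pi.
by apply: polyfun_ext IH => p; rewrite big_cons Pi.
Qed.

Lemma polyfun_prod (I : Type) (r : seq I) (P : pred I) (F : I -> _ -> R) :
  (forall i, polyfun (F i)) -> polyfun (fun p => \prod_(i <- r | P i) F i p).
Proof.
move=> pF; elim: r => [|i r IH].
  by apply: polyfun_ext (polyfun_const 1) => p; rewrite big_nil.
case Pi: (P i).
  by apply: polyfun_ext (polyfunM (pF i) IH) => p; rewrite big_cons Pi.
by apply: polyfun_ext IH => p; rewrite big_cons Pi.
Qed.

Lemma polyfun_det n (A : (V -> 'rV[R]_2) -> 'M[R]_n) :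
  (forall i j, polyfun (fun p => A p i j)) -> polyfun (fun p => \det (A p)).
Proof.
move=> pA; apply: polyfun_sum => s; apply: polyfunM; first exact: polyfun_const.
exact: polyfun_prod.
Qed.

Lemma polyfun_line F p d : polyfun F ->
  exists h : {poly R}, forall t, F (fun v => p v + t *: d v) = h.[t].
Proof.
move=> [f fE]; exists (\sum_(m <- msupp f) (f@_m)%:P *
  \prod_i ((coords p i)%:P + coords d i *: 'X) ^+ m i) => t.
rewrite fE mevalE horner_sum; apply: eq_bigr => m _.
rewrite hornerM hornerC horner_prod; congr (_ * _).
apply: eq_bigr => i _; rewrite horner_exp hornerD hornerC hornerZ hornerX.
congr (_ ^+ _); case/mxvec_indexP: i => i k.
by rewrite /coords !mxvecE !mxE mulrC.
Qed.

(** A field of characteristic zero has more natural numbers than [h] has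
roots. *)
Lemma nonroot_exists (h : {poly R}) : h != 0 -> exists t, h.[t] != 0.
Proof.
move=> h0; have : ~~ all (root h) [seq i%:R | i <- iota 0 (size h)].
  apply/negP => rh; have uq : uniq [seq i%:R : R | i <- iota 0 (size h)].
    rewrite map_inj_uniq ?iota_uniq // => i j /eqP.
    by rewrite eqr_nat => /eqP.
  by have := max_poly_roots h0 rh uq; rewrite size_map size_iota ltnn.
by case/allPn => t _ ht; exists t.
Qed.

(** Non-vanishing sets of polynomials meet: restrict both polynomials to the
line through two witnesses. *)
Lemma polyfun_generic F G : polyfun F -> polyfun G ->
  (exists p, F p != 0) -> (exists p, G p != 0) ->
  exists p, F p != 0 /\ G p != 0.
Proof.
move=> pF pG [p Fp] [q Gq]; pose d v := q v - p v.
have [f fE] := polyfun_line p d pF; have [g gE] := polyfun_line p d pG.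
have ext t r : (forall v, r v = p v + t *: d v) ->
    coords r =1 coords (fun v => p v + t *: d v).
  move=> rE i; case/mxvec_indexP: i => i k.
  by rewrite /coords !mxvecE !mxE rE !mxE.
have Fp0 : f.[0] = F p.
  rewrite -fE; case: pF => f' f'E; rewrite !f'E; apply: meval_eq => i.
  by rewrite (ext 0 p) // => v; rewrite scale0r addr0.
have Gq1 : g.[1] = G q.
  rewrite -gE; case: pG => g' g'E; rewrite !g'E; apply: meval_eq => i.
  by rewrite (ext 1 q) // => v; rewrite scale1r addrCA subrr addr0.
have : f * g != 0.
  rewrite -Fp0 in Fp; rewrite -Gq1 in Gq.
  by apply: mulf_neq0; [apply: contra_neq Fp | apply: contra_neq Gq] => ->;
     rewrite horner0.
case/nonroot_exists => t; rewrite hornerM mulf_eq0 negb_or => /andP[ft gt].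
by exists (fun v => p v + t *: d v); rewrite fE gE.
Qed.

(** A right inverse [B] of the system at [p0] gives the function
[det (M p *m B)]; it equals one at [p0]. *)
Lemma polyfun_rows_independent (I J : finType) (A : {set I})
    (M : (V -> 'rV[R]_2) -> I -> J -> R) p0 :
  (forall i j, polyfun (fun p => M p i j)) -> rows_independent A (M p0) ->
  exists F, [/\ polyfun F, F p0 != 0
    & forall p, F p != 0 -> rows_independent A (M p)].
Proof.
move=> pM /rows_independentP/row_freeP[B MB].
exists (fun p => \det (system_mx A (M p) *m B)); split=> [||p det0].
- apply: polyfun_det => i j.
  apply: (@polyfun_ext (fun p =>
      \sum_k M p (enum_val i) (enum_val k) * B k j)) => [p|].
    by rewrite mxE; apply: eq_bigr => k _; rewrite mxE.
  apply: polyfun_sum => k; apply: polyfunM => //; exact: polyfun_const.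
- by rewrite MB det1 oner_neq0.
apply/rows_independentP/row_freeP.
exists (B *m invmx (system_mx A (M p) *m B)).
by rewrite mulmxA mulmxV // unitmxE unitfE.
Qed.

End PolynomialFunctions.

(** * Realizations near a given one *)

Section Nearby.
Variables (R : realType) (V : finType) (p : V -> 'rV[R]_2).
Implicit Types (q : V -> 'rV[R]_2) (F G : (V -> 'rV[R]_2) -> R).

Definition nearby (P : (V -> 'rV[R]_2) -> Prop) : Prop :=
  exists2 eps : R, 0 < eps &
    forall q, (forall v, enorm (q v - p v) < eps) -> P q.

Lemma nearbyW (P Q : _ -> Prop) : (forall q, P q -> Q q) -> nearby P -> nearby Q.
Proof. by move=> PQ [e e0 Pe]; exists e => // q /Pe/PQ. Qed.

Lemma nearby_and (P Q : _ -> Prop) :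
  nearby P -> nearby Q -> nearby (fun q => P q /\ Q q).
Proof.
move=> [e e0 Pe] [d d0 Qd]; exists (Num.min e d); first by rewrite lt_min e0.
by move=> q qp; split; [apply: Pe | apply: Qd] => v; move: (qp v);
   rewrite lt_min => /andP[].
Qed.

Lemma nearby_all (T : finType) (P : T -> _ -> Prop) :
  (forall i, nearby (P i)) -> nearby (fun q => forall i, P i q).
Proof.
move=> nP; suff: nearby (fun q => forall i, i \in enum T -> P i q).
  by apply: nearbyW => q Pq i; apply: Pq; rewrite mem_enum.
elim: (enum T) => [|i s IH]; first by exists 1.
apply: nearbyW (nearby_and (nP i) IH) => q [Pi Ps] j.
by rewrite inE => /orP[/eqP ->|/Ps].
Qed.

Lemma nearby_imply (Q : Prop) (P : _ -> Prop) :
  Q \/ ~ Q -> (Q -> nearby P) -> nearby (fun q => Q -> P q).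
Proof.
by move=> [q|nq] nP; [apply: nearbyW (nP q) => r Pr _ | exists 1].
Qed.

(** Continuity at [p], in a quantitative form that is stable under products. *)
Definition lipschitz F : Prop :=
  exists2 K : R, 0 <= K & forall e q, 0 < e -> e <= 1 ->
    (forall v, enorm (q v - p v) < e) -> `|F q - F p| <= K * e.

Lemma lipschitz_const a : lipschitz (fun=> a).
Proof. by exists 0 => // e q _ _ _; rewrite subrr normr0 mul0r. Qed.

Lemma lipschitz_coord v k : lipschitz (fun q => q v 0 k).
Proof.
exists 1 => // e q _ _ qp; rewrite mul1r (le_trans _ (ltW (qp v))) //.
by apply: le_trans (coord_le_enorm _ k); rewrite !mxE.
Qed.

Lemma lipschitzD F G :
  lipschitz F -> lipschitz G -> lipschitz (fun q => F q + G q).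
Proof.
move=> [K K0 FK] [L L0 GL]; exists (K + L) => [|e q e0 e1 qp].
  exact: addr_ge0.
rewrite opprD addrACA mulrDl; apply: le_trans (ler_normD _ _) _.
by rewrite lerD ?FK ?GL.
Qed.

Lemma lipschitzM F G :
  lipschitz F -> lipschitz G -> lipschitz (fun q => F q * G q).
Proof.
move=> [K K0 FK] [L L0 GL].
exists (K * (`|G p| + L) + `|F p| * L) => [|e q e0 e1 qp].
  by rewrite addr_ge0 ?mulr_ge0 ?addr_ge0.
have -> : F q * G q - F p * G p
          = (F q - F p) * (G p + (G q - G p)) + F p * (G q - G p) by ring.
apply: le_trans (ler_normD _ _) _; rewrite !normrM mulrDl lerD //; last first.
  by rewrite -mulrA ler_wpM2l ?GL.
rewrite mulrAC ler_pM ?FK //.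
apply: le_trans (ler_normD _ _) _; rewrite lerD2l.
apply: le_trans (GL e q e0 e1 qp) _.
by rewrite -[leRHS]mulr1 ler_wpM2l.
Qed.

Lemma lipschitzN F : lipschitz F -> lipschitz (fun q => - F q).
Proof.
by move=> [K K0 FK]; exists K => // e q e0 e1 qp; rewrite -opprD normrN FK.
Qed.

Lemma lipschitz_nearby F e : lipschitz F -> 0 < e ->
  nearby (fun q => `|F q - F p| < e).
Proof.
move=> [K K0 FK] e0; have K1 : 0 < K + 1 by lra.
exists (Num.min 1 (e / (K + 1))) => [|q qp].
  by rewrite lt_min ltr01 divr_gt0.
have d0 : 0 < Num.min 1 (e / (K + 1)) by rewrite lt_min ltr01 divr_gt0.
have d1 : Num.min 1 (e / (K + 1)) <= 1 by rewrite ge_min lexx.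
apply: le_lt_trans (FK _ _ d0 d1 qp) _.
have : Num.min 1 (e / (K + 1)) <= e / (K + 1) by rewrite ge_min lexx orbT.
move/(ler_wpM2l K0) => le1; apply: le_lt_trans le1 _.
by rewrite mulrA ltr_pdivrMr //; nra.
Qed.

Lemma lipschitz_positive F : lipschitz F -> 0 < F p -> nearby (fun q => 0 < F q).
Proof.
move=> lF Fp; apply: nearbyW (lipschitz_nearby lF Fp) => q.
by rewrite ltr_norml => /andP[]; lra.
Qed.

Lemma lipschitz_sign F : lipschitz F ->
  nearby (fun q => F p != 0 -> 0 < F p * F q).
Proof.
move=> lF; apply: nearby_imply; first by case: eqP => _; [right | left].
move=> Fp; apply: (@lipschitz_positive (fun q => F p * F q)).
  by apply: lipschitzM => //; apply: lipschitz_const.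
by rewrite -expr2 lt_def sqrf_eq0 Fp sqr_ge0.
Qed.

Lemma lipschitz_rows_independent (I J : finType) (A : {set I})
    (M : (V -> 'rV[R]_2) -> I -> J -> R) :
  (forall i j, i \in A -> lipschitz (fun q => M q i j)) -> rows_independent A (M p) ->
  nearby (fun q => rows_independent A (M q)).
Proof.
move=> lM /rows_independent_open[e e0 openM].
have : nearby (fun q => forall ij : I * J,
    ij.1 \in A -> `|M q ij.1 ij.2 - M p ij.1 ij.2| < e).
  apply: nearby_all => -[i j] /=; apply: nearby_imply.
    by case: (i \in A); [left | right].
  by move=> iA; apply: lipschitz_nearby e0; apply: lM.
by apply: nearbyW => q close; apply: openM => i j; apply: (close (i, j)).
Qed.

Lemma lipschitz_diff v w k : lipschitz (fun q => (q v - q w) 0 k).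
Proof.
have := lipschitzD (lipschitz_coord v k) (lipschitzN (lipschitz_coord w k)).
by case=> K K0 FK; exists K => // e q e0 e1 qp; rewrite !mxE FK.
Qed.

Lemma lipschitz_ext F G : (forall q, F q = G q) -> lipschitz F -> lipschitz G.
Proof.
by move=> FG [K K0 FK]; exists K => // e q e0 e1 qp; rewrite -!FG FK.
Qed.

Lemma lipschitz_dotv (f g : _ -> 'rV[R]_2) :
  (forall k, lipschitz (fun q => f q 0 k)) ->
  (forall k, lipschitz (fun q => g q 0 k)) -> lipschitz (fun q => dotv (f q) (g q)).
Proof.
move=> lf lg; apply: lipschitz_ext (lipschitzD (lipschitzM (lf 0) (lg 0))
  (lipschitzM (lf 1) (lg 1))) => q; by rewrite dotvE.
Qed.

Lemma lipschitz_cross (f g : _ -> 'rV[R]_2) :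
  (forall k, lipschitz (fun q => f q 0 k)) ->
  (forall k, lipschitz (fun q => g q 0 k)) -> lipschitz (fun q => cross (f q) (g q)).
Proof.
by move=> lf lg; apply: (lipschitzD (lipschitzM (lf 0) (lg 1))
  (lipschitzN (lipschitzM (lf 1) (lg 0)))).
Qed.

Lemma nearby_realization : realization p -> nearby (@realization R V).
Proof.
move=> injp; have : nearby (fun q => forall vw : V * V, vw.1 != vw.2 ->
    0 < dotv (q vw.1 - q vw.2) (q vw.1 - q vw.2)).
  apply: nearby_all => -[v w] /=; apply: nearby_imply.
    by case: eqP => _; [right | left].
  move=> vw; apply: lipschitz_positive.
    by apply: lipschitz_dotv => k; apply: lipschitz_diff.
  by rewrite dotv_gt0 // subr_eq0 (inj_eq injp).
apply: nearbyW => q pos v w qvw; apply/eqP; apply: contraT => vw.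
have := pos (v, w) vw; rewrite /= qvw subrr.
by rewrite dotvE !mxE mul0r addr0 ltxx.
Qed.

End Nearby.

(** * Stresses *)

Section Edges.
Variables (R : realType) (V : finType).
Implicit Types (p q y : V -> 'rV[R]_2) (e : {set V}) (X : {set {set V}}).

Lemma set2_eq (a b v w : V) : ([set a; b] == [set v; w]) =
  (a == v) && (b == w) || (a == w) && (b == v).
Proof.
apply/eqP/orP => [E|[] /andP[/eqP-> /eqP->] //]; last by rewrite setUC.
have /set2P av : a \in [set v; w] by rewrite -E set21.
have /set2P bv : b \in [set v; w] by rewrite -E set22.
have /set2P va : v \in [set a; b] by rewrite E set21.
have /set2P wa : w \in [set a; b] by rewrite E set22.
by case: av; case: bv; case: va; case: wa => *; subst; rewrite ?eqxx; auto.
Qed.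

Lemma simple_edge X e : simple_graph X -> e \in X ->
  exists a b, a != b /\ e = [set a; b].
Proof.
by move=> sX /sX/eqP/cards2P[a [b [ab ->]]]; exists a, b.
Qed.

Lemma enum_set2 (a b : V) : a != b ->
  enum [set a; b] = [:: a; b] \/ enum [set a; b] = [:: b; a].
Proof.
move=> ab; have := cards2 a b; rewrite ab cardE.
have := enum_uniq [set a; b].
have : forall x, x \in enum [set a; b] -> x = a \/ x = b.
  by move=> x; rewrite mem_enum in_set2 => /orP[]/eqP; auto.
case: (enum _) => [|x [|y [|? ?]]] //= mem /andP[xy _] _.
have xab := mem x (mem_head _ _).
have yab : y = a \/ y = b by apply: mem; rewrite !inE eqxx orbT.
move: xy; rewrite mem_seq1.
by case: xab yab => -> [] ->; rewrite ?eqxx; auto.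
Qed.

Lemma sqlen_set2 p (a b : V) : a != b ->
  sqlen p [set a; b] = dotv (p a - p b) (p a - p b).
Proof.
move=> ab; rewrite /sqlen; case: (enum_set2 ab) => -> //.
by rewrite !planeE; ring.
Qed.

(** The row of the rigidity matrix, vertex by vertex; writing it as a sum over
the potential second end avoids choosing an orientation of the edge. *)
Definition edge_row p e v : 'rV[R]_2 :=
  \sum_w (e == [set v; w])%:R *: (p v - p w).

Lemma edge_row_set2 p (a b v : V) : a != b ->
  edge_row p [set a; b] v =
    ((v == a)%:R - (v == b)%:R) *: (p a - p b).
Proof.
move=> ab; rewrite /edge_row.
have [->|va] := eqVneq v a; last have [->|vb] := eqVneq v b.
- rewrite (negPf ab) subr0 scale1r (bigD1 b) //= set2_eq !eqxx /= scale1r.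
  rewrite big1 ?addr0 // => w wb; rewrite set2_eq eqxx /= [b == w]eq_sym.
  by rewrite (negPf wb) [b == a]eq_sym (negPf ab) andbF scale0r.
- rewrite sub0r scaleN1r opprB (bigD1 a) //= set2_eq !eqxx /= orbT scale1r.
  rewrite big1 ?addr0 // => w wa; rewrite set2_eq eqxx /= [a == w]eq_sym.
  by rewrite (negPf wa) (negPf ab) scale0r.
rewrite subr0 scale0r big1 // => w _; rewrite set2_eq.
by rewrite [a == v]eq_sym [b == v]eq_sym (negPf va) (negPf vb) andbF scale0r.
Qed.

Lemma sum_edge_row (Z : zmodType) (h : V -> 'rV[R]_2 -> Z) p (a b : V) : a != b ->
  (forall v, h v 0 = 0) ->
  \sum_v h v (edge_row p [set a; b] v) = h a (p a - p b) + h b (p b - p a).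
Proof.
move=> ab h0; rewrite (bigD1 a) //= (bigD1 b) 1?eq_sym //= big1 => [|v].
  rewrite addr0 !edge_row_set2 // !eqxx (negPf ab) [b == a]eq_sym (negPf ab).
  by rewrite subr0 sub0r scale1r scaleN1r opprB.
by case/andP => va vb; rewrite edge_row_set2 // (negPf va) (negPf vb) subr0 scale0r.
Qed.

Lemma rigidity_rowE p e v k : #|e| = 2%N ->
  rigidity_row p e 0 (mxvec_index (enum_rank v) k) = edge_row p e v 0 k.
Proof.
move=> /eqP/cards2P[a [b [ab ->]]]; rewrite edge_row_set2 // /rigidity_row.
case: (enum_set2 ab) => ->; rewrite mxvecE !mxE enum_rankK //.
by rewrite -mulrNN !opprB.
Qed.

Definition stress p (w : {set V} -> R) : Prop :=
  forall v, \sum_x w [set v; x] *: (p v - p x) = 0.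

Definition supported X (w : {set V} -> R) : Prop := forall e, e \notin X -> w e = 0.

Lemma force_edge_rows X p w v : supported X w ->
  \sum_(e in X) w e *: edge_row p e v = \sum_x w [set v; x] *: (p v - p x).
Proof.
move=> supw; under eq_bigr => e _ do rewrite /edge_row scaler_sumr.
rewrite exchange_big; apply: eq_bigr => x _ /=.
have [vx|vx] := boolP ([set v; x] \in X).
  rewrite (bigD1 [set v; x]) //= eqxx scale1r big1 ?addr0 // => e /andP[_].
  by move/negPf->; rewrite scale0r scaler0.
rewrite supw // scale0r big1 // => e eX; case: eqP eX vx => [->->//|_ _ _].
by rewrite scale0r scaler0.
Qed.

Lemma stressP X p w : supported X w ->
  stress p w <-> forall v, \sum_(e in X) w e *: edge_row p e v = 0.
Proof.
move=> supw; split=> st v; first by rewrite force_edge_rows.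
by rewrite -(force_edge_rows _ _ supw).
Qed.

(** The equilibrium equations paired with [p] itself: the edge [ab] contributes
[dotv (p a) (p a - p b) + dotv (p b) (p b - p a)]. *)
Lemma stress_sqlen X p w : simple_graph X -> supported X w -> stress p w ->
  \sum_(e in X) w e * sqlen p e = 0.
Proof.
move=> sX supw /(stressP p supw) st.
have dotZ a (u v : 'rV[R]_2) : dotv u (a *: v) = a * dotv u v.
  by rewrite !planeE; ring.
have dotD (u v v' : 'rV[R]_2) : dotv u (v + v') = dotv u v + dotv u v'.
  by rewrite !planeE; ring.
have dot0 (u : 'rV[R]_2) : dotv u 0 = 0 by rewrite !planeE !mulr0 addr0.
have E v : \sum_(e in X) w e * dotv (p v) (edge_row p e v) = 0.
  rewrite -[RHS](dot0 (p v)) -[X in dotv _ X](st v).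
  rewrite (big_morph (dotv (p v)) (dotD (p v)) (dot0 (p v))).
  by apply: eq_bigr => e _; rewrite dotZ.
transitivity (\sum_v \sum_(e in X) w e * dotv (p v) (edge_row p e v)); last first.
  exact: big1.
rewrite exchange_big /=; apply: eq_bigr => e eX; rewrite -mulr_sumr.
have [a [b [ab ->]]] := simple_edge sX eX.
rewrite (sum_edge_row (h := fun v u => dotv (p v) u)) // sqlen_set2 //.
by congr (_ * _); rewrite !planeE; ring.
Qed.

(** Pinning an edge [ab]: if the forces of [w] vanish away from [a] and [b],
they are opposite at [a] and [b] and parallel to [ab] (total force and total
torque are zero), so a single further equation makes them vanish. *)
Lemma stress_exists X (W : {set V}) p (J : finType) (g : J -> {set V} -> R) :
  simple_graph X -> injective p -> X != set0 -> cover X \subset W ->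
  (2 * #|W| + #|J| < #|X| + 3)%N ->
  exists w : {set V} -> R, [/\ exists2 e, e \in X & w e != 0, supported X w,
    stress p w & forall j, \sum_(e in X) w e * g j e = 0].
Proof.
move=> sX injp /set0Pn[e0 e0X] covW ltX.
have [a [b [ab e0E]]] := simple_edge sX e0X.
have inW e v : e \in X -> v \in e -> v \in W.
  by move=> eX ve; apply: (subsetP covW); apply/bigcupP; exists e.
have aW : a \in W by apply: (inW e0) => //; rewrite e0E set21.
have bW : b \in W by apply: (inW e0) => //; rewrite e0E set22.
pose W' := W :\ a :\ b.
have W'2 : #|W| = #|W'|.+2.
  by rewrite (cardsD1 a) aW (cardsD1 b (W :\ a)) !inE eq_sym ab bW.
pose M e (j : V * 'I_2 + option J) := match j with
  | inl vk => edge_row p e vk.1 0 vk.2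
  | inr None => dotv (edge_row p e b) (p b - p a)
  | inr (Some j) => g j e end.
pose B := [set x : V * 'I_2 + option J | if x is inl vk then vk.1 \in W' else true].
have cardB : (#|B| < #|X|)%N.
  have : (#|B| <= #|setX W' [set: 'I_2]| + #|[set: option J]|)%N.
    apply: (@leq_trans #|(inl @: setX W' [set: 'I_2]) :|: (inr @: [set: option J])|).
      apply/subset_leq_card/subsetP => -[vk|j]; rewrite !inE => vW.
        by apply/orP; left; rewrite imset_f // !inE andbT.
      by apply/orP; right; rewrite imset_f // inE.
    apply: leq_trans (leq_card_setU _ _) _.
    by apply: leq_add; apply: leq_imset_card.
  by rewrite cardsX !cardsT card_ord card_option; lia.
have [w [nzw supw eqw]] := more_unknowns M cardB.
exists w; split=> //; last by move=> j; apply: (eqw (inr (Some j))); rewrite inE.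
apply/(stressP p supw); pose f v := \sum_(e in X) w e *: edge_row p e v.
have f0 v : v != a -> v != b -> f v = 0.
  move=> va vb; have [vW|vW] := boolP (v \in W).
    apply/rowP => k; rewrite summxE mxE -[RHS](eqw (inl (v, k))) ?inE ?va ?vb //.
    by apply: eq_bigr => e _; rewrite mxE.
  rewrite /f big1 // => e eX; have [x [y [xy eE]]] := simple_edge sX eX.
  have nv z : z \in e -> (v == z) = false.
    by move=> ze; apply: contraNF vW => /eqP->; apply: inW ze.
  by rewrite eE edge_row_set2 // !nv ?eE ?set21 ?set22 // subr0 scale0r scaler0.
have sumf : f a + f b = 0.
  transitivity (\sum_v f v).
    rewrite (bigD1 a) //= (bigD1 b) 1?eq_sym //= big1 ?addr0 // => v.
    by case/andP => va vb; rewrite f0.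
  rewrite exchange_big big1 // => e eX; rewrite -scaler_sumr.
  have [x [y [xy ->]]] := simple_edge sX eX.
  by rewrite (sum_edge_row (h := fun v u => u)) // addrA subrK subrr scaler0.
have crossD (u v v' : 'rV[R]_2) : cross u (v + v') = cross u v + cross u v'.
  by rewrite /cross !mxE; ring.
have cross0 (u : 'rV[R]_2) : cross u 0 = 0 by rewrite /cross !mxE !mulr0 subr0.
have torque : cross (p a) (f a) + cross (p b) (f b) = 0.
  transitivity (\sum_v cross (p v) (f v)).
    rewrite [RHS](bigD1 a) //= (bigD1 b) 1?eq_sym //= big1 ?addr0 // => v.
    by case/andP => va vb; rewrite f0.
  transitivity (\sum_v \sum_(e in X) w e * cross (p v) (edge_row p e v)).
    apply: eq_bigr => v _; rewrite (big_morph (cross (p v)) (crossD (p v)) (cross0 (p v))).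
    by apply: eq_bigr => e _; rewrite /cross !mxE; ring.
  rewrite exchange_big big1 // => e eX; rewrite -mulr_sumr.
  have [x [y [xy ->]]] := simple_edge sX eX.
  rewrite (sum_edge_row (h := fun v u => cross (p v) u)) //.
  by apply/eqP; rewrite mulf_eq0; apply/orP; right; rewrite /cross !mxE; apply/eqP; ring.
have fa : f a = - f b by apply/eqP; rewrite -addr_eq0 sumf.
have dot0 : dotv (f b) (p b - p a) = 0.
  rewrite -[RHS](eqw (inr None)) ?inE // /f.
  have dotD (v v' : 'rV[R]_2) : dotv (v + v') (p b - p a) = dotv v (p b - p a) + dotv v' (p b - p a).
    by rewrite !planeE; ring.
  have dot0 : dotv (0 : 'rV[R]_2) (p b - p a) = 0 by rewrite !planeE; ring.
  rewrite (big_morph (fun u => dotv u (p b - p a)) dotD dot0).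
  by apply: eq_bigr => e _; rewrite /= !planeE; ring.
have fb0 : f b = 0.
  apply: dotv_eq0; have ba0 : 0 < dotv (p b - p a) (p b - p a).
    by rewrite dotv_gt0 // subr_eq0 (inj_eq injp) eq_sym.
  have : cross (f b) (p b - p a) = 0.
    by rewrite -[RHS]oppr0 -torque fa /cross; move: (f b) => z; rewrite !mxE; ring.
  have := cross_dot_sqr (f b) (p b - p a); rewrite dot0 => dist crossbb.
  move: dist; rewrite crossbb expr0n /= addr0 => /esym/eqP; rewrite mulf_eq0 (gt_eqF ba0) orbF.
  by move/eqP.
move=> v; have [->|va] := eqVneq v a; first by rewrite -/(f a) fa fb0 oppr0.
by have [->|vb] := eqVneq v b; [rewrite -/(f b) fb0 | rewrite -/(f v) f0].
Qed.

End Edges.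

Section AngleIndependence.
Variables (R : realType) (V : finType).
Implicit Types (p q y : V -> 'rV[R]_2) (e : {set V}) (E : {set {set V}}).

(** With two colors one color equation suffices, because the total of
[w e * sqlen p e] over all edges is zero for a stress; [b] is the indicator
of that color. *)
Definition angle_independent E (b : pred {set V}) p : Prop :=
  forall w, supported E w -> stress p w ->
  \sum_(e in E | b e) w e * sqlen p e = 0 -> forall e, e \in E -> w e = 0.

Definition angle_system (r : {set V} -> R) p e (j : option (V * 'I_2)) : R :=
  if j is Some vk then edge_row p e vk.1 0 vk.2 else r e.

Lemma restrict_support E (w : {set V} -> R) : exists w', supported E w' /\
  {in E, w' =1 w}.
Proof.
by exists (fun e => if e \in E then w e else 0); split=> e; [move/negPf-> | move->].
Qed.

(** The factor [s] covers the column of a framework [s *: p]. *)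
Lemma angle_independentP E (b : pred {set V}) p (r : {set V} -> R) (s : R) : s != 0 ->
  {in E, forall e, r e = (b e)%:R * (s * sqlen p e)} ->
  angle_independent E b p <-> rows_independent E (angle_system r p).
Proof.
move=> s0 rE.
have colE (w : {set V} -> R) :
    \sum_(e in E) w e * r e = s * \sum_(e in E | b e) w e * sqlen p e.
  rewrite [in RHS]big_mkcondr mulr_sumr; apply: eq_bigr => e eE; rewrite rE //.
  by case: (b e); rewrite ?mul0r ?mulr0 // mul1r mulrCA.
split=> ind w.
  move=> wM; have [w' [supw' w'E]] := restrict_support E w.
  move=> e eE; rewrite -w'E //; apply: (ind w') => //.
    apply/(stressP p supw') => v; apply/rowP => k; rewrite summxE mxE.
    rewrite -[RHS](wM (Some (v, k))); apply: eq_bigr => i iE.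
    by rewrite mxE w'E.
  apply: (mulfI s0); rewrite mulr0 -colE -[RHS](wM None).
  by apply: eq_bigr => i iE; rewrite w'E.
move=> supw /(stressP p supw) st bal; apply: ind => -[[v k]|] /=.
  move/rowP: (st v) => /(_ k); rewrite summxE [RHS]mxE; apply: etrans.
  by apply: eq_bigr => e _; rewrite mxE.
by rewrite colE bal mulr0.
Qed.

Lemma polyfun_edge_row e v k : polyfun (fun p : V -> 'rV[R]_2 => edge_row p e v 0 k).
Proof.
apply: (@polyfun_ext _ _ (fun p =>
    \sum_w (e == [set v; w])%:R * (p v 0 k + - p w 0 k))) => [p|].
  by rewrite summxE; apply: eq_bigr => w _; rewrite !mxE.
apply: polyfun_sum => w; apply: polyfunM; first exact: polyfun_const.
by apply: polyfunD; [|apply: polyfunN]; apply: polyfun_coord.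
Qed.

Lemma polyfun_diff v w k : polyfun (fun p : V -> 'rV[R]_2 => (p v - p w) 0 k).
Proof.
apply: (@polyfun_ext _ _ (fun p => p v 0 k + - p w 0 k)) => [p|]; first by rewrite !mxE.
by apply: polyfunD; [|apply: polyfunN]; apply: polyfun_coord.
Qed.

Lemma polyfun_dotv (f g : (V -> 'rV[R]_2) -> 'rV[R]_2) :
  (forall k, polyfun (fun p => f p 0 k)) -> (forall k, polyfun (fun p => g p 0 k)) ->
  polyfun (fun p => dotv (f p) (g p)).
Proof. by move=> pf pg; apply: polyfun_sum => k; apply: polyfunM. Qed.

Lemma polyfun_cross (f g : (V -> 'rV[R]_2) -> 'rV[R]_2) :
  (forall k, polyfun (fun p => f p 0 k)) -> (forall k, polyfun (fun p => g p 0 k)) ->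
  polyfun (fun p => cross (f p) (g p)).
Proof.
by move=> pf pg; apply: polyfunD; [|apply: polyfunN]; apply: polyfunM.
Qed.

Lemma polyfun_sqlen e : polyfun (fun p : V -> 'rV[R]_2 => sqlen p e).
Proof.
rewrite /sqlen; case: (enum e) => [|a [|b [|? ?]]]; try exact: polyfun_const.
by apply: polyfun_dotv => k; apply: polyfun_diff.
Qed.

(** By [polyfun_generic], this makes angle independence at one point compatible
with every other generic condition. *)
Lemma angle_independent_polyfun E b p0 : angle_independent E b p0 ->
  exists F, [/\ polyfun F, F p0 != 0 & forall p, F p != 0 -> angle_independent E b p].
Proof.
pose r p e := (b e)%:R * (1 * sqlen p e).
have P p := @angle_independentP E b p (r p) 1 (oner_neq0 R) (fun e _ => erefl).
move=> /P ind0.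
have [|F [pF F0 indF]] := polyfun_rows_independent
  (M := fun p => angle_system (r p) p) _ ind0.
  move=> e [[v k]|]; first exact: polyfun_edge_row.
  apply: polyfunM; first exact: polyfun_const.
  by apply: polyfunM; [exact: polyfun_const | exact: polyfun_sqlen].
by exists F; split=> // p /indF/P.
Qed.

Lemma angle_independent_generic E b G : polyfun G -> (exists p, G p != 0) ->
  (exists p, angle_independent E b p) -> exists p, angle_independent E b p /\ G p != 0.
Proof.
move=> pG Gp [p0 /angle_independent_polyfun[F [pF F0 indF]]].
have [|p [Fp Gp']] := polyfun_generic pF pG _ Gp; first by exists p0.
by exists p; split; first exact: indF.
Qed.

Lemma row_freeP0 m n (A : 'M[R]_(m, n)) :
  row_free A <-> forall u : 'rV_m, u *m A = 0 -> u = 0.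
Proof.
rewrite -kermx_eq0; split=> [/eqP k0 u /sub_kermxP|inj].
  by rewrite k0 submx0 => /eqP.
by apply/rowV0P => v /sub_kermxP/inj.
Qed.

Lemma independentP (K : finType) E (c : {set V} -> K) k0 p :
  simple_graph E -> #|c @: E| = 2%N -> k0 \in c @: E ->
  independent E c p <-> angle_independent E (fun e => c e == k0) p.
Proof.
move=> sE C2 k0C; rewrite /independent; set A := angle_rigidity_mx E c p.
have rigE (u : 'rV_#|E|) w : (forall i, w (enum_val i) = u 0 i) -> forall v k,
    (u *m rigidity_mx E p) 0 (mxvec_index (enum_rank v) k) =
    \sum_(e in E) w e * edge_row p e v 0 k.
  move=> wE v k; rewrite mxE [RHS]big_enum_val; apply: eq_bigr => i _.
  by rewrite wE mxE rigidity_rowE // sE ?enum_valP.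
have colE (u : 'rV_#|E|) w : (forall i, w (enum_val i) = u 0 i) -> forall j,
    (u *m color_mx E c p) 0 j =
    - \sum_(e in E | c e == enum_val j) w e * sqlen p e.
  move=> wE j; rewrite mxE [in RHS]big_mkcondr [in RHS]big_enum_val -sumrN.
  apply: eq_bigr => i _; rewrite wE mxE; case: ifP; rewrite ?mulr0 ?oppr0 //.
  by rewrite mulrN.
have kerE (u : 'rV_#|E|) w : (forall i, w (enum_val i) = u 0 i) -> supported E w ->
    u *m A = 0 <-> stress p w /\
      forall k, k \in c @: E -> \sum_(e in E | c e == k) w e * sqlen p e = 0.
  move=> wE supw; rewrite /A /angle_rigidity_mx mul_mx_row; split.
    rewrite -[0]row_mx0 => /eq_row_mx[/rowP uR /rowP uM]; split=> [|k kC].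
      apply/(stressP p supw) => v; apply/rowP => k; rewrite summxE mxE.
      have := uR (mxvec_index (enum_rank v) k); rewrite (rigE u w) // mxE.
      by apply: etrans; apply: eq_bigr => e _; rewrite mxE.
    have := uM (enum_rank_in kC k); rewrite (colE u w) // enum_rankK_in // mxE.
    by move/eqP; rewrite oppr_eq0 => /eqP.
  move=> [/(stressP p supw) st bal]; rewrite -[RHS]row_mx0; congr row_mx.
    apply/rowP; case/mxvec_indexP => i k; rewrite -[i]enum_valK (rigE u w) // mxE.
    move/rowP/(_ k): (st (enum_val i)); rewrite summxE [RHS]mxE; apply: etrans.
    by apply: eq_bigr => e _; rewrite mxE.
  by apply/rowP => j; rewrite (colE u w) // bal ?enum_valP // oppr0 mxE.
split=> [/row_freeP0 freeA w supw st bal e eE|ind].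
  pose u := \row_(i < #|E|) w (enum_val i).
  have uE i : w (enum_val i) = u 0 i by rewrite mxE.
  suff u0 : u = 0.
    by move/rowP/(_ (enum_rank_in eE e)): u0; rewrite !mxE enum_rankK_in.
  apply: freeA; apply/(kerE u w) => //; split=> // k kC.
  have [->//|kk0] := eqVneq k k0.
  have := stress_sqlen sE supw st; rewrite (bigID (fun e => c e == k0)) /= bal add0r.
  apply: etrans; apply: eq_bigl => f; case fE: (f \in E) => //=.
  have fC : c f \in c @: E by rewrite imset_f.
  have cE : c @: E = [set k; k0].
    apply/esym/eqP; rewrite eqEcard C2 cards2 kk0 leqnn andbT.
    by apply/subsetP => x /set2P[]->.
  move: fC; rewrite cE => /set2P[]->; last by rewrite eqxx eq_sym (negPf kk0).
  by rewrite eqxx kk0.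
apply/row_freeP0 => u uA; have [w [wE supw]] := extend_row u.
have [st bal] := (kerE u w wE supw).1 uA.
apply/rowP => i; rewrite -wE mxE; apply: (ind w) => //; last exact: enum_valP.
exact: bal.
Qed.

End AngleIndependence.

(** * Motions that rotate the edges of each color by a common angle *)

Section Motions.
Variables (R : realType) (V : finType).
Implicit Types (p q y : V -> 'rV[R]_2) (e : {set V}) (E : {set {set V}}).

Lemma dotv_quarter_turn (u v : 'rV[R]_2) : dotv (quarter_turn u) v = cross u v.
Proof. by rewrite /cross !planeE; ring. Qed.

(** The rigidity row turned by a right angle: in the plane, the quarter turns of
the infinitesimal motions of [p] are the fields along which [p] can be redrawn
with parallel edges. *)
Definition parallel_system p e (vk : V * 'I_2) : R :=
  quarter_turn (edge_row p e vk.1) 0 vk.2.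

(** The extra unknown is the tangent of the angle by which the edges of the
second color are turned relative to those of the first. *)
Definition motion_system p (r : {set V} -> R) e (j : option (V * 'I_2)) : R :=
  if j is Some vk then parallel_system p e vk else r e.

Definition field_coords y (vk : V * 'I_2) : R := y vk.1 0 vk.2.

Definition motion_coords y (t : R) (j : option (V * 'I_2)) : R :=
  if j is Some vk then field_coords y vk else t.

Lemma parallel_systemE p y a b : a != b ->
  \sum_vk parallel_system p [set a; b] vk * field_coords y vk
    = cross (p a - p b) (y a - y b).
Proof.
move=> ab; transitivity (\sum_v cross (edge_row p [set a; b] v) (y v)).
  rewrite -(pair_big xpredT xpredT (fun v k =>
    quarter_turn (edge_row p [set a; b] v) 0 k * y v 0 k)) /=.
  by apply: eq_bigr => v _; rewrite -dotv_quarter_turn.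
rewrite (sum_edge_row (h := fun v u => cross u (y v))) // => [|v].
  by rewrite /cross !mxE; ring.
by rewrite /cross !mxE; ring.
Qed.

Lemma edge_row_dot p y a b : a != b ->
  \sum_vk edge_row p [set a; b] vk.1 0 vk.2 * field_coords y vk
    = dotv (p a - p b) (y a - y b).
Proof.
move=> ab; transitivity (\sum_v dotv (edge_row p [set a; b] v) (y v)).
  by rewrite -(pair_big xpredT xpredT (fun v k => edge_row p [set a; b] v 0 k * y v 0 k)).
rewrite (sum_edge_row (h := fun v u => dotv u (y v))) // => [|v].
  by rewrite !planeE; ring.
by rewrite !planeE; ring.
Qed.

Lemma sum_option (I : finType) (F : option I -> R) :
  \sum_j F j = F None + \sum_i F (Some i).
Proof.
rewrite (bigD1 None) //=; congr (_ + _).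
rewrite (reindex_omap Some id) => [|[i|]] //=.
by apply: eq_bigl => i; rewrite eqxx.
Qed.

Lemma motion_systemE p r y t a b : a != b ->
  \sum_j motion_system p r [set a; b] j * motion_coords y t j
    = cross (p a - p b) (y a - y b) + r [set a; b] * t.
Proof. by move=> ab; rewrite sum_option addrC /= parallel_systemE. Qed.

Lemma motion_system_independent E p r :
  rows_independent E (angle_system r p) -> rows_independent E (motion_system p r).
Proof.
move=> ind w wM; apply: ind => -[[v k]|] /=; last exact: (wM None).
case: (ord2_cases k) => ->.
  rewrite -[RHS](wM (Some (v, 1))); apply: eq_bigr => e _.
  by rewrite /= /parallel_system quarter_turn1.
rewrite -[RHS]oppr0 -[in RHS](wM (Some (v, 0))) -sumrN; apply: eq_bigr => e _.
by rewrite /= /parallel_system quarter_turn0 mulrN opprK.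
Qed.

(** The velocity fields of the dilations from the origin and of the translations. *)
Definition trivial_motion p (d : option 'I_2) : V -> 'rV[R]_2 :=
  if d is Some k then fun=> delta_mx 0 k else p.

Lemma trivial_motion_cross p d a b :
  cross (p a - p b) (trivial_motion p d a - trivial_motion p d b) = 0.
Proof.
by case: d => [k|] /=; rewrite ?subrr /cross ?mxE; ring.
Qed.

Lemma trivial_motion_combination p (a : option 'I_2 -> R) v k :
  \sum_d a d * trivial_motion p d v 0 k = a None * p v 0 k + a (Some k).
Proof.
rewrite sum_option (bigD1 k) //= mxE !eqxx mulr1 big1 ?addr0 // => l lk.
by rewrite mxE eqxx /= eq_sym (negPf lk) mulr0.
Qed.

Lemma trivial_motion_free p a b (c : option 'I_2 -> R) : p a != p b ->
  (forall v k, \sum_d c d * trivial_motion p d v 0 k = 0) -> forall d, c d = 0.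
Proof.
move=> pab c0; have cN : c None = 0.
  apply/eqP; apply: contraNT pab => cN; apply/eqP/rowP => k.
  apply: (mulfI cN); apply: (addIr (c (Some k))).
  by rewrite -!trivial_motion_combination !c0.
by case=> // k; rewrite -(c0 a k) trivial_motion_combination cN mul0r add0r.
Qed.

Lemma similar_spin p q g h z : g ^+ 2 + h ^+ 2 != 0 ->
  (forall v, q v = spin g h (p v) + z) -> Defs.similar p q.
Proof.
move=> gh0 qE; have gh : 0 < g ^+ 2 + h ^+ 2.
  by rewrite lt_def gh0 addr_ge0 ?sqr_ge0.
pose l := Num.sqrt (g ^+ 2 + h ^+ 2); have l0 : 0 < l by rewrite sqrtr_gt0.
pose Q : 'M[R]_2 := \matrix_(i, j) (quarter_turn (delta_mx 0 i)) 0 j.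
have QE (u : 'rV[R]_2) : u *m Q = quarter_turn u.
  by apply: plane_eq; rewrite ![(_ *m _) 0 _]mxE sum_ord2 !mxE /=; ring.
pose T := mulmxr (l^-1 *: (g *: 1%:M + h *: Q)) : {linear 'rV[R]_2 -> 'rV[R]_2}.
have TE u : T u = l^-1 *: spin g h u.
  by rewrite /T /= -scalemxAr mulmxDr -!scalemxAr mulmx1 QE.
exists T, z, l; split=> // [u|v]; last first.
  by rewrite TE scalerA divff ?gt_eqF // scale1r qE.
have -> : T u = spin (l^-1 * g) (l^-1 * h) u.
  by rewrite TE /spin scalerDr !scalerA.
rewrite enorm_spin !exprMn -mulrDr sqrtrM ?sqr_ge0 // sqrtr_sqr.
by rewrite ger0_norm ?invr_ge0 ?ltW // mulVf ?mul1r // gt_eqF.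
Qed.

(** Each edge of [q] is a nonzero multiple of the same edge of [p] multiplied by
the complex number [1 + tau i], and [line_cos] is invariant under both. *)
Lemma angle_equivalent_turned (K : finType) E (c : {set V} -> K) (tau : K -> R) p q :
  simple_graph E -> realization p -> realization q ->
  (forall a b, a != b -> [set a; b] \in E ->
    cross (p a - p b) (q a - q b) = tau (c [set a; b]) * dotv (p a - p b) (q a - q b)) ->
  angle_equivalent E c p q.
Proof.
move=> sE injp injq turned v w x y vwE xyE cE.
have ne a b : [set a; b] \in E -> a != b.
  by move/sE; rewrite cards2; case: (a == b).
have turnE a b : [set a; b] \in E -> exists2 l, l != 0 &
    q a - q b = l *: spin 1 (tau (c [set a; b])) (p a - p b).
  move=> abE; have ab := ne a b abE.
  have P0 : spin 1 (tau (c [set a; b])) (p a - p b) != 0.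
    apply/negP => /eqP/(congr1 (@enorm R)); rewrite enorm_spin.
    have -> : enorm (0 : 'rV[R]_2) = 0 by rewrite /enorm !planeE !mulr0 addr0 sqrtr0.
    apply/eqP; rewrite mulf_neq0 // ?gt_eqF ?enorm_gt0 ?subr_eq0 ?inj_eq //.
    by rewrite sqrtr_gt0; have := sqr_ge0 (tau (c [set a; b])); lra.
  eexists; last first.
    apply: cross0_parallel => //.
    rewrite /spin /cross; have := turned a b ab abE; rewrite /cross dotvE.
    by rewrite !mxE /=; lra.
  apply: (contraTneq _ ab) => l0; rewrite negbK -(inj_eq injq) -subr_eq0.
  have : cross (spin 1 (tau (c [set a; b])) (p a - p b)) (q a - q b) = 0.
    rewrite /spin /cross; have := turned a b ab abE; rewrite /cross dotvE.
    by rewrite !mxE /=; lra.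
  by move/(cross0_parallel P0) ->; rewrite l0 scale0r.
have [l l0 ->] := turnE v w vwE; have [m m0 ->] := turnE x y xyE.
rewrite line_cos_scale // -cE line_cos_spin //.
by rewrite gt_eqF //; have := sqr_ge0 (tau (c [set v; w])); lra.
Qed.

(* As for sqlen, exchanging the two ends does not change the value. *)
Definition edge_dot p q e : R :=
  if enum e is [:: v; w] then dotv (p v - p w) (q v - q w) else 0.

Lemma edge_dot_set2 p q a b : a != b ->
  edge_dot p q [set a; b] = dotv (p a - p b) (q a - q b).
Proof.
move=> ab; rewrite /edge_dot; case: (enum_set2 ab) => -> //.
by rewrite !planeE; ring.
Qed.

End Motions.

Section Rigidity.
Variables (R : realType) (V K : finType) (E : {set {set V}}) (c : {set V} -> K).
Variables (k1 k2 : K).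
Hypotheses (sE : simple_graph E) (C12 : c @: E = [set k1; k2]) (k12 : k1 != k2).
Implicit Types p q : V -> 'rV[R]_2.

Let colorP e : e \in E -> c e = k1 \/ c e = k2.
Proof. by move=> eE; have := imset_f c eE; rewrite C12 => /set2P. Qed.

Let color_edge k : k \in [set k1; k2] -> exists a b, [/\ a != b, [set a; b] \in E
  & c [set a; b] = k].
Proof.
rewrite -C12 => /imsetP[e eE ->]; have [a [b [ab eab]]] := simple_edge sE eE.
by exists a, b; rewrite -eab.
Qed.

Let edge_neq a b : [set a; b] \in E -> a != b.
Proof. by move/sE; rewrite cards2; case: (a == b). Qed.

(** A nearby equivalent framework turns each color by a common angle.  After
turning the first color back, the framework [q'] and the tangent [t] of the
relative angle solve the motion system of [q']; its rows are
independent near [p], so its only solutions are the trivial ones. *)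
Lemma angle_independent_rigid p : realization p ->
  #|E| = (2 * #|V| - 2)%N -> angle_independent E (fun e => c e == k2) p ->
  locally_angle_rigid E c p.
Proof.
move=> injp cardE ind.
have [a1 [b1 [ab1 abE1 c1]]] := color_edge (set21 _ _).
have [a2 [b2 [ab2 abE2 c2]]] := color_edge (set22 _ _).
pose A a b q := dotv (p a - p b) (q a - q b).
pose B a b q := cross (p a - p b) (q a - q b).
have lipA a b : lipschitz p (A a b).
  by apply: lipschitz_dotv => k; [exact: lipschitz_const | exact: lipschitz_diff].
have lipB a b : lipschitz p (B a b).
  by apply: lipschitz_cross => k; [exact: lipschitz_const | exact: lipschitz_diff].
have App a b : a != b -> 0 < A a b p.
  by move=> ab; rewrite dotv_gt0 // subr_eq0 (inj_eq injp).
have Bpp a b : B a b p = 0 by rewrite /B /cross; ring.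
pose turn q v := spin (A a1 b1 q) (- B a1 b1 q) (q v).
have turn_p v : turn p v = A a1 b1 p *: p v.
  by rewrite /turn Bpp oppr0 /spin scale0r addr0.
pose r q e := - (c e == k2)%:R * edge_dot p (turn q) e.
have ind_near : nearby p (fun q => rows_independent E (motion_system p (r q))).
  apply: lipschitz_rows_independent => [e [vk|] eE|].
  - exact: lipschitz_const.
  - have [a [b [ab eab]]] := simple_edge sE eE.
    apply: lipschitzM; first exact: lipschitz_const.
    rewrite eab; apply: (@lipschitz_ext _ _ _ (fun q =>
        A a1 b1 q * A a b q + B a1 b1 q * B a b q)) => [q|].
      rewrite edge_dot_set2 // /turn /A /B /spin /cross !planeE; ring.
    by apply: lipschitzD; apply: lipschitzM.
  apply: motion_system_independent.
  apply/(@angle_independentP _ _ _ _ _ _ (- A a1 b1 p)); last exact: ind.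
    by rewrite oppr_eq0 gt_eqF // App.
  move=> e eE; have [a [b [ab ->]]] := simple_edge sE eE.
  rewrite /r edge_dot_set2 // sqlen_set2 // !turn_p -scalerBr.
  have -> : dotv (p a - p b) (A a1 b1 p *: (p a - p b)) =
      A a1 b1 p * dotv (p a - p b) (p a - p b).
    by move: (A a1 b1 p) (p a - p b) => s u; rewrite !planeE; ring.
  by rewrite !mulNr mulrN.
have sgn_near : nearby p (fun q => forall vwxy : V * V * (V * V),
    let: (v, w, (x, y)) := vwxy in
    (dotv (p v - p w) (p x - p y) != 0 ->
      0 < dotv (p v - p w) (p x - p y) * dotv (q v - q w) (q x - q y)) /\
    (cross (p v - p w) (p x - p y) != 0 ->
      0 < cross (p v - p w) (p x - p y) * cross (q v - q w) (q x - q y))).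
  apply: nearby_all => -[[v w] [x y]]; apply: nearby_and.
    apply: (@lipschitz_sign _ _ _ (fun q => dotv (q v - q w) (q x - q y))).
    by apply: lipschitz_dotv => k; apply: lipschitz_diff.
  apply: (@lipschitz_sign _ _ _ (fun q => cross (q v - q w) (q x - q y))).
  by apply: lipschitz_cross => k; apply: lipschitz_diff.
have g_near : nearby p (fun q => 0 < A a1 b1 q * A a2 b2 q + B a1 b1 q * B a2 b2 q).
  apply: lipschitz_positive; first by apply: lipschitzD; apply: lipschitzM.
  by rewrite Bpp mul0r addr0 mulr_gt0 ?App.
have [eps eps0 near] := nearby_and ind_near (nearby_and sgn_near g_near).
exists eps => // q injq /near{near}[indq [sgn g0]] equiv.
have tangent v w x y : [set v; w] \in E -> [set x; y] \in E ->
    c [set v; w] = c [set x; y] -> A v w q * B x y q = B v w q * A x y q.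
  move=> vwE xyE cE; have := equiv v w x y vwE xyE cE.
  have vw := edge_neq vwE; have xy := edge_neq xyE.
  have [sD sX] := sgn (v, w, (x, y)).
  move=> cosE; have := line_cos_tangent _ _ _ _ cosE sD sX.
  rewrite !subr_eq0 !(inj_eq injp) !(inj_eq injq) => /(_ vw xy vw xy) DX.
  have := cross_dot_rotation (p v - p w) (p x - p y) (q v - q w) (q x - q y).
  by rewrite DX subrr => /esym/eqP; rewrite subr_eq0 => /eqP.
pose x1 := A a1 b1 q; pose y1 := B a1 b1 q; pose x2 := A a2 b2 q; pose y2 := B a2 b2 q.
rewrite -/x1 -/y1 -/x2 -/y2 in g0.
pose t := (x1 * y2 - y1 * x2) / (x1 * x2 + y1 * y2).
have cross_turn a b : cross (p a - p b) (turn q a - turn q b)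
    = x1 * B a b q - y1 * A a b q.
  by rewrite /turn -/x1 -/y1 /A /B /spin /cross !planeE; ring.
have dot_turn a b : dotv (p a - p b) (turn q a - turn q b)
    = x1 * A a b q + y1 * B a b q.
  by rewrite /turn -/x1 -/y1 /A /B /spin /cross !planeE; ring.
have sol : solution E (motion_system p (r q)) (motion_coords (turn q) t).
  move=> e eE; have [a [b [ab eab]]] := simple_edge sE eE; rewrite eab in eE *.
  rewrite motion_systemE // /r edge_dot_set2 // cross_turn dot_turn.
  case: (colorP eE) => ce; rewrite ce.
    rewrite (negPf k12) oppr0 !mul0r addr0; apply/eqP; rewrite subr_eq0; apply/eqP.
    by apply: tangent; rewrite ?ce.
  have tan2 : x2 * B a b q = y2 * A a b q by apply: tangent; rewrite ?ce.
  rewrite eqxx mulN1r; apply: (mulIf (lt0r_neq0 g0)).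
  rewrite mul0r mulrDl -mulrA /t divfK ?lt0r_neq0 //.
  transitivity ((x1 ^+ 2 + y1 ^+ 2) * (x2 * B a b q - y2 * A a b q)); first ring.
  by rewrite tan2 subrr mulr0.
pose triv d : option (V * 'I_2) -> R := motion_coords (trivial_motion p d) 0.
have pab : p a1 != p b1 by rewrite (inj_eq injp).
have [a aE] : combination triv (motion_coords (turn q) t).
  apply: solution_combination indq _ sol => [d e eE|w w0 d _|].
  - have [a [b [ab ->]]] := simple_edge sE eE.
    by rewrite motion_systemE // trivial_motion_cross mulr0 addr0.
  - apply: (trivial_motion_free pab) => v k.
    rewrite -[RHS](w0 (Some (v, k))); apply: eq_bigl => i; by rewrite inE.
  by rewrite !card_option card_prod !card_ord cardE; clear; lia.
have qE v k : turn q v 0 k = a None * p v 0 k + a (Some k).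
  rewrite -trivial_motion_combination; exact: (aE (Some (v, k))).
have n0 : x1 ^+ 2 + y1 ^+ 2 != 0.
  apply: contraTneq g0 => n0; suff [-> ->] : x1 = 0 /\ y1 = 0.
    by rewrite !mul0r addr0 ltxx.
  have := sqr_ge0 x1; have := sqr_ge0 y1 => y0 x0.
  by split; apply/eqP; rewrite -sqrf_eq0; apply/eqP; lra.
have aN : a None != 0.
  apply: (contraTneq _ ab1) => aN; rewrite negbK -(inj_eq injq); apply/eqP.
  have tq : turn q a1 = turn q b1 by apply/rowP => k; rewrite !qE aN !mul0r.
  have back u : spin x1 y1 (spin x1 (- y1) u) = (x1 ^+ 2 + y1 ^+ 2) *: u :> 'rV[R]_2.
    by apply: plane_eq; rewrite /spin !mxE /=; ring.
  have := congr1 (spin x1 y1) tq; rewrite /turn -/x1 -/y1 !back => E'.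
  by apply: (scalerI n0).
pose n := x1 ^+ 2 + y1 ^+ 2.
apply: (@similar_spin _ _ _ _ (a None * x1 / n) (a None * y1 / n)
   (n^-1 *: spin x1 y1 (\row_k a (Some k)))).
  have -> : (a None * x1 / n) ^+ 2 + (a None * y1 / n) ^+ 2 = a None ^+ 2 / n.
    by rewrite /n; field.
  by rewrite mulf_neq0 ?invr_eq0 ?sqrf_eq0.
move=> v; have tv : turn q v = a None *: p v + \row_k a (Some k).
  by apply/rowP => k; rewrite qE !mxE.
apply: (scalerI n0); rewrite scalerDr scalerA divff // scale1r.
have -> : (x1 ^+ 2 + y1 ^+ 2) *: q v = spin x1 y1 (turn q v).
  by apply: plane_eq; rewrite /turn -/x1 -/y1 /spin !mxE /=; ring.
rewrite tv; apply: plane_eq; rewrite /spin !mxE /= /n; field; exact: n0.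
Qed.

(** With too few edges either the parallel redrawings of [p] are not all
trivial, or the parallel system is surjective and, for a small [t], there
is a redrawing near [p] that turns the second color by the angle with tangent
[t].  Two edges that keep their directions force a similarity to be a dilation
followed by a translation, which turns no edge and is a trivial redrawing. *)
Lemma few_edges_flexible p a b a' b' : realization p -> (#|E| + 3 <= 2 * #|V|)%N ->
  a != b -> [set a; b] \in E -> a' != b' -> [set a'; b'] \in E ->
  ((#|E| + 3)%N = (2 * #|V|)%N -> c [set a; b] = k1 /\ c [set a'; b'] = k1) ->
  cross (p a - p b) (p a' - p b') != 0 -> dotv (p a - p b) (p a' - p b') != 0 ->
  ~ locally_angle_rigid E c p.
Proof.
move=> injp leE ab abE ab' abE' cE crossP dotP [eps eps0 rigid].
have [eps' eps'0 inj_near] := nearby_realization injp.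
pose d := Num.min eps eps'; have d0 : 0 < d by rewrite lt_min eps0.
(* The tangent of the angle by which the edges of color k are turned. *)
pose tau t k : R := if k == k1 then 0 else t.
have scaled q t : (t = 0 \/ (#|E| + 3)%N = (2 * #|V|)%N) ->
    (forall v, enorm (q v - p v) < d) ->
    (forall x y, x != y -> [set x; y] \in E -> cross (p x - p y) (q x - q y)
       = tau t (c [set x; y]) * dotv (p x - p y) (q x - q y)) ->
    exists m z, m != 0 /\ forall v, q v = m *: p v + z.
  move=> t_or close turned.
  have injq : realization q.
    by apply: inj_near => v; have := close v; rewrite lt_min => /andP[].
  have [||T [z [l [isoT l0 qE]]]] := rigid q injq.
  - by move=> v; have := close v; rewrite lt_min => /andP[].
  - exact: (@angle_equivalent_turned _ _ _ _ _ (tau t)).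
  have eigen x y : x != y -> [set x; y] \in E -> tau t (c [set x; y]) = 0 ->
      exists m, T (p x - p y) = m *: (p x - p y).
    move=> xy xyE tau0; have := turned x y xy xyE; rewrite tau0 mul0r.
    move/cross0_parallel; rewrite subr_eq0 (inj_eq injp) => /(_ xy).
    set m := _ / _ => qxy; exists (l^-1 * m).
    rewrite -scalerA -qxy !qE linearB opprD addrACA subrr addr0 -scalerBr scalerA.
    by rewrite mulVf ?scale1r ?gt_eqF.
  have [tau1 tau2] : tau t (c [set a; b]) = 0 /\ tau t (c [set a'; b']) = 0.
    case: t_or => [->|/cE[-> ->]]; rewrite /tau ?eqxx //.
    by split; case: ifP.
  have [m1 T1] := eigen _ _ ab abE tau1; have [m2 T2] := eigen _ _ ab' abE' tau2.
  have [m1sq TE] := isometry_scalar isoT T1 T2 crossP dotP.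
  exists (l * m1), z; split; last by move=> v; rewrite qE TE scalerA.
  apply: mulf_neq0; first exact: lt0r_neq0.
    by apply/eqP => m0; move/eqP: m1sq; rewrite m0 expr0n /= eq_sym oner_eq0.
pose triv d := field_coords (trivial_motion p d).
have pab : p a != p b by rewrite (inj_eq injp).
have sol_triv d' : solution E (parallel_system p) (triv d').
  move=> e eE; have [x [y [xy ->]]] := simple_edge sE eE.
  by rewrite parallel_systemE // trivial_motion_cross.
have free_triv : rows_independent [set: option 'I_2] triv.
  move=> w w0 d' _; apply: (trivial_motion_free pab) => v k.
  by rewrite -[RHS](w0 (v, k)); apply: eq_bigl => i; rewrite inE.
have [|[indp cardE]|[f sol_f]] := independent_or_solution (A := E) (parallel_system p) free_triv.
- by rewrite card_option card_prod !card_ord; move: leE; clear; lia.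
(* The flex equation is cross P Q = t * dot P Q on the second color. *)
- pose N e (vk : V * 'I_2) := - (c e == k2)%:R * edge_row p e vk.1 0 vk.2.
  have [|del del0 flex] := solution_perturbed N indp (sol_triv None) (eps := d / 2).
    by rewrite divr_gt0.
  have [t t0 t_del] : exists2 t, 0 < t & `|t| < del.
    by exists (del / 2); rewrite ?gtr0_norm ?divr_gt0 //; lra.
  have [qf q_close sol_q] := flex t t_del.
  pose q v : 'rV[R]_2 := \row_k qf (v, k).
  have turned x y : x != y -> [set x; y] \in E -> cross (p x - p y) (q x - q y)
       = tau t (c [set x; y]) * dotv (p x - p y) (q x - q y).
    move=> xy xyE; have := sol_q _ xyE.
    under eq_bigr => vk _ do rewrite mulrDl -mulrA.
    rewrite big_split /= -mulr_sumr.
    have fE vk : qf vk = field_coords q vk.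
      by case: vk => v k; rewrite /field_coords mxE.
    under eq_bigr => vk _ do rewrite fE.
    rewrite parallel_systemE //.
    under eq_bigr => vk _ do rewrite fE /N -mulrA.
    rewrite -mulr_sumr edge_row_dot // => /eqP; rewrite addr_eq0 => /eqP ->.
    rewrite /tau; case: (colorP xyE) => ->; last first.
      by rewrite eqxx eq_sym (negPf k12) mulN1r mulrN opprK.
    by rewrite eqxx (negPf k12) oppr0 !mul0r mulr0 oppr0.
  have [||m [z [m0 qE]]] := scaled q t _ _ turned.
  - right; move: cardE; rewrite card_option card_prod !card_ord; clear; lia.
  - move=> v; apply: le_lt_trans (enorm_le_coords _) _.
    have := q_close (v, 0); have := q_close (v, 1).
    by rewrite /triv /field_coords /= !mxE; lra.
  have [x [y [xy xyE cxy]]] := color_edge (set22 _ _).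
  have := turned x y xy xyE; rewrite cxy /tau eq_sym (negPf k12).
  have -> : q x - q y = m *: (p x - p y) by rewrite !qE opprD addrACA subrr addr0 -scalerBr.
  have -> : cross (p x - p y) (m *: (p x - p y)) = 0 by rewrite /cross !mxE; ring.
  have -> : dotv (p x - p y) (m *: (p x - p y)) = m * dotv (p x - p y) (p x - p y).
    by move: (p x - p y) => u; rewrite !planeE; ring.
  move/esym/eqP; rewrite !mulf_eq0 (gt_eqF t0) (negPf m0) /=.
  by rewrite gt_eqF // dotv_gt0 // subr_eq0 (inj_eq injp).
case; pose y v : 'rV[R]_2 := \row_k f (v, k).
pose S := 1 + \sum_v enorm (y v).
have S0 : 0 < S by rewrite ltr_pwDl // sumr_ge0 // => v _; apply: enorm_ge0.
pose s := d / S; have s0 : 0 < s by rewrite divr_gt0.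
pose q v := p v + s *: y v.
have [||x w xw xwE|m [z [m0 qE]]] := scaled q 0; first by left.
- move=> v; rewrite /q addrAC subrr add0r.
  have -> : s *: y v = spin s 0 (y v) by rewrite /spin scale0r addr0.
  rewrite enorm_spin expr0n /= addr0 sqrtr_sqr gtr0_norm // /s mulrAC ltr_pdivrMr //.
  rewrite ltr_pM2l // /S (bigD1 v) //=.
  have : 0 <= \sum_(i | i != v) enorm (y i) by apply: sumr_ge0 => i _; apply: enorm_ge0.
  by have := enorm_ge0 (y v); lra.
- rewrite /tau if_same mul0r.
  have := sol_f _ xwE; have fE vk : f vk = field_coords y vk.
    by case: vk => v k; rewrite /field_coords mxE.
  under eq_bigr => vk _ do rewrite fE.
  rewrite parallel_systemE // => y0.
  have -> : q x - q w = p x - p w + s *: (y x - y w).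
    by rewrite /q opprD addrACA -scalerBr.
  transitivity (s * cross (p x - p w) (y x - y w)); last by rewrite y0 mulr0.
  by rewrite /cross !mxE; ring.
exists (fun d' => if d' is Some k then s^-1 * z 0 k else s^-1 * (m - 1)) => -[v k].
rewrite /triv /field_coords trivial_motion_combination /=.
have := congr1 (fun u : 'rV[R]_2 => u 0 k) (qE v); rewrite /q !mxE => E'.
by apply: (mulfI (lt0r_neq0 s0)); rewrite mulrDr !mulrA divff ?lt0r_neq0 // !mul1r; lra.
Qed.

End Rigidity.

(** * Circuits of the count matroid *)

(* Generalizing the cardinals identifies those that are convertible without
being syntactically equal. *)
Ltac card_lia :=
  repeat match goal with
  | H : is_true (leq _ _) |- _ => revert H
  | H : @eq nat _ _ |- _ => revert H
  | H : is_true (~~ (@eq_op _ _ _)) |- _ => revert H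
  end;
  repeat match goal with
  | |- context [@card.body ?T ?A] => move: (@card.body T A) => ?
  end; clear; lia.

Section Circuits.
Variable V : finType.
Implicit Types (D F X Y : {set {set V}}) (e : {set V}).
Local Open Scope nat_scope.

Lemma coverS X Y : X \subset Y -> cover X \subset cover Y.
Proof.
move=> XY; apply/bigcupsP => e eX; apply: bigcup_sup.
exact: (subsetP XY).
Qed.

Lemma cover_edge e X v : e \in X -> v \in e -> v \in cover X.
Proof. by move=> eX ve; apply/bigcupP; exists e. Qed.

Lemma coverU X Y : cover (X :|: Y) = cover X :|: cover Y.
Proof.
apply/setP => v; rewrite inE; apply/bigcupP/orP => [[e]|].
  by rewrite inE => /orP[] eX ve; [left | right]; apply: cover_edge eX ve.
by case=> /bigcupP[e eX ve]; exists e; rewrite // inE eX ?orbT.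
Qed.

Lemma coverI X Y : cover (X :&: Y) \subset cover X :&: cover Y.
Proof. by rewrite subsetI !coverS ?subsetIl ?subsetIr. Qed.

Lemma simple_sub X Y : X \subset Y -> simple_graph Y -> simple_graph X.
Proof. by move=> /subsetP XY sY e /XY/sY. Qed.

Lemma R2_independentP D : reflect
  (forall X, X \subset D -> X != set0 -> #|X| + 3 <= 2 * #|cover X|)
  (R2_independent D).
Proof.
apply: (iffP forall_inP) => [ind X XD X0|ind X /andP[]]; last exact: ind.
by apply: ind; rewrite XD.
Qed.

Lemma R2_independentS X Y : X \subset Y -> R2_independent Y -> R2_independent X.
Proof.
move=> XY /R2_independentP ind; apply/R2_independentP => Z ZX.
exact/ind/(subset_trans ZX).
Qed.

Lemma R2_circuitP D : reflect
  (~~ R2_independent D /\ forall X, X \proper D -> R2_independent X) (R2_circuit D).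
Proof.
apply: (iffP minsetP) => -[dep minD]; split=> // X.
  rewrite properEneq => /andP[XD subD]; apply: contraNT XD => depX.
  by rewrite (minD X).
move=> depX subX; apply/eqP; apply: contraNT depX => XD.
by apply: minD; rewrite properEneq XD.
Qed.

Lemma dependent_circuit X : ~~ R2_independent X ->
  exists D, D \subset X /\ R2_circuit D.
Proof. by move/(minset_exists (P := fun D => ~~ R2_independent D)) => [D]; exists D. Qed.

Lemma circuit_sub_eq D X : R2_circuit D -> ~~ R2_independent X -> X \subset D -> X = D.
Proof. by move=> /minsetP[_ minD] depX XD; apply: minD. Qed.

Lemma circuit_card D : simple_graph D -> R2_circuit D ->
  #|D| + 2 = 2 * #|cover D|.
Proof.
move=> sD /R2_circuitP[dep ind].
have [large [e eD]] : 2 * #|cover D| < #|D| + 3 /\ exists e, e \in D.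
  move: dep; rewrite negb_forall_in => /exists_inP[X /andP[XD X0]].
  rewrite -ltnNge; have [e eX] := set0Pn _ X0.
  move=> large; split; last by exists e; apply: (subsetP XD).
  move: large; have [->//|nXD] := eqVneq X D.
  have /R2_independentP/(_ X (subxx X) X0) : R2_independent X.
    by apply: ind; rewrite properEneq nXD.
  by card_lia.
have e2 : 1 < #|cover D|.
  have := subset_leq_card (bigcup_sup e eD : e \subset cover D).
  by rewrite (sD e eD).
have D1 := cardsD1 e D; rewrite eD add1n in D1.
have De0 : D :\ e != set0 by rewrite -card_gt0; card_lia.
have /R2_independentP/(_ _ (subxx _) De0) := ind _ (properD1 eD).
have := subset_leq_card (coverS (subsetDl D [set e])).
by card_lia.
Qed.

Lemma circuit_simple_card D : simple_graph D -> R2_circuit D -> 0 < #|D|.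
Proof.
move=> sD /R2_circuitP[dep _]; rewrite card_gt0; apply: contraNneq dep => ->.
by apply/R2_independentP => X; rewrite subset0 => ->.
Qed.

(** Submodularity: if both circuits contained a common edge, their
intersection would be independent, and their union too large. *)
Lemma circuits_disjoint D1 D2 : simple_graph D1 -> simple_graph D2 ->
  R2_circuit D1 -> R2_circuit D2 ->
  #|D1 :|: D2| + 2 <= 2 * #|cover (D1 :|: D2)| -> D1 != D2 -> D1 :&: D2 = set0.
Proof.
move=> s1 s2 c1 c2 leU neD; apply/eqP; apply: contraT => I0.
have properI : D1 :&: D2 \proper D1.
  rewrite properEneq subsetIl andbT; apply: contraNneq neD => /setIidPl sub12.
  have [dep1 _] := R2_circuitP _ c1.
  by rewrite (circuit_sub_eq c2 dep1 sub12).
have [_ /(_ _ properI)/R2_independentP/(_ _ (subxx _) I0)] := R2_circuitP _ c1.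
have := subset_leq_card (coverI D1 D2); rewrite coverU in leU.
have := cardsUI D1 D2; have := cardsUI (cover D1) (cover D2).
have := circuit_card s1 c1; have := circuit_card s2 c2; card_lia.
Qed.

End Circuits.

(** * Angle rigidity implies the count *)

Section Necessity.
Variables (R : realType) (V K : finType) (E : {set {set V}}) (c : {set V} -> K).
Hypotheses (sE : simple_graph E) (C2 : #|c @: E| = 2%N).
Implicit Types (p q : V -> 'rV[R]_2) (X : {set {set V}}).

Lemma supported_sub X (w : {set V} -> R) : X \subset E -> supported X w -> supported E w.
Proof. by move=> XE supw e eE; apply: supw; apply: contra eE; apply: (subsetP XE). Qed.

Lemma sum_supported X (b : pred {set V}) (w : {set V} -> R) (g : {set V} -> R) :
  X \subset E -> supported X w ->
  \sum_(e in E | b e) w e * g e = \sum_(e in X) w e * ((b e)%:R * g e).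
Proof.
move=> XE supw; rewrite big_mkcond [RHS]big_mkcond; apply: eq_bigr => e _ /=.
have [eX|eX] := boolP (e \in X); last by rewrite supw // mul0r if_same.
by rewrite (subsetP XE) //; case: (b e); rewrite ?mul1r // mul0r mulr0.
Qed.

(** A set of more than [2 #|cover X| - 2] edges has a stress that also
satisfies the color equation. *)
Lemma angle_independent_sparse (b : pred {set V}) p X : realization p ->
  angle_independent E b p -> X \subset E -> X != set0 ->
  (#|X| + 2 <= 2 * #|cover X|)%N.
Proof.
move=> injp ind XE X0; rewrite leqNgt; apply/negP => dense.
have [|w [[e eX we] supw st bal]] := stress_exists (J := unit)
    (fun _ e => (b e)%:R * sqlen p e) (simple_sub XE sE) injp X0 (subxx _).
  by rewrite card_unit; card_lia.
case/eqP: we; apply: (ind w) (subsetP XE _ eX) => //.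
  exact: supported_sub supw.
by rewrite (sum_supported _ _ XE) // (bal tt).
Qed.

Lemma two_edges : exists e1 e2, [/\ e1 \in E, e2 \in E, e1 != e2
  & (3 <= #|E|)%N -> c e1 = c e2].
Proof.
have [/dinjectivePn[e1 e1E [e2 /andP[e21 e2E] cE]]|/negPn/dinjectiveP injc] :=
    boolP (~~ dinjectiveb c (mem E)).
  by exists e1, e2; split; rewrite // eq_sym.
have cardE : #|E| = 2%N by rewrite -(card_in_imset injc).
have /cards2P[e1 [e2 [e12 EE]]] : #|E| == 2%N by rewrite cardE.
by exists e1, e2; rewrite cardE EE set21 set22.
Qed.

Lemma transverse_edges (a b a' b' : V) : a != a' -> a != b -> a != b' -> a' != b ->
    a' != b' ->
  exists2 F, @polyfun R V F & (exists p, F p != 0) /\ forall p, F p != 0 ->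
    cross (p a - p b) (p a' - p b') != 0 /\ dotv (p a - p b) (p a' - p b') != 0.
Proof.
move=> aa' ab ab' a'b a'b'.
exists (fun p => cross (p a - p b) (p a' - p b') * dotv (p a - p b) (p a' - p b')).
  apply: polyfunM; [apply: polyfun_cross|apply: polyfun_dotv] => k;
  exact: polyfun_diff.
split=> [|p]; last by rewrite mulf_eq0 negb_or => /andP.
pose p v : 'rV[R]_2 := if v == a then \row_k (k == 0)%:R
  else if v == a' then const_mx 1 else 0.
have pa : p a = \row_k (k == 0)%:R by rewrite /p eqxx.
have pa' : p a' = const_mx 1 by rewrite /p eq_sym (negPf aa') eqxx.
have p0 v : a != v -> a' != v -> p v = 0.
  by rewrite /p ![_ == v]eq_sym => /negPf-> /negPf->.
exists p; rewrite pa pa' !p0 // !subr0 /cross !planeE /= !mulr1 subr0 addr0.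
by rewrite mulr1 oner_neq0.
Qed.

Lemma edge_minus (e f : {set V}) : e \in E -> f \in E -> e != f ->
  exists a b, [/\ a != b, e = [set a; b] & a \notin f].
Proof.
move=> eE fE ef; have : ~~ (e \subset f).
  by apply: contra ef => sub; rewrite eqEcard sub (sE eE) (sE fE) leqnn.
case/subsetPn => a ae af; have [x [y [xy eE']]] := simple_edge sE eE.
move: ae; rewrite eE' => /set2P[] aE; subst a; first by exists x, y.
by exists y, x; rewrite eq_sym setUC.
Qed.

(** Two disjoint circuits carry two stresses, and one of their combinations
satisfies the color equation; a circuit without edges of some color carries a
stress that satisfies the equation of that color trivially. *)
Lemma minimally_angle_rigid_count : minimally_angle_rigid R E c ->
  #|E| = (2 * #|V| - 2)%N /\ exists D : {set {set V}}, unique (R2_circuit_in E) D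
    /\ forall k, k \in c @: E -> exists2 e, e \in D & c e = k.
Proof.
move=> [S [[FS SE] [p0 Sp0] injS rigidS]].
have [e1 [e2 [e1E e2E e12 same]]] := two_edges.
have [a [b [ab e1ab ae2]]] := edge_minus e1E e2E e12.
have [a' [b' [ab' e2ab a'e1]]] : exists a b, [/\ a != b, e2 = [set a; b] & a \notin e1].
  by apply: edge_minus => //; rewrite eq_sym.
move: a'e1 ae2; rewrite {1}e1ab {1}e2ab !in_set2 !negb_or => /andP[a'a a'b] /andP[aa' ab''].
have [G pG [Gp GP]] := transverse_edges aa' ab ab'' a'b ab'.
have [f Ff fp0] := (SE p0).1 Sp0.
have [||p [fp /GP[crossP dotP]]] := @polyfun_generic _ _ (fun p => f.@[coords p]) G _ pG _ Gp.
- by exists f.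
- by exists p0.
have Sp : S p by apply/SE; exists f.
have injp := injS p Sp; have [rigid indep] := rigidS p Sp.
have ind k : k \in c @: E -> angle_independent E (fun e => c e == k) p.
  by move=> kC; apply/(independentP _ sE C2 kC).
have E0 : E != set0 by apply/set0Pn; exists e1.
have c1 : c e1 \in c @: E by rewrite imset_f.
have sparse X : X \subset E -> X != set0 -> (#|X| + 2 <= 2 * #|cover X|)%N.
  exact: angle_independent_sparse (ind _ c1).
have V3 : (2 < #|V|)%N.
  apply: (@leq_trans #|a' |: e1|); last exact: max_card.
  by rewrite cardsU1 (sE e1E) e1ab in_set2 negb_or a'a a'b.
have leE : (#|E| + 2 <= 2 * #|V|)%N.
  by apply: leq_trans (sparse E (subxx _) E0) _; rewrite leq_mul2l max_card orbT.
have cardE : #|E| = (2 * #|V| - 2)%N.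
  apply/eqP; apply: contraT => neE.
  have ltE : (#|E| + 3 <= 2 * #|V|)%N by move: neE leE; clear; card_lia.
  have [k2 C12 k12] : exists2 k2, c @: E = [set c e1; k2] & c e1 != k2.
    have /cards2P[x [y [xy CE]]] : #|c @: E| == 2%N by rewrite C2.
    move: c1; rewrite CE => /set2P[] ->; first by exists y.
    by exists x; rewrite 1?setUC // eq_sym.
  case: (few_edges_flexible sE C12 k12 injp ltE ab _ ab' _ _ crossP dotP rigid).
  - by rewrite -e1ab.
  - by rewrite -e2ab.
  move=> cardE; rewrite -e1ab -e2ab same //.
  by move: cardE V3; clear; card_lia.
split=> //.
have [D [DE circD]] : exists D : {set {set V}}, D \subset E /\ R2_circuit D.
  apply: dependent_circuit; apply/negP => /R2_independentP/(_ E (subxx _) E0).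
  by have := max_card (cover E); move: cardE V3; clear; card_lia.
have circuit_stress (D' : {set {set V}}) : D' \subset E -> R2_circuit D' -> exists w,
    [/\ exists2 e, e \in D' & w e != 0, supported D' w & stress p w].
  move=> sub circ; have sD := simple_sub sub sE.
  have [|||w [nzw supw st _]] := stress_exists (J := void) (fun _ _ => 0)
    (p := p) (W := cover D') sD injp.
  - by rewrite -card_gt0 (circuit_simple_card sD).
  - exact: subxx.
  - by rewrite card_void; have := circuit_card sD circ; clear; card_lia.
  by exists w.
exists D; split; first split=> // D' [D'E circD'].
  have sD := simple_sub DE sE; have sD' := simple_sub D'E sE.
  apply/eqP; apply: contraT => neD.
  have UE : D :|: D' \subset E by rewrite subUset DE.
  have I0 : D :&: D' = set0.
    apply: circuits_disjoint => //; apply: sparse => //.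
    have := circuit_simple_card sD circD; rewrite card_gt0.
    by case/set0Pn => e eD; apply/set0Pn; exists e; rewrite inE eD.
  have [w [[e eD we] supw st]] := circuit_stress D DE circD.
  have [w' [[e' eD' we'] supw' st']] := circuit_stress D' D'E circD'.
  pose bal (u : {set V} -> R) := \sum_(e in E | c e == c e1) u e * sqlen p e.
  have balw : bal w != 0.
    apply: contraNneq we => balw; apply/eqP; apply: (ind _ c1 w) (subsetP DE _ eD) => //.
    exact: supported_sub supw.
  pose u e := bal w' * w e - bal w * w' e.
  have uE : u e' = - (bal w * w' e').
    rewrite /u supw ?mulr0 ?sub0r //; apply/negP => e'D.
    by have := in_set0 e'; rewrite -I0 inE e'D eD'.
  suff : u e' = 0 by move/eqP; rewrite uE oppr_eq0 mulf_eq0 (negPf balw) (negPf we').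
  apply: (ind _ c1 u) (subsetP D'E _ eD').
  - move=> g gE; rewrite /u (supported_sub DE supw) // (supported_sub D'E supw') //.
    by rewrite !mulr0 subrr.
  - move=> v; transitivity (bal w' *: (\sum_x w [set v; x] *: (p v - p x))
        - bal w *: (\sum_x w' [set v; x] *: (p v - p x))).
      rewrite !scaler_sumr -sumrB; apply: eq_bigr => x _.
      by rewrite /u scalerBl !scalerA.
    by rewrite st st' !scaler0 subrr.
  transitivity (bal w' * bal w - bal w * bal w'); last by rewrite mulrC subrr.
  rewrite [in X in _ = X - _]/bal [in X in _ = _ - X]/bal -/(bal w) -/(bal w').
  by rewrite !mulr_sumr -sumrB; apply: eq_bigr => g _; rewrite /u mulrBl !mulrA.
move=> k kC.
have [/exists_inP[e eD /eqP ce]|/exists_inPn noK] :=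
  boolP [exists e in D, c e == k]; first by exists e.
have [w [[e eD we] supw st]] := circuit_stress D DE circD.
case/eqP: we; apply: (ind k kC w) (subsetP DE _ eD) => //.
  exact: supported_sub supw.
rewrite (sum_supported _ _ DE) // big1 // => g gD.
by rewrite (negPf (noK g gD)) mul0r mulr0.
Qed.

End Necessity.

(** * Extensions preserve angle independence *)

Section ExtensionIndependence.
Variables (R : realType) (V : finType).
Implicit Types (p q : V -> 'rV[R]_2) (E : {set {set V}}) (b : pred {set V}).

Lemma angle_independent_ext E b b' p : {in E, b =1 b'} ->
  angle_independent E b p -> angle_independent E b' p.
Proof.
move=> bE ind w supw st bal; apply: ind => //; rewrite -[RHS]bal.
by apply: eq_bigl => e; case eE: (e \in E); rewrite //= bE.
Qed.

Lemma edge_row_congr E p p' e v : simple_graph E -> e \in E ->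
  {in cover E, p =1 p'} -> edge_row p e v = edge_row p' e v.
Proof.
move=> sE eE pp'; have [a [b [ab eab]]] := simple_edge sE eE.
have inC x : x \in e -> x \in cover E by apply: cover_edge.
by rewrite eab !edge_row_set2 // !pp' // inC // eab ?set21 ?set22.
Qed.

Lemma sqlen_congr E p p' e : simple_graph E -> e \in E ->
  {in cover E, p =1 p'} -> sqlen p e = sqlen p' e.
Proof.
move=> sE eE pp'; have [a [b [ab eab]]] := simple_edge sE eE.
have inC x : x \in e -> x \in cover E by apply: cover_edge.
by rewrite eab !sqlen_set2 // !pp' // inC // eab ?set21 ?set22.
Qed.

Lemma edge_row_notin E p e v : simple_graph E -> e \in E -> v \notin cover E ->
  edge_row p e v = 0.
Proof.
move=> sE eE vE; have [a [b [ab eab]]] := simple_edge sE eE.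
have nv x : x \in e -> (v == x) = false.
  by move=> xe; apply: contraNF vE => /eqP->; apply: cover_edge eE xe.
by rewrite eab edge_row_set2 // !nv ?eab ?set21 ?set22 // subr0 scale0r.
Qed.

Lemma new_edge_notin E w x : w \notin cover E -> [set w; x] \notin E.
Proof. by apply: contra => wxE; apply: cover_edge wxE _; rewrite set21. Qed.

Lemma new_edges_neq (w x y : V) : x != y -> w != x -> ([set w; x] == [set w; y]) = false.
Proof. by move=> xy wx; rewrite set2_eq eqxx (negPf xy) [x == w]eq_sym (negPf wx) !andbF. Qed.

(** The two new edges are linearly independent vectors at [w], so a stress
vanishes on them. *)
Lemma zero_extension_independent E b b' w x y : simple_graph E ->
  w \notin cover E -> x != y -> w != x -> w != y -> {in E, b =1 b'} ->
  (exists p, @angle_independent R V E b p) ->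
  exists p, @angle_independent R V (E :|: [set [set w; x]; [set w; y]]) b' p.
Proof.
move=> sE wE xy wx wy bb' indE.
have [|||p [ind dxy]] := @angle_independent_generic R V E b
    (fun p => dotv (p x - p y) (p x - p y)).
- by apply: polyfun_dotv => k; apply: polyfun_diff.
- exists (fun v => if v == x then const_mx 1 else 0).
  by rewrite eqxx [y == x]eq_sym (negPf xy) subr0 !planeE mulr1 -mulr2n pnatr_eq0.
- exact: indE.
have {}ind := angle_independent_ext bb' ind.
pose p' v := if v == w then p x + quarter_turn (p y - p x) else p v.
have p'w : p' w = p x + quarter_turn (p y - p x) by rewrite /p' eqxx.
have p'E v : v != w -> p' v = p v by rewrite /p' => /negPf->.
have pp' : {in cover E, p' =1 p}.
  by move=> v vE; rewrite p'E //; apply: contraNneq wE => <-.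
exists p'; set E' := _ :|: _ => u supu st bal.
have wx_y := new_edges_neq xy wx.
have EE' : E' = [set w; x] |: ([set w; y] |: E) by rewrite /E' setUC -setUA.
have sumE (Z : zmodType) (F : {set V} -> Z) : \sum_(e in E') F e =
    F [set w; x] + (F [set w; y] + \sum_(e in E) F e).
  rewrite EE' big_setU1 /=; last by rewrite in_setU1 wx_y /= new_edge_notin.
  by rewrite big_setU1 // new_edge_notin.
have st' := (stressP p' supu).1 st.
have atw : u [set w; x] *: (p' w - p' x) + u [set w; y] *: (p' w - p' y) = 0.
  rewrite -[RHS](st' w) sumE !edge_row_set2 // eqxx (negPf wx) (negPf wy) !subr0.
  rewrite !scale1r big1 ?addr0 // => e eE.
  by rewrite (edge_row_notin _ sE eE) // scaler0.
rewrite p'w !p'E 1?eq_sym // in atw.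
have wy0 : u [set w; y] = 0.
  have := congr1 (dotv (p x - p y)) atw.
  have -> : dotv (p x - p y) 0 = 0 by rewrite !planeE; ring.
  have -> : dotv (p x - p y)
    (u [set w; x] *: (p x + quarter_turn (p y - p x) - p x) +
     u [set w; y] *: (p x + quarter_turn (p y - p x) - p y))
     = u [set w; y] * dotv (p x - p y) (p x - p y) by rewrite !planeE; ring.
  by move/eqP; rewrite mulf_eq0 (negPf dxy) orbF => /eqP.
have wx0 : u [set w; x] = 0.
  have := congr1 (dotv (quarter_turn (p y - p x))) atw; rewrite wy0.
  have -> : dotv (quarter_turn (p y - p x)) 0 = 0 by rewrite !planeE; ring.
  have -> : dotv (quarter_turn (p y - p x))
    (u [set w; x] *: (p x + quarter_turn (p y - p x) - p x) +
     0 *: (p x + quarter_turn (p y - p x) - p y))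
     = u [set w; x] * dotv (p x - p y) (p x - p y) by rewrite !planeE; ring.
  by move/eqP; rewrite mulf_eq0 (negPf dxy) orbF => /eqP.
have supE : supported E u.
  move=> e eE; have [eE'|/supu//] := boolP (e \in E').
  by move: eE'; rewrite EE' !in_setU1 (negPf eE) orbF => /orP[]/eqP->.
suff u0 : forall e, e \in E -> u e = 0.
  by move=> e; rewrite EE' !in_setU1 => /or3P[/eqP->|/eqP->|/u0].
apply: (ind u) => //.
  apply/(stressP p supE) => v; rewrite -[RHS](st' v) sumE wx0 wy0 !scale0r !add0r.
  by apply: eq_bigr => e eE; rewrite (edge_row_congr _ sE eE pp').
rewrite -[RHS]bal big_mkcondr [in RHS]big_mkcondr sumE wx0 wy0 !mul0r !if_same !add0r.
by apply: eq_bigr => e eE; rewrite (sqlen_congr sE eE pp').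
Qed.

(** Perturbed by the term [u * (g * w e0)], the color equation has nonzero
stresses among its solutions for at most one value of [u], because the stresses
form a line at most. *)
Lemma perturbed_balance E b p (g : R) e0 : angle_independent E b p ->
  exists u : R, [/\ u != 0, u != 1 & forall w, supported E w -> stress p w ->
    \sum_(e in E | b e) w e * sqlen p e + u * (g * w e0) = 0 ->
    forall e, e \in E -> w e = 0].
Proof.
move=> ind; pose bal w := \sum_(e in E | b e) w e * sqlen p e.
have u_ok (n : nat) : (1 < n)%N -> n%:R != 0 :> R /\ n%:R != 1 :> R.
  by move=> n1; rewrite pnatr_eq0 (eqr_nat _ n 1); split; lia.
(* At most one of the values 2 and 3 fails. *)
case: (boolp.EM (exists w, [/\ supported E w, stress p w,
    bal w + 2 * (g * w e0) = 0 & exists2 e, e \in E & w e != 0])); last first.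
  move=> no2; exists 2; have [u0 u1] := u_ok 2%N isT; split=> // w supw st bal2 e eE.
  apply/eqP; apply: contraT => we; case: no2; exists w; split=> //.
  by exists e.
move=> [w2 [sup2 st2 bal2 [e2 e2E we2]]].
have bal2_neq0 : bal w2 != 0.
  by apply: contraNneq we2 => bw; apply/eqP; apply: (ind w2).
exists 3; have [u0 u1] := u_ok 3%N isT; split=> // w supw st bal3.
have prop e : e \in E -> bal w * w2 e - bal w2 * w e = 0.
  apply: (ind (fun e => bal w * w2 e - bal w2 * w e)).
  - by move=> f fE; rewrite sup2 // supw // !mulr0 subrr.
  - move=> v; transitivity (bal w *: (\sum_x w2 [set v; x] *: (p v - p x))
        - bal w2 *: (\sum_x w [set v; x] *: (p v - p x))).
      rewrite !scaler_sumr -sumrB; apply: eq_bigr => x _.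
      by rewrite scalerBl !scalerA.
    by rewrite st st2 !scaler0 subrr.
  transitivity (bal w * bal w2 - bal w2 * bal w); last by rewrite mulrC subrr.
  rewrite [in X in _ = X - _]/bal [in X in _ = _ - X]/bal -/(bal w) -/(bal w2).
  by rewrite !mulr_sumr -sumrB; apply: eq_bigr => f _; rewrite mulrBl !mulrA.
have prop0 : bal w * w2 e0 - bal w2 * w e0 = 0.
  have [/prop//|e0E] := boolP (e0 \in E).
  by rewrite sup2 // supw // !mulr0 subrr.
suff balw : bal w = 0 by apply: (ind w).
have : 3 * (bal w + 2 * (g * w e0)) * bal w2 = 2 * bal w2 * (bal w + 3 * (g * w e0)) + bal w2 * bal w by ring.
rewrite [X in _ = _ * X + _]bal3 mulr0 add0r.
have -> : 3 * (bal w + 2 * (g * w e0)) * bal w2 =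
    3 * (bal w * (bal w2 + 2 * (g * w2 e0))) -
    6 * g * (bal w * w2 e0 - bal w2 * w e0) by ring.
rewrite bal2 prop0 !mulr0 subrr => /esym/eqP.
by rewrite mulf_eq0 (negPf bal2_neq0) => /eqP.
Qed.

(** Put [w] on the line [xy] at [p x + (1 - u) (p y - p x)].  The edge [wz]
carries no stress, and the stresses of [wx] and [wy] are [u] and [1 - u] times
a common factor, which amounts to a stress of [xy].  The squared length of
[xy] splits into the shares [1 - u] of [wx] and [u] of [wy]; so the
color equation is that of the old graph up to [u] times the stress of [xy]. *)
Lemma one_extension_independent E b b' w x y z : simple_graph E ->
  w \notin cover E -> [set x; y] \in E -> x != y -> z != x -> z != y -> w != z ->
  {in E :\ [set x; y], b =1 b'} -> b' [set w; x] = b [set x; y] ->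
  (exists p, @angle_independent R V E b p) ->
  exists p, @angle_independent R V
    (E :\ [set x; y] :|: [set [set w; x]; [set w; y]; [set w; z]]) b' p.
Proof.
move=> sE wE xyE xy zx zy wz bb' bx indE.
have wx : w != x by apply: contraNneq wE => ->; apply: cover_edge xyE _; rewrite set21.
have wy : w != y by apply: contraNneq wE => ->; apply: cover_edge xyE _; rewrite set22.
have [|||p [ind Gp]] := @angle_independent_generic R V E b
    (fun p => cross (p y - p x) (p z - p x)).
- by apply: polyfun_cross => k; apply: polyfun_diff.
- exists (fun v => if v == y then \row_k (k == 0)%:R else if v == z then const_mx 1 else 0).
  rewrite eqxx (negPf xy) (eq_sym x z) (negPf zx) (negPf zy) eqxx !subr0.
  by rewrite /cross !planeE /= !mulr1 subr0 oner_neq0.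
- exact: indE.
have [u [u0 u1 indu]] := perturbed_balance
  (((b' [set w; y])%:R - (b [set x; y])%:R) * sqlen p [set x; y]) [set x; y] ind.
pose p' v := if v == w then p x + (1 - u) *: (p y - p x) else p v.
have p'w : p' w = p x + (1 - u) *: (p y - p x) by rewrite /p' eqxx.
have p'E v : v != w -> p' v = p v by rewrite /p' => /negPf->.
have pp' : {in cover E, p' =1 p}.
  by move=> v vE; rewrite p'E //; apply: contraNneq wE => <-.
pose E1 := E :\ [set x; y].
have s1 : simple_graph E1 by apply: simple_sub sE; apply: subsetDl.
have w1 : w \notin cover E1.
  by apply: contra wE; apply: (subsetP (coverS (subsetDl _ _))).
have pp1 : {in cover E1, p' =1 p}.
  by move=> v v1; apply: pp'; apply: (subsetP (coverS (subsetDl _ _))) v1.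
exists p'; set E' := _ :|: _ => t supt st bal.
have wx_y := new_edges_neq xy wx.
have wx_z : ([set w; x] == [set w; z]) = false by rewrite new_edges_neq // eq_sym.
have wy_z : ([set w; y] == [set w; z]) = false by rewrite new_edges_neq // eq_sym.
have EE' : E' = [set w; x] |: ([set w; y] |: ([set w; z] |: E1)).
  by rewrite /E' setUC -!setUA.
have sumE' (Z : zmodType) (F : {set V} -> Z) : \sum_(e in E') F e =
    F [set w; x] + (F [set w; y] + (F [set w; z] + \sum_(e in E1) F e)).
  rewrite EE' big_setU1 /=; last by rewrite !in_setU1 wx_y wx_z /= new_edge_notin.
  rewrite big_setU1 /=; last by rewrite in_setU1 wy_z /= new_edge_notin.
  by rewrite big_setU1 // new_edge_notin.
have sumE (Z : zmodType) (F : {set V} -> Z) : \sum_(e in E) F e =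
    F [set x; y] + \sum_(e in E1) F e.
  by rewrite (big_setD1 [set x; y]).
have st' := (stressP p' supt).1 st.
pose d := p y - p x.
have p'wx : p' w - p' x = (1 - u) *: d by rewrite p'w p'E 1?eq_sym // addrAC subrr add0r.
have p'wy : p' w - p' y = - u *: d.
  rewrite p'w p'E 1?eq_sym // scalerBl scale1r -/d /d [p x + _]addrA.
  by rewrite addrCA subrr addr0 addrAC subrr add0r scaleNr.
have atw : t [set w; x] *: (p' w - p' x) + (t [set w; y] *: (p' w - p' y)
      + t [set w; z] *: (p' w - p' z)) = 0.
  rewrite -[RHS](st' w) sumE' !edge_row_set2 // eqxx (negPf wx) (negPf wy) (negPf wz).
  rewrite !subr0 !scale1r big1 ?addr0 // => e eE.
  by rewrite (edge_row_notin _ s1 eE) // scaler0.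
rewrite p'wx p'wy in atw.
have wz0 : t [set w; z] = 0.
  have := congr1 (cross d) atw.
  have -> : cross d 0 = 0 by rewrite /cross !mxE; ring.
  have -> : cross d (t [set w; x] *: ((1 - u) *: d) +
      (t [set w; y] *: (- u *: d) + t [set w; z] *: (p' w - p' z)))
     = - t [set w; z] * cross d (p z - p x).
    by rewrite p'w (p'E z) 1?eq_sym // -/d /cross !mxE; ring.
  by move/eqP; rewrite mulf_eq0 (negPf Gp) orbF oppr_eq0 => /eqP.
have d0 : d != 0.
  by apply: contra_neq Gp => d0; rewrite -/d d0 /cross !mxE; ring.
have ratio : t [set w; x] * (1 - u) = t [set w; y] * u.
  apply/eqP; rewrite -subr_eq0; move: atw.
  rewrite wz0 scale0r addr0 !scalerA mulrN scaleNr -scalerBl => /eqP.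
  by rewrite scaler_eq0 (negPf d0) orbF.
pose t0 e := if e == [set x; y] then t [set w; x] * (1 - u)
             else if e \in E1 then t e else 0.
have t0xy : t0 [set x; y] = t [set w; x] * (1 - u) by rewrite /t0 eqxx.
have t01 e : e \in E1 -> t0 e = t e.
  by move=> e1; rewrite /t0 e1; move: e1; rewrite !inE => /andP[/negPf->].
have supt0 : supported E t0.
  move=> e eE; rewrite /t0; case: eqP => [exy|_]; first by rewrite exy xyE in eE.
  by rewrite !inE (negPf eE) andbF.
have p_xy : p x - p y = - d by rewrite opprB.
have t0_zero : forall e, e \in E -> t0 e = 0.
  apply: indu => //.
    apply/(stressP p supt0) => v; rewrite sumE.
    have [->|vw] := eqVneq v w.
      rewrite (edge_row_notin _ sE xyE) // scaler0 add0r big1 // => e e1.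
      by rewrite (edge_row_notin _ s1 e1) // scaler0.
    rewrite -[RHS](st' v) sumE' wz0 scale0r add0r addrA; congr (_ + _); last first.
      by apply: eq_bigr => e e1; rewrite t01 // (edge_row_congr _ s1 e1 pp1).
    rewrite !edge_row_set2 // p'wx p'wy (negPf vw) !sub0r p_xy t0xy.
    rewrite !scalerA scalerN -scaleNr -scalerDl; congr (_ *: _).
    transitivity ((t [set w; y] * u) * (v == y)%:R - t [set w; x] * (1 - u) * (v == x)%:R).
      by rewrite -ratio; ring.
    by ring.
  rewrite big_mkcondr sumE.
  transitivity (\sum_(e in E' | b' e) t e * sqlen p' e); last exact: bal.
  rewrite [in RHS]big_mkcondr sumE' wz0 mul0r if_same add0r.
  have -> : \sum_(e in E1) (if b e then t0 e * sqlen p e else 0) =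
      \sum_(e in E1) (if b' e then t e * sqlen p' e else 0).
    by apply: eq_bigr => e e1; rewrite bb' // t01 // (sqlen_congr s1 e1 pp1).
  rewrite bx !sqlen_set2 // p'wx p'wy p_xy t0xy.
  have N a : dotv (a *: d) (a *: d) = a ^+ 2 * dotv d d by rewrite !planeE; ring.
  have -> : dotv (- d) (- d) = dotv d d by rewrite !planeE; ring.
  rewrite !N; move: (\sum_(e in E1) _) (dotv d d) => s n.
  have -> : t [set w; y] * ((- u) ^+ 2 * n) = t [set w; x] * (1 - u) * (u * n).
    by rewrite ratio; ring.
  by case: (b [set x; y]); case: (b' [set w; y]); rewrite /=; ring.
have wx0 : t [set w; x] = 0.
  have := t0_zero _ xyE; rewrite t0xy => /eqP; rewrite mulf_eq0 subr_eq0 [1 == u]eq_sym.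
  by rewrite (negPf u1) orbF => /eqP.
have wy0 : t [set w; y] = 0.
  by move/eqP: ratio; rewrite wx0 mul0r eq_sym mulf_eq0 (negPf u0) orbF => /eqP.
move=> e; rewrite EE' !in_setU1 => /or4P[/eqP->|/eqP->|/eqP->|e1] //.
by rewrite -t01 // t0_zero //; move: e1; rewrite inE => /andP[].
Qed.

Definition K4_edges (v1 v2 v3 v4 : V) : seq {set V} :=
  [:: [set v1; v2]; [set v1; v3]; [set v1; v4];
      [set v2; v3]; [set v2; v4]; [set v3; v4]].

Lemma K4_edges_uniq v1 v2 v3 v4 :
  uniq [:: v1; v2; v3; v4] -> uniq (K4_edges v1 v2 v3 v4).
Proof.
rewrite /= !inE !negb_or !andbT => /and3P[/and3P[n12 n13 n14] /andP[n23 n24] n34].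
rewrite !set2_eq ?[v2 == v1]eq_sym ?[v3 == v1]eq_sym ?[v4 == v1]eq_sym.
rewrite ?[v3 == v2]eq_sym ?[v4 == v2]eq_sym ?[v4 == v3]eq_sym !eqxx.
rewrite (negPf n12) (negPf n13) (negPf n14) (negPf n23) (negPf n24) (negPf n34).
by rewrite !andbF.
Qed.

(** For [v1], [v2], [v3], [v4] placed at (0,0), (1,0), (0,1), (-2,-2) the stresses
[w] are the multiples of (-10, -10, -5, 4, 2, 2), in the order of [K4_edges], and
the terms [w e * sqlen p e] those of (-10, -10, -40, 8, 26, 26): only the empty
and the full sum of these numbers vanish. *)
Lemma K4_balance (b1 b2 b3 b4 b5 b6 : bool) (s : R) :
  ~~ [&& b1, b2, b3, b4, b5 & b6] -> [|| b1, b2, b3, b4, b5 | b6] ->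
  (10 * b1%:R + 10 * b2%:R + 40 * b3%:R - 8 * b4%:R - 26 * b5%:R - 26 * b6%:R) * s = 0 ->
  s = 0.
Proof.
by case: b1; case: b2; case: b3; case: b4; case: b5; case: b6 => //= _ _; lra.
Qed.

Lemma K4_independent E b (v1 v2 v3 v4 : V) : uniq [:: v1; v2; v3; v4] ->
  E =i K4_edges v1 v2 v3 v4 -> (exists2 e, e \in E & b e) ->
  (exists2 e, e \in E & ~~ b e) -> exists p, @angle_independent R V E b p.
Proof.
move=> uq EE [e1 e1E be1] [e2 e2E be2].
have uqE := K4_edges_uniq uq.
move: (uq); rewrite /= !inE !negb_or !andbT.
case/and3P=> /and3P[n12 n13 n14] /andP[n23 n24] n34.
pose pt (i j : R) : 'rV[R]_2 := \row_k (if k == 0 then i else j).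
pose p v := if v == v2 then pt 1 0 else if v == v3 then pt 0 1
            else if v == v4 then pt (-2) (-2) else pt 0 0.
have [pv1 pv2 pv3 pv4] : [/\ p v1 = pt 0 0, p v2 = pt 1 0, p v3 = pt 0 1 & p v4 = pt (-2) (-2)].
  by split; rewrite /p ?eqxx ?(negPf n12) ?(negPf n13) ?(negPf n14) ?[v3 == v2]eq_sym
    ?[v4 == v2]eq_sym ?[v4 == v3]eq_sym ?(negPf n23) ?(negPf n24) ?(negPf n34) ?eqxx.
have pt0 i j : pt i j 0 0 = i by rewrite mxE.
have pt1 i j : pt i j 0 1 = j by rewrite mxE.
exists p => w supw st.
have sum4 (F : V -> 'rV[R]_2) : (forall v, v \notin [:: v1; v2; v3; v4] -> F v = 0) ->
    \sum_v F v = F v1 + (F v2 + (F v3 + F v4)).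
  move=> F0; rewrite (bigID (mem [:: v1; v2; v3; v4])) /= [X in _ + X]big1 ?addr0 //.
  by rewrite -big_uniq // !big_cons big_nil /= addr0.
have off v v' : v' \notin [:: v1; v2; v3; v4] -> w [set v; v'] = 0.
  move=> v'4; apply: supw; apply: contra v'4; rewrite EE !inE !set2_eq.
  by do ?[case/orP]; case/andP=> _ /eqP->; rewrite eqxx ?orbT.
have at_vertex v k : w [set v; v1] * (p v 0 k - p v1 0 k)
   + (w [set v; v2] * (p v 0 k - p v2 0 k) + (w [set v; v3] * (p v 0 k - p v3 0 k)
   + w [set v; v4] * (p v 0 k - p v4 0 k))) = 0.
  move/rowP/(_ k): (st v); rewrite sum4 => [|x /off->]; last by rewrite scale0r.
  by rewrite !mxE.
rewrite big_mkcondr (eq_bigl _ _ EE) -big_uniq // !big_cons big_nil /= addr0.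
rewrite !sqlen_set2 // pv1 pv2 pv3 pv4 !dotvE !mxE /= => bal.
have bs : [|| b [set v1; v2], b [set v1; v3], b [set v1; v4],
      b [set v2; v3], b [set v2; v4] | b [set v3; v4]].
  by move: e1E be1; rewrite EE !inE => /or4P[||| /or3P[]] /eqP-> ->; rewrite ?orbT.
have nbs : ~~ [&& b [set v1; v2], b [set v1; v3], b [set v1; v4],
      b [set v2; v3], b [set v2; v4] & b [set v3; v4]].
  move: e2E be2; rewrite EE !inE => /or4P[||| /or3P[]] /eqP-> /negPf->;
  by rewrite ?andbF.
have := at_vertex v1 0; have := at_vertex v1 1; have := at_vertex v2 0.
have := at_vertex v2 1; have := at_vertex v3 0; have := at_vertex v3 1.
rewrite pv1 pv2 pv3 pv4 !pt0 !pt1 (setUC [set v2] [set v1]) (setUC [set v3] [set v1]).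
rewrite (setUC [set v3] [set v2]).
move=> h1 h2 h3 h4 h5 h6.
set s := w [set v1; v4] in h1 h2 h3 h4 h5 h6 bal *.
set w12 := w [set v1; v2] in h1 h2 h3 h4 h5 h6 bal *.
set w13 := w [set v1; v3] in h1 h2 h3 h4 h5 h6 bal *.
set w23 := w [set v2; v3] in h1 h2 h3 h4 h5 h6 bal *.
set w24 := w [set v2; v4] in h1 h2 h3 h4 h5 h6 bal *.
set w34 := w [set v3; v4] in h1 h2 h3 h4 h5 h6 bal *.
clear -h1 h2 h3 h4 h5 h6 bal bs nbs EE.
move: h1 h2 h3 h4 h5 h6; rewrite !subr0 !subrr !mulr0 => h1 h2 h3 h4 h5 h6.
have [e12 e13] : w12 = 2 * s /\ w13 = 2 * s by clear bal; split; lra.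
have [e23 e24 e34] : [/\ w23 = - (4 / 5) * s, w24 = - (2 / 5) * s & w34 = - (2 / 5) * s].
  by clear bal; split; lra.
have s0 : s = 0.
  apply: (K4_balance nbs bs); rewrite -[RHS](mulr0 5) -bal e12 e13 e23 e24 e34.
  by clear; do 6![case: (b _) => /=]; field.
move=> e; rewrite EE !inE => /or4P[||| /or3P[]] /eqP->;
  by rewrite -/s -/w12 -/w13 -/w23 -/w24 -/w34 ?e12 ?e13 ?e23 ?e24 ?e34 s0 ?mulr0.
Qed.

End ExtensionIndependence.

Section Sufficiency.
Variables (R : realType) (V K : finType).
Implicit Types (G H : cgraph V K).

Definition well_formed G : Prop :=
  [/\ simple_graph (eset G), cover (eset G) \subset vset G
    & (#|eset G| + 2 = 2 * #|vset G|)%N].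

Definition generically_independent G : Prop := forall k, k \in colors G ->
  exists p, @angle_independent R V (eset G) (fun e => Defs.col G e == k) p.

Lemma simple_setU (E1 E2 : {set {set V}}) :
  simple_graph E1 -> simple_graph E2 -> simple_graph (E1 :|: E2).
Proof. by move=> s1 s2 e; rewrite inE => /orP[/s1|/s2]. Qed.

Lemma card_edge (x y : V) : x != y -> #|[set x; y]| = 2%N.
Proof. by rewrite cards2 => ->. Qed.

Lemma K4_edgesP (W : {set V}) : #|W| = 4%N -> exists v1 v2 v3 v4,
  [/\ uniq [:: v1; v2; v3; v4], W =i [:: v1; v2; v3; v4] &
   [set e : {set V} | (e \subset W) && (#|e| == 2%N)] =i K4_edges v1 v2 v3 v4].
Proof.
rewrite cardE; have := enum_uniq W; have memW := mem_enum W.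
case: (enum W) memW => [|v1 [|v2 [|v3 [|v4 [|? ?]]]]] //= memW uq _.
have WE : W =i [:: v1; v2; v3; v4] by move=> v; rewrite -memW.
exists v1, v2, v3, v4; split=> // e; rewrite inE; apply/andP/idP.
  case=> eW /cards2P[a [b [ab eE]]]; move: eW; rewrite eE subUset !sub1set !WE !inE.
  case/andP=> /or4P[] /eqP aE /or4P[] /eqP bE; move: ab; rewrite aE bE ?eqxx //= => _;
  by rewrite ?eqxx ?orbT // setUC eqxx ?orbT.
move: uq; rewrite /= !inE !negb_or !andbT.
case/and3P=> /and3P[n12 n13 n14] /andP[n23 n24] n34.
by case/or4P=> [||| /or3P[]] /eqP->; rewrite card_edge // subUset !sub1set !WE !inE
  !eqxx ?orbT.
Qed.

Lemma K4_generically_independent G : bichromatic_K4 G ->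
  well_formed G /\ generically_independent G.
Proof.
move=> [W4 EG C2]; have [v1 [v2 [v3 [v4 [uq WE EE]]]]] := K4_edgesP W4.
rewrite -EG in EE; split.
  split=> [e||]; first by rewrite EG inE => /andP[_ /eqP].
    by apply/bigcupsP => e; rewrite EG inE => /andP[].
  by rewrite W4 (eq_card EE) (card_uniqP (K4_edges_uniq uq)).
move=> k kC; apply: K4_independent uq EE _ _.
  by case/imsetP: kC => e eE ->; exists e.
have /cards2P[x [y [xy CE]]] : #|colors G| == 2%N by rewrite C2.
have [l lC lk] : exists2 l, l \in colors G & l != k.
  have [->|xk] := eqVneq k x; first by exists y; rewrite ?CE ?set22 // eq_sym.
  by exists x; rewrite ?CE ?set21 // eq_sym.
by case/imsetP: lC lk => e eE -> lk; exists e.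
Qed.

Lemma zero_extension_preserves G H : zero_extension G H ->
  well_formed G /\ generically_independent G ->
  well_formed H /\ generically_independent H.
Proof.
move=> [w [x [y [wV [xV yV xy] VH EH [colE cx cy]]]]] [[sG cG nG] indG].
have [wx wy] : w != x /\ w != y by split; apply: contraNneq wV => ->.
have wE : w \notin cover (eset G) by apply: contra wV; apply: (subsetP cG).
have sub_colors : colors H \subset colors G.
  apply/subsetP => k /imsetP[e + ->]; rewrite EH !inE.
  case/or3P=> [eG|/eqP->|/eqP->] //; rewrite colE //.
  exact: imset_f.
split; last first.
  move=> k kH; rewrite EH.
  apply: (zero_extension_independent (b := fun e => Defs.col G e == k)) => //.
    by move=> e eG /=; rewrite colE.
  by apply: indG; apply: (subsetP sub_colors).
split.
- rewrite EH; apply: simple_setU => // e.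
  by rewrite !inE => /orP[]/eqP->; apply: card_edge.
- rewrite EH VH coverU subUset (subset_trans cG) ?subsetUr //=.
  apply/bigcupsP => e; rewrite !inE => /orP[]/eqP->;
  by rewrite subUset !sub1set !inE eqxx ?xV ?yV ?orbT.
have EE : eset H = [set w; x] |: ([set w; y] |: eset G) by rewrite EH setUC -setUA.
rewrite EE VH !cardsU1 wV !in_setU1 new_edges_neq // !new_edge_notin //=.
by move: nG; clear; card_lia.
Qed.

Lemma one_extension_preserves G H : color_preserving_one_extension G H ->
  well_formed G /\ generically_independent G ->
  well_formed H /\ generically_independent H.
Proof.
move=> [w [x [y [z [wV [xyE zV xy zx zy] VH EH [colE cx cy cz cpres]]]]]].
move=> [[sG cG nG] indG].
have wE : w \notin cover (eset G) by apply: contra wV; apply: (subsetP cG).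
have inV v : v \in [set x; y] -> v \in vset G.
  by move=> vxy; apply: (subsetP cG); apply: cover_edge vxy.
have xV : x \in vset G by rewrite inV ?set21.
have yV : y \in vset G by rewrite inV ?set22.
have [wx wy wz] : [/\ w != x, w != y & w != z] by split; apply: contraNneq wV => ->.
have sub_colors : colors H \subset colors G.
  apply/subsetP => k /imsetP[e + ->]; rewrite EH inE.
  case/orP=> [eG|]; first by rewrite colE //; apply: imset_f; move: eG; rewrite inE => /andP[].
  by rewrite !inE => /orP[/orP[/eqP->|/eqP->]|/eqP->].
split; last first.
  move=> k kH; rewrite EH.
  have indk := indG k (subsetP sub_colors _ kH).
  case: cpres => cp.
    apply: (one_extension_independent (b := fun e => Defs.col G e == k)) => //=.
      by move=> e eG /=; rewrite colE.
    by rewrite cp.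
  rewrite (setUC [set [set w; x]]) (setUC [set x]).
  apply: (one_extension_independent (b := fun e => Defs.col G e == k)) => //=.
  - by rewrite setUC.
  - by rewrite eq_sym.
  - by move=> e eG /=; rewrite colE // setUC.
  by rewrite cp setUC.
split.
- rewrite EH; apply: simple_setU; first by apply: simple_sub sG; apply: subsetDl.
  move=> e; rewrite !inE => /orP[/orP[]|] /eqP->; exact: card_edge.
- rewrite EH VH coverU subUset (subset_trans (subset_trans (coverS (subsetDl _ _)) cG)) ?subsetUr //=.
  apply/bigcupsP => e; rewrite !inE => /orP[/orP[]|] /eqP->;
  by rewrite subUset !sub1set !inE eqxx ?xV ?yV ?zV ?orbT.
have EE : eset H = [set w; x] |: ([set w; y] |: ([set w; z] |: (eset G :\ [set x; y]))).
  by rewrite EH setUC -!setUA.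
have w1 : w \notin cover (eset G :\ [set x; y]).
  by apply: contra wE; apply: (subsetP (coverS (subsetDl _ _))).
have xz : x != z by rewrite eq_sym.
have yz : y != z by rewrite eq_sym.
have n1 := cardsD1 [set x; y] (eset G); rewrite xyE in n1.
rewrite EE VH !cardsU1 wV.
have -> : [set w; x] \notin [set w; y] |: ([set w; z] |: eset G :\ [set x; y]).
  by rewrite !in_setU1 !new_edges_neq //= new_edge_notin.
have -> : [set w; y] \notin [set w; z] |: eset G :\ [set x; y].
  by rewrite !in_setU1 !new_edges_neq //= new_edge_notin.
rewrite new_edge_notin //; move: n1 nG => /=; clear; card_lia.
Qed.

Lemma constructible_independent G : constructible G ->
  well_formed G /\ generically_independent G.
Proof.
elim=> {G} [G|G H _ IH zGH|G H _ IH oGH].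
- exact: K4_generically_independent.
- exact: zero_extension_preserves zGH IH.
exact: one_extension_preserves oGH IH.
Qed.

Lemma realization_polyfun : exists F, [/\ @polyfun R V F, exists p, F p != 0
  & forall p, F p != 0 -> realization p].
Proof.
exists (fun p => \prod_(vw : V * V | vw.1 != vw.2)
  dotv (p vw.1 - p vw.2) (p vw.1 - p vw.2)); split=> [||p].
- by apply: polyfun_prod => vw; apply: polyfun_dotv => k; apply: polyfun_diff.
- exists (fun v => const_mx (enum_rank v)%:R); apply/prodf_neq0 => -[v w] /= vw.
  rewrite gt_eqF // dotv_gt0 // subr_eq0; apply: contra_neq vw => /rowP/(_ 0).
  by rewrite !mxE => /eqP; rewrite eqr_nat => /eqP/ord_inj/enum_rank_inj.
move/prodf_neq0 => nz v w pvw; apply/eqP; apply: contraT => vw.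
by have := nz (v, w) vw; rewrite /= pvw subrr !planeE mul0r addr0 eqxx.
Qed.

Lemma constructible_minimally_angle_rigid (E : {set {set V}}) (c : {set V} -> K) :
  #|c @: E| = 2%N -> constructible (CGraph [set: V] E c) ->
  minimally_angle_rigid R E c.
Proof.
move=> C2 /constructible_independent[[/= sE _ nE] indE].
have /cards2P[k1 [k2 [k12 C12]]] : #|c @: E| == 2%N by rewrite C2.
have k2C : k2 \in c @: E by rewrite C12 set22.
have [F' [pF' nzF' F'P]] := realization_polyfun.
have [p0 [ind0 F'0]] := angle_independent_generic pF' nzF' (indE k2 k2C).
have [F [pF F0 indF]] := angle_independent_polyfun ind0.
have [f fE] := polyfunM pF pF'.
exists (fun p => F p * F' p != 0); split.
- by exists (fun g => g = f) => p; rewrite fE; split=> [nz|[g ->]]; first by exists f.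
- by exists p0; rewrite mulf_neq0.
- by move=> p; rewrite mulf_eq0 negb_or => /andP[_ /F'P].
move=> p; rewrite mulf_eq0 negb_or => /andP[/indF ind /F'P injp].
split; last exact/(independentP _ sE C2 k2C).
apply: (angle_independent_rigid sE C12 k12 injp _ ind).
by move: nE; rewrite cardsT; clear; card_lia.
Qed.

End Sufficiency.

(** * Sparse graphs: tight sets and degrees *)

Section SparseGraphs.
Local Open Scope nat_scope.
Variable V : finType.
Implicit Types (D E F X Y U : {set {set V}}) (e : {set V}) (v x y z : V).

(** For an independent [X] this is the count of a generically rigid graph: a new
edge between two vertices of [X] makes it dependent. *)
Definition tight X : bool := 2 * #|cover X| <= #|X| + 3.

Lemma tightU F X Y : R2_independent F -> X \subset F -> Y \subset F ->
  tight X -> tight Y -> 1 < #|cover X :&: cover Y| -> tight (X :|: Y).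
Proof.
move=> /R2_independentP ind XF YF tX tY two; rewrite /tight coverU.
have leI : #|X :&: Y| + 3 <= 2 * #|cover X :&: cover Y|.
  have [->|I0] := eqVneq (X :&: Y) set0; first by rewrite cards0; move: two; clear; card_lia.
  have := ind (X :&: Y) (subset_trans (subsetIl X Y) XF) I0.
  have := subset_leq_card (coverI X Y); clear; card_lia.
have := cardsUI X Y; have := cardsUI (cover X) (cover Y).
move: leI tX tY; rewrite /tight; clear; card_lia.
Qed.

Lemma leq_card2 (A : {set V}) x y : x != y -> x \in A -> y \in A -> 1 < #|A|.
Proof.
move=> xy xA yA; apply: (@leq_trans #|[set x; y]|); first by rewrite cards2 xy.
by apply: subset_leq_card; rewrite subUset !sub1set xA.
Qed.

(** Three tight sets pairwise meeting in a vertex of a triangle form a tight set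
like three bodies hinged together in a triangle; if two of them share more
than that vertex, then these two are enough. *)
Lemma tight_triangle F X1 X2 X3 x y z : simple_graph F -> R2_independent F ->
  X1 \subset F -> X2 \subset F -> X3 \subset F -> tight X1 -> tight X2 -> tight X3 ->
  x != y -> y != z -> x != z ->
  x \in cover X1 -> y \in cover X1 -> y \in cover X2 -> z \in cover X2 ->
  x \in cover X3 -> z \in cover X3 ->
  exists U, [/\ U \subset X1 :|: X2 :|: X3, tight U
    & [/\ x \in cover U, y \in cover U & z \in cover U]].
Proof.
move=> sF ind s1 s2 s3 t1 t2 t3 xy yz xz x1 y1 y2 z2 x3 z3.
have [I12|I12] := ltnP 1 #|cover X1 :&: cover X2|.
  exists (X1 :|: X2); rewrite subsetUl coverU !inE x1 y1 z2 orbT.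
  by split=> //; apply: (tightU ind).
have [I13|I13] := ltnP 1 #|cover X1 :&: cover X3|.
  exists (X1 :|: X3); rewrite coverU !inE x1 y1 z3 orbT setUAC subsetUl.
  by split=> //; apply: (tightU ind).
have [I23|I23] := ltnP 1 #|cover X2 :&: cover X3|.
  exists (X2 :|: X3); rewrite coverU !inE y2 z2 x3 orbT -setUA subsetUr.
  by split=> //; apply: (tightU ind).
have disj X Y : X \subset F -> #|cover X :&: cover Y| <= 1 -> X :&: Y = set0.
  move=> XF; apply: contraTeq => /set0Pn[e]; rewrite inE => /andP[eX eY].
  rewrite -ltnNge -(sF e (subsetP XF _ eX)); apply: subset_leq_card.
  by rewrite subsetI !bigcup_sup.
exists (X1 :|: X2 :|: X3); rewrite subxx !coverU !inE x1 y1 z2 orbT; split=> //.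
have c12 := cardsUI X1 X2; rewrite disj // cards0 addn0 in c12.
have c123 := cardsUI (X1 :|: X2) X3.
rewrite setIUl (disj _ _ s1 I13) (disj _ _ s2 I23) setU0 cards0 addn0 in c123.
rewrite /tight !coverU.
have v12 := cardsUI (cover X1) (cover X2).
have v123 := cardsUI (cover X1 :|: cover X2) (cover X3).
have y12 : 0 < #|cover X1 :&: cover X2| by apply/card_gt0P; exists y; rewrite inE y1.
have xz3 : 1 < #|(cover X1 :|: cover X2) :&: cover X3|.
  by apply: (leq_card2 xz); rewrite !inE ?x1 ?z2 ?x3 ?z3 ?orbT.
move: t1 t2 t3 v12 v123 y12 xz3 c12 c123; rewrite /tight; clear; card_lia.
Qed.

Lemma cover1 e : cover [set e] = e.
Proof. by rewrite /cover big_set1. Qed.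

Lemma coverU1 e X : cover (e |: X) = e :|: cover X.
Proof. by rewrite coverU cover1. Qed.

Lemma circuit_through F D f : R2_independent F -> D \subset f |: F -> R2_circuit D ->
  f \in D /\ D :\ f \subset F.
Proof.
move=> ind DF /R2_circuitP[dep _]; split; last by rewrite subDset.
apply: contraNT dep => fD; apply: R2_independentS ind; apply/subsetP => e eD.
have := subsetP DF e eD; rewrite in_setU1 => /orP[/eqP ef|//].
by rewrite -ef eD in fD.
Qed.

(** A circuit on [n] vertices has [2 * n - 2] edges; the [2 * n - 3] edges that are
left without [f] are independent, so they cannot cover fewer vertices. *)
Lemma circuit_link F D f : simple_graph (f |: F) -> R2_independent F ->
  D \subset f |: F -> R2_circuit D ->
  tight (D :\ f) /\ f \subset cover (D :\ f).
Proof.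
move=> sF ind DF circD; have [fD DfF] := circuit_through ind DF circD.
have sD := simple_sub DF sF; have cardD := circuit_card sD circD.
have cD := cardsD1 f D; rewrite fD add1n in cD.
have covD : 1 < #|cover D|.
  by rewrite -(sD f fD); apply: subset_leq_card; apply: bigcup_sup.
have D0 : D :\ f != set0.
  by rewrite -card_gt0; move: cD cardD covD; clear; card_lia.
have ge := (R2_independentP _ ind) _ DfF D0.
have cov : cover (D :\ f) = cover D.
  apply/eqP; rewrite eqEcard coverS ?subsetDl //=.
  by move: ge cD cardD; clear; card_lia.
by rewrite cov /tight cov (bigcup_sup f) //; split=> //; move: cD cardD; clear; card_lia.
Qed.

Lemma tight1 e : #|e| = 2 -> tight [set e].
Proof. by move=> e2; rewrite /tight cover1 e2 cards1. Qed.

Lemma sparse_minus_edge E e0 X : simple_graph E -> R2_independent (E :\ e0) ->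
  X \subset E -> X != set0 -> #|X| + 2 <= 2 * #|cover X|.
Proof.
move=> sE ind XE X0; have [Xe|Xe] := eqVneq (X :\ e0) set0.
  have [e eX] := set0Pn _ X0.
  have : 1 < #|cover X|.
    by rewrite -(sE e (subsetP XE _ eX)); apply: subset_leq_card; apply: bigcup_sup.
  have := cardsD1 e0 X; rewrite Xe cards0; have := leq_b1 (e0 \in X).
  by move: (e0 \in X : nat) => n; clear; card_lia.
have := (R2_independentP _ ind) _ (setSD [set e0] XE) Xe.
have := subset_leq_card (coverS (subsetDl X [set e0])).
have := cardsD1 e0 X; have := leq_b1 (e0 \in X).
by move: (e0 \in X : nat) => n; clear; card_lia.
Qed.

Definition star E v : {set {set V}} := [set e in E | v \in e].
Definition del E v : {set {set V}} := [set e in E | v \notin e].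
Definition nbr E v : {set V} := [set x | (x != v) && ([set v; x] \in E)].

Lemma star_del E v : E = star E v :|: del E v.
Proof. by apply/setP => e; rewrite !inE -andb_orr orbN andbT. Qed.

Lemma del_sub E v : del E v \subset E.
Proof. by apply/subsetP => e; rewrite inE => /andP[]. Qed.

Lemma card_star_del E v : #|E| = #|star E v| + #|del E v|.
Proof.
rewrite {1}(star_del E v) cardsU; suff -> : star E v :&: del E v = set0.
  by rewrite cards0 subn0.
by apply/setP => e; rewrite !inE; case: (v \in e); rewrite ?andbF.
Qed.

Lemma starE E v : simple_graph E -> star E v = [set [set v; x] | x in nbr E v].
Proof.
move=> sE; apply/setP => e; rewrite inE; apply/andP/imsetP.
  case=> eE; have [a [b [ab eab]]] := simple_edge sE eE; rewrite eab.
  rewrite eab in eE; case/set2P => ->; first by exists b; rewrite // inE eq_sym ab.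
  by exists a; rewrite 1?setUC // inE ab setUC.
by case=> x; rewrite inE => /andP[_ xE] ->; rewrite set21.
Qed.

Lemma card_star E v : simple_graph E -> #|star E v| = #|nbr E v|.
Proof.
move=> sE; rewrite starE // card_in_imset // => x y; rewrite !inE => /andP[xv _] _ /eqP.
by rewrite set2_eq eqxx [v == y]eq_sym /= => /orP[/eqP //|/andP[_ /eqP xv']];
   rewrite xv' eqxx in xv.
Qed.

Lemma cover_del E v (W : {set V}) : cover E \subset W -> cover (del E v) \subset W :\ v.
Proof.
move=> EW; apply/bigcupsP => e; rewrite inE => /andP[eE ve].
by rewrite subsetD1 ve (subset_trans _ EW) // bigcup_sup.
Qed.

Lemma sum_degrees E (A : {set V}) :
  \sum_(v in A) #|star E v| = \sum_(e in E) #|e :&: A|.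
Proof.
transitivity (\sum_(v in A) \sum_(e in E) (v \in e : nat)).
  apply: eq_bigr => v _; rewrite -sum1_card [LHS]big_mkcond [RHS]big_mkcond.
  apply: eq_bigr => e _; rewrite inE.
  by case: (e \in E); case: (v \in e).
rewrite exchange_big; apply: eq_bigr => e _.
rewrite -sum1_card big_mkcond [RHS]big_mkcond /=; apply: eq_bigr => v _.
by rewrite inE; case: (v \in A); case: (v \in e).
Qed.

Lemma enum3 (A : {set V}) : #|A| = 3 -> exists x y z,
  [/\ x != y, y != z, x != z & A =i [:: x; y; z]].
Proof.
rewrite cardE; have := enum_uniq A; have := mem_enum A.
case: (enum A) => [|x [|y [|z [|? ?]]]] //= memA; rewrite !inE negb_or.
by case/and3P => /andP[xy xz] yz _ _; exists x, y, z; split=> // v; rewrite -memA.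
Qed.

Lemma pairs_in_card (W : {set V}) E : simple_graph E -> cover E \subset W ->
  #|E| <= 'C(#|W|, 2).
Proof.
move=> sE EW; rewrite -cards_draws; apply: subset_leq_card.
apply/subsetP => e eE; rewrite inE (sE e eE) eqxx andbT.
by apply: subset_trans EW; apply: bigcup_sup.
Qed.

Lemma circuit_cover4 D : simple_graph D -> R2_circuit D -> 3 < #|cover D|.
Proof.
move=> sD circD; have cardD := circuit_card sD circD.
have pos := circuit_simple_card sD circD.
have := pairs_in_card sD (subxx _).
move: cardD pos; move: (#|D|) (#|cover D|) => m [|[|[|[|n]]]] //;
  rewrite ?bin0n ?binn /=; try lia.
by rewrite bin2 /=; lia.
Qed.

End SparseGraphs.

(** * Reducing a graph with a unique bichromatic circuit *)

Section Reduction.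
Local Open Scope nat_scope.
Variables V K : finType.
Implicit Types (G H : cgraph V K) (D E F X Y U : {set {set V}}) (e : {set V}).
Implicit Types (v x y z : V).

(** The graph minus the edge [e0] is independent, so [D] is its only circuit. *)
Definition bichromatic_circuit_in G D : Prop :=
  [/\ D \subset eset G, R2_circuit D,
      exists2 e0, e0 \in D & R2_independent (eset G :\ e0)
    & exists e1 e2, [/\ e1 \in D, e2 \in D & Defs.col G e1 != Defs.col G e2]].

Definition reducible_class G : Prop :=
  [/\ well_formed G, #|colors G| = 2 & exists D, bichromatic_circuit_in G D].

Lemma sub_colors_card2 G H e1 e2 : #|colors G| = 2 -> colors H \subset colors G ->
  e1 \in eset H -> e2 \in eset H -> Defs.col H e1 != Defs.col H e2 ->
  colors H = colors G.
Proof.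
move=> C2 sub e1H e2H ne; apply/eqP; rewrite eqEcard sub C2.
by apply: (leq_card2 ne); apply: imset_f.
Qed.

Lemma nbr_vset G v x : well_formed G -> x \in nbr (eset G) v ->
  [/\ x != v, [set v; x] \in eset G, v \in vset G & x \in vset G].
Proof.
move=> [_ cG _]; rewrite inE => /andP[xv vxE]; split=> //; apply: (subsetP cG);
by apply: cover_edge vxE _; rewrite ?set21 ?set22.
Qed.

Lemma circuit_del G D v : bichromatic_circuit_in G D -> v \notin cover D ->
  D \subset del (eset G) v.
Proof.
move=> [DE _ _ _] vD; apply/subsetP => e eD; rewrite inE (subsetP DE e eD).
by apply: contra vD; apply: cover_edge.
Qed.

Lemma zero_reduction G D v : well_formed G -> #|colors G| = 2 ->
  bichromatic_circuit_in G D -> v \notin cover D -> #|nbr (eset G) v| = 2 ->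
  exists H, [/\ zero_extension H G, reducible_class H & #|vset H| < #|vset G|].
Proof.
move=> wfG C2 bcD vD N2; have [sG cG nG] := wfG.
have [DE circD [e0 e0D ind] [e1 [e2 [e1D e2D ne]]]] := bcD.
have Ddel := circuit_del bcD vD.
have /cards2P[x [y [xy NE]]] : #|nbr (eset G) v| == 2 by rewrite N2.
have [|xv vxE vV xV] := nbr_vset (v := v) (x := x) wfG; first by rewrite NE set21.
have [|yv vyE _ yV] := nbr_vset (v := v) (x := y) wfG; first by rewrite NE set22.
pose H := CGraph (vset G :\ v) (del (eset G) v) (Defs.col G).
have subC : colors H \subset colors G by apply: imsetS; apply: del_sub.
have CE : colors H = colors G.
  by apply: (sub_colors_card2 C2 subC _ _ ne); apply: (subsetP Ddel).
have starG : star (eset G) v = [set [set v; x]; [set v; y]].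
  by rewrite starE // NE imsetU1 imset_set1.
have cV := cardsD1 v (vset G); rewrite vV add1n in cV.
exists H; split; last by rewrite /= cV.
  exists v, x, y; split; rewrite /= ?CE ?setD11 //.
  - by rewrite !inE xv yv xV yV.
  - by rewrite setD1K.
  - by rewrite -starG setUC -star_del.
  by split=> //; apply: imset_f.
split; [split| by rewrite CE |] => /=.
- exact: simple_sub (del_sub _ _) sG.
- exact: cover_del.
- have := card_star_del (eset G) v; rewrite card_star // N2.
  by move: nG cV; clear; card_lia.
exists D; split=> //; last by exists e1, e2.
exists e0 => //; apply: R2_independentS ind; apply: setSD; exact: del_sub.
Qed.

Definition recolor (c : {set V} -> K) e k : {set V} -> K :=
  fun e' => if e' == e then k else c e'.

Definition split_off G v f k : cgraph V K :=
  CGraph (vset G :\ v) (f |: del (eset G) v) (recolor (Defs.col G) f k).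

(** The inverse of a color-preserving 1-extension; the new edge [xy] may take the
color of [vx] or of [vy]. *)
Lemma one_reduction G D v x y z k : well_formed G -> #|colors G| = 2 ->
  x != y -> y != z -> x != z -> nbr (eset G) v =i [:: x; y; z] ->
  [set x; y] \notin eset G ->
  k = Defs.col G [set v; x] \/ k = Defs.col G [set v; y] ->
  bichromatic_circuit_in (split_off G v [set x; y] k) D ->
  exists H, [/\ color_preserving_one_extension H G, reducible_class H
    & #|vset H| < #|vset G|].
Proof.
move=> wfG C2 xy yz xz NE xyE kE bcD; have [sG cG nG] := wfG.
set H := split_off _ _ _ _ in bcD.
have [DE circD [e0 e0D ind] [e1 [e2 [e1D e2D ne]]]] := bcD.
have [|xv vxE vV xV] := nbr_vset (v := v) (x := x) wfG; first by rewrite NE mem_head.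
have [|yv vyE _ yV] := nbr_vset (v := v) (x := y) wfG; first by rewrite NE !inE eqxx orbT.
have [|zv vzE _ zV] := nbr_vset (v := v) (x := z) wfG; first by rewrite NE !inE eqxx !orbT.
have vxy : v \notin [set x; y] by rewrite !inE negb_or ![v == _]eq_sym xv yv.
have colH e : e \in eset G -> Defs.col H e = Defs.col G e.
  by move=> eE; rewrite /= /recolor; case: eqP => // exy; rewrite exy (negPf xyE) in eE.
have colxy : Defs.col H [set x; y] = k by rewrite /= /recolor eqxx.
have subC : colors H \subset colors G.
  apply/subsetP => l /imsetP[e]; rewrite in_setU1 => /orP[/eqP->|eG] ->.
    by rewrite colxy; case: kE => ->; apply: imset_f.
  have eE : e \in eset G by apply: (subsetP (del_sub _ _)) eG.
  by rewrite colH //; apply: imset_f.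
have CE : colors H = colors G.
  by apply: (sub_colors_card2 C2 subC _ _ ne); apply: (subsetP DE).
have starG : star (eset G) v = [set [set v; x]; [set v; y]; [set v; z]].
  rewrite starE // (_ : nbr _ v = [set x; y; z]).
    by rewrite !imsetU !imset_set1.
  by apply/setP => u; rewrite NE !inE orbA.
have cV := cardsD1 v (vset G); rewrite vV add1n in cV.
have xydel : [set x; y] \notin del (eset G) v.
  by apply: contra xyE; apply: (subsetP (del_sub _ _)).
have N3 : #|nbr (eset G) v| = 3.
  rewrite (eq_card NE); apply/card_uniqP.
  by rewrite /= !inE negb_or xy xz yz.
exists H; split; last by rewrite /= cV.
  exists v, x, y, z; split.
  - by rewrite /= setD11.
  - by split; rewrite ?setU11 //= ?inE ?zv // eq_sym.
  - by rewrite /= setD1K.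
  - by rewrite /= setU1K // -starG setUC -star_del.
  split; rewrite ?CE ?colxy; try exact: imset_f.
    move=> e; rewrite setU1K //= => eG; rewrite -colH //.
    exact: (subsetP (del_sub _ _)) eG.
  by case: kE => ->; [left | right].
split; [split| by rewrite CE |] => /=.
- move=> e; rewrite in_setU1 => /orP[/eqP->|]; first exact: card_edge.
  by move/(subsetP (del_sub _ _)); apply: sG.
- rewrite coverU1 subUset cover_del // andbT subUset !sub1set.
  by rewrite !inE xv yv xV yV.
- rewrite cardsU1 xydel; have := card_star_del (eset G) v; rewrite card_star // N3.
  by move: nG cV => /=; clear; card_lia.
by exists D.
Qed.

(** The circuit accounts for all edges on its vertices, so the number of edges
that touch the outside is twice the number of outside vertices.  If the outside
degrees were all at least four, these edges would have both ends outside and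
form too dense a graph. *)
Lemma outside_vertex G D : well_formed G -> bichromatic_circuit_in G D ->
  D != eset G -> exists v, [/\ v \in vset G, v \notin cover D & #|nbr (eset G) v| <= 3].
Proof.
move=> [sG cG nG] [DE circD [e0 e0D ind] _] neD; set E := eset G in sG cG nG DE ind neD *.
have sD := simple_sub DE sG; have cD := circuit_card sD circD.
pose S := cover D; have SV : S \subset vset G := subset_trans (coverS DE) cG.
pose out := vset G :\: S.
have cout : #|out| + #|S| = #|vset G|.
  by rewrite /out -(cardsID S (vset G)) (setIidPr SV) addnC.
pose X := [set e in E | ~~ (e \subset S)].
have inner : #|E :\: X| = #|D|.
  have DX : D \subset E :\: X.
    apply/subsetP => e eD; rewrite !inE (subsetP DE e eD) andbT negbK.
    exact: bigcup_sup.
  apply/eqP; rewrite eqn_leq [X in _ && X]subset_leq_card // andbT.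
  have X0 : E :\: X != set0.
    by apply/set0Pn; exists e0; apply: (subsetP DX).
  have := sparse_minus_edge sG ind (subsetDl E X) X0.
  have : cover (E :\: X) \subset S.
    by apply/bigcupsP => e; rewrite !inE => /andP[+ eE]; rewrite eE negbK.
  move/subset_leq_card; move: cD; rewrite -/S; clear; card_lia.
have XE : X \subset E by apply/subsetP => e; rewrite inE => /andP[].
have cX : #|X| = 2 * #|out|.
  have := cardsID X E; rewrite (setIidPr XE) inner.
  by move: cout nG cD; rewrite -/S -/E; clear; card_lia.
have X0 : X != set0.
  apply: contra neD => /eqP X0; move: inner; rewrite X0 setD0 => cE.
  by rewrite eqEcard DE cE leqnn.
have [/existsP[v /andP[/setDP[vV vS] deg]]|/existsPn high] :=
    boolP [exists v, (v \in out) && (#|nbr E v| <= 3)]; first by exists v.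
have degs : 4 * #|out| <= \sum_(e in E) #|e :&: out|.
  rewrite -sum_degrees mulnC -sum_nat_const; apply: leq_sum => v vout.
  by have := high v; rewrite vout card_star //= -ltnNge.
have small e : e \in E -> #|e :&: out| <= 2.
  by move=> eE; rewrite -(sG e eE) subset_leq_card // subsetIl.
have sumX : \sum_(e in E) #|e :&: out| = \sum_(e in X) #|e :&: out|.
  rewrite (big_setID X) /= (setIidPr XE) [X in _ + X]big1 ?addn0 // => e.
  rewrite !inE => /andP[+ eE]; rewrite eE negbK /= => eS.
  apply/eqP; rewrite cards_eq0; apply/eqP/setP => v; rewrite !inE.
  by case ve: (v \in e) => //=; rewrite (subsetP eS).
have full e : e \in X -> e \subset out.
  move=> eX; apply: contraT => eout.
  have lt2 : #|e :&: out| < 2.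
    rewrite -(sG e (subsetP XE e eX)); apply: proper_card.
    by rewrite properEneq subsetIl andbT; apply: contra eout => /eqP/setIidPl.
  suff : \sum_(e in X) #|e :&: out| < 2 * #|X|.
    by move: degs; rewrite sumX cX ltnNge mulnA => ->.
  rewrite (big_setD1 e) //= (cardsD1 e X) eX mulnDr muln1 -addSn leq_add //.
  rewrite mulnC -sum_nat_const; apply: leq_sum => f; rewrite inE => /andP[_ fX].
  by apply: small; apply: (subsetP XE).
have covX : cover X \subset out by apply/bigcupsP.
have := sparse_minus_edge sG ind XE X0.
by have := subset_leq_card covX; move: cX; clear; card_lia.
Qed.

Lemma degree_ge2 G D v : well_formed G -> bichromatic_circuit_in G D ->
  v \in vset G -> v \notin cover D -> 2 <= #|nbr (eset G) v|.
Proof.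
move=> [sG cG nG] bcD vV vD; have Ddel := circuit_del bcD vD.
have [DE circD [e0 e0D ind] _] := bcD.
have del0 : del (eset G) v != set0.
  by apply/set0Pn; exists e0; apply: (subsetP Ddel).
have := sparse_minus_edge sG ind (del_sub _ v) del0.
have := subset_leq_card (cover_del v cG).
have := cardsD1 v (vset G); rewrite vV add1n.
have := card_star_del (eset G) v; rewrite card_star //.
by move: nG; clear; card_lia.
Qed.

(** Were all three pairs of neighbors of [v] linked by tight sets, these
tight sets together with the star of [v] would be too large. *)
Lemma split_off_pair G D v : well_formed G -> bichromatic_circuit_in G D ->
  v \notin cover D -> #|nbr (eset G) v| = 3 ->
  exists x y z e0, [/\ [/\ x != y, y != z & x != z], nbr (eset G) v =i [:: x; y; z],
    [set x; y] \notin eset G, e0 \in D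
    & R2_independent (([set x; y] |: del (eset G) v) :\ e0)].
Proof.
move=> wfG bcD vD N3; have [sG cG nG] := wfG; have Ddel := circuit_del bcD vD.
have [DE circD [e0 e0D ind] _] := bcD.
have [depD _] := R2_circuitP _ circD.
pose F := del (eset G) v :\ e0.
have FE : F \subset eset G :\ e0 by apply: setSD; apply: del_sub.
have indF : R2_independent F by apply: R2_independentS ind.
have sF : simple_graph F := simple_sub (subset_trans FE (subsetDl _ _)) sG.
have [x [y [z [xy yz xz NE]]]] := enum3 N3.
have good a b : a != b -> [set a; b] \notin F -> R2_independent ([set a; b] |: F) ->
    v \notin [set a; b] ->
    [set a; b] \notin eset G /\ R2_independent (([set a; b] |: del (eset G) v) :\ e0).
  move=> ab abF indab vab; have ne0 : [set a; b] != e0.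
    apply: contraNneq depD => abe0; apply: R2_independentS indab.
    apply/subsetP => e eD; rewrite !inE abe0; case: (eqVneq e e0) => //= _.
    by move/(_ e eD): (subsetP Ddel); rewrite inE.
  split; last first.
    apply: R2_independentS indab; rewrite subDset.
    apply/subsetP => e; rewrite !inE => /orP[->|->]; first by rewrite orbT.
    by case: (e == e0) => //=; rewrite orbT.
  apply: contra abF => abE; rewrite !inE ne0 abE /=.
  by move: vab; rewrite !inE.
have nv a : a \in [:: x; y; z] -> a != v by rewrite -NE inE => /andP[].
have [xv yv zv] : [/\ x != v, y != v & z != v].
  by split; apply: nv; rewrite !inE eqxx ?orbT.
have vpair a b : a != v -> b != v -> v \notin [set a; b].
  by move=> av bv; rewrite !inE negb_or ![v == _]eq_sym av.
have link a b : a != b -> ~~ (([set a; b] \notin F) && R2_independent ([set a; b] |: F)) ->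
    exists X, [/\ X \subset F, tight X, a \in cover X & b \in cover X].
  move=> ab; rewrite negb_and negbK => /orP[abF|dep].
    exists [set [set a; b]]; rewrite sub1set abF tight1 ?card_edge // cover1.
    by rewrite set21 set22.
  have [D' [D'F circD']] := dependent_circuit dep.
  have sabF : simple_graph ([set a; b] |: F).
    by move=> e; rewrite in_setU1 => /orP[/eqP->|/sF //]; apply: card_edge.
  have [tX cX] := circuit_link sabF indF D'F circD'.
  have [_ XF] := circuit_through indF D'F circD'.
  by exists (D' :\ [set a; b]); split=> //; apply: (subsetP cX); rewrite ?set21 ?set22.
have [/andP[abF iab]|bxy] := boolP (([set x; y] \notin F) && R2_independent ([set x; y] |: F)).
  have [xyE i'] := good x y xy abF iab (vpair x y xv yv).
  by exists x, y, z, e0.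
have [/andP[abF iab]|byz] := boolP (([set y; z] \notin F) && R2_independent ([set y; z] |: F)).
  have [yzE i'] := good y z yz abF iab (vpair y z yv zv).
  exists y, z, x, e0; split=> //; first by split; rewrite // eq_sym.
  by move=> u; rewrite NE !inE; do 3![case: (u == _)].
have [/andP[abF iab]|bxz] := boolP (([set x; z] \notin F) && R2_independent ([set x; z] |: F)).
  have [xzE i'] := good x z xz abF iab (vpair x z xv zv).
  exists x, z, y, e0; split=> //; first by split; rewrite // eq_sym.
  by move=> u; rewrite NE !inE; do 3![case: (u == _)].
have [X1 [s1 t1 x1 y1]] := link x y xy bxy.
have [X2 [s2 t2 y2 z2]] := link y z yz byz.
have [X3 [s3 t3 x3 z3]] := link x z xz bxz.
have [U [UX tU [xU yU zU]]] := tight_triangle sF indF s1 s2 s3 t1 t2 t3 xy yz xz x1 y1 y2 z2 x3 z3.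
have UF : U \subset F by apply: subset_trans UX _; rewrite !subUset s1 s2 s3.
have e0v : v \notin e0 by move/(_ e0 e0D): (subsetP Ddel); rewrite inE => /andP[].
pose Y := U :|: star (eset G) v.
have YE : Y \subset eset G :\ e0.
  rewrite subUset (subset_trans UF FE) /=; apply/subsetP => e; rewrite !inE.
  case/andP=> eE ve; rewrite eE andbT; apply: contraNneq e0v => <-; exact: ve.
have Udel : U :&: star (eset G) v = set0.
  apply/setP => e; rewrite !inE; case eU: (e \in U) => //=.
  by have := subsetP UF e eU; rewrite !inE => /and3P[_ _ /negPf->]; rewrite andbF.
have cY : #|Y| = #|U| + 3 by rewrite /Y cardsU Udel cards0 subn0 card_star // N3.
have covY : cover Y \subset v |: cover U.
  rewrite coverU subUset subsetUr /=; apply/bigcupsP => e; rewrite starE //.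
  case/imsetP=> a; rewrite NE => ain ->; rewrite subUset !sub1set setU11 /= in_setU1.
  by move: ain; rewrite !inE => /or3P[]/eqP->; rewrite ?xU ?yU ?zU ?orbT.
have Y0 : Y != set0 by rewrite -card_gt0 cY addn3.
have := (R2_independentP _ ind) Y YE Y0; have := subset_leq_card covY.
have : #|v |: cover U| <= #|cover U|.+1 by rewrite cardsU1; case: (v \notin _).
by move: cY tU; rewrite /tight; clear; card_lia.
Qed.

Lemma reduction_outside G D : well_formed G -> #|colors G| = 2 ->
  bichromatic_circuit_in G D -> D != eset G ->
  exists H, [/\ zero_extension H G \/ color_preserving_one_extension H G,
    reducible_class H & #|vset H| < #|vset G|].
Proof.
move=> wfG C2 bcD neD; have [v [vV vD deg]] := outside_vertex wfG bcD neD.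
have deg2 := degree_ge2 wfG bcD vV vD.
have [N2|N3] : #|nbr (eset G) v| = 2 \/ #|nbr (eset G) v| = 3.
- by move: deg deg2; clear; card_lia.
- by have [H [zH rH ltH]] := zero_reduction wfG C2 bcD vD N2; exists H; split; auto.
have [x [y [z [e0 [[xy yz xz] NE xyE e0D ind]]]]] := split_off_pair wfG bcD vD N3.
have [DE circD _ [e1 [e2 [e1D e2D ne]]]] := bcD.
have [H [oH rH ltH]] : exists H, [/\ color_preserving_one_extension H G,
    reducible_class H & #|vset H| < #|vset G|].
  apply: (one_reduction wfG C2 xy yz xz NE xyE (or_introl erefl) (D := D)).
  have Ddel := circuit_del bcD vD.
  have colD e : e \in D -> Defs.col (split_off G v [set x; y] (Defs.col G [set v; x])) e
      = Defs.col G e.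
    move=> eD; rewrite /= /recolor; case: eqP => // exy.
    by rewrite -exy (subsetP DE) in xyE.
  split=> //; first by apply: subset_trans Ddel _; apply: subsetUr.
    by exists e0.
  by exists e1, e2; rewrite !colD.
by exists H; split; auto.
Qed.

End Reduction.

(** * Reducing a bichromatic circuit *)

Section CircuitReduction.
Local Open Scope nat_scope.
Variables V K : finType.
Implicit Types (G H : cgraph V K) (D E F X Y U : {set {set V}}) (e : {set V}).
Implicit Types (v x y z : V).

Lemma proper_sub_independent E X e : R2_circuit E -> X \subset E -> e \in E ->
  e \notin X -> R2_independent X.
Proof.
move=> /R2_circuitP[_ ind] XE eE eX; apply: ind.
by apply/properP; split=> //; exists e.
Qed.

Lemma dense_sub_eq E Y : R2_circuit E -> Y \subset E -> Y != set0 ->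
  2 * #|cover Y| < #|Y| + 3 -> Y = E.
Proof.
move=> circE YE Y0 dense; apply: (circuit_sub_eq circE) YE.
by apply/negP => /R2_independentP/(_ Y (subxx _) Y0); rewrite leqNgt dense.
Qed.

Lemma circuit_degree_ge3 E v : simple_graph E -> R2_circuit E -> v \in cover E ->
  3 <= #|nbr E v|.
Proof.
move=> sE circE vE; have [e eE ve] := bigcupP vE.
have cE := circuit_card sE circE; have c4 := circuit_cover4 sE circE.
have cV := cardsD1 v (cover E); rewrite vE add1n in cV.
have cdel := card_star_del E v; rewrite card_star // in cdel.
have covdel := subset_leq_card (cover_del v (subxx (cover E))).
have [del0|del0] := eqVneq (del E v) set0.
  rewrite del0 cards0 in cdel.
  by move: cE c4 cV cdel; clear; card_lia.
have : R2_independent (del E v).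
  by apply: (proper_sub_independent circE (del_sub E v) eE); rewrite inE ve andbF.
move/R2_independentP/(_ _ (subxx _) del0).
by move: cE cV cdel covdel; clear; card_lia.
Qed.

Definition closed_nbr E v : {set V} := v |: nbr E v.

Lemma card_inside (W : {set V}) E : simple_graph E ->
  #|[set e in E | e \subset W]| <= 'C(#|W|, 2).
Proof.
move=> sE; apply: pairs_in_card; first by move=> e; rewrite inE => /andP[/sE].
by apply/bigcupsP => e; rewrite inE => /andP[].
Qed.

Lemma nbr_edge E v x : x \in nbr E v -> [set v; x] \in E.
Proof. by rewrite inE => /andP[]. Qed.

(** No admissible splitting off at a vertex of degree three: each
non-adjacent pair of neighbors is linked by a tight set that has the color
of both edges to [v].  The star of [v] and the three links make up the
whole circuit, and the edges that need not have that color lie in the closed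
neighborhood of [v]. *)
Lemma bad_vertex E (c : {set V} -> K) v : simple_graph E -> R2_circuit E ->
  4 < #|cover E| -> #|nbr E v| = 3 ->
  (forall x y, x \in nbr E v -> y \in nbr E v -> x != y -> [set x; y] \notin E ->
    forall D, D \subset [set x; y] |: del E v -> R2_circuit D ->
    forall e, e \in D :\ [set x; y] -> c e = c [set v; x] /\ c e = c [set v; y]) ->
  exists r, [/\ forall e, e \in E -> c e != r -> e \subset closed_nbr E v,
    7 <= #|[set e in E | c e == r]| & #|[set e in E | c e != r]| <= 6].
Proof.
move=> sE circE n5 N3 bad; have [x [y [z [xy yz xz NE]]]] := enum3 N3.
pose F := del E v; have FE : F \subset E := del_sub E v.
have sF : simple_graph F := simple_sub FE sE.
have [xN yN zN] : [/\ x \in nbr E v, y \in nbr E v & z \in nbr E v].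
  by split; rewrite NE !inE eqxx ?orbT.
have nv a : a \in nbr E v -> a != v by rewrite inE => /andP[].
have indF : R2_independent F.
  by apply: (proper_sub_independent circE FE (nbr_edge xN)); rewrite inE set21 andbF.
have newF a b : a \in nbr E v -> b \in nbr E v -> a != b ->
    simple_graph ([set a; b] |: F) /\ ([set a; b] \in E -> [set a; b] \in F).
  move=> aN bN ab; split=> [e|abE].
    by rewrite in_setU1 => /orP[/eqP->|/sF //]; apply: card_edge.
  by rewrite !inE abE /= negb_or ![v == _]eq_sym !nv.
have newC a b : a \in nbr E v -> b \in nbr E v -> a != b -> [set a; b] \notin E ->
    exists2 D : {set {set V}}, D \subset [set a; b] |: F & R2_circuit D.
  move=> aN bN ab abE; have [sabF _] := newF a b aN bN ab.
  suff : ~~ R2_independent ([set a; b] |: F).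
    by move/dependent_circuit => [D []]; exists D.
  have abF : [set a; b] \notin F by apply: contra abE; apply: (subsetP FE).
  apply/negP => /R2_independentP/(_ _ (subxx _)).
  have cab := cardsU1 [set a; b] F; rewrite abF /= in cab.
  have cov : cover ([set a; b] |: F) \subset cover E :\ v.
    rewrite coverU1 subUset cover_del // andbT subUset !sub1set !inE !nv //=.
    by rewrite (cover_edge (nbr_edge aN)) ?set22 // (cover_edge (nbr_edge bN)) ?set22.
  have vE : v \in cover E by rewrite (cover_edge (nbr_edge xN)) ?set21.
  have cV := cardsD1 v (cover E); rewrite vE add1n in cV.
  have := card_star_del E v; rewrite card_star // N3.
  have := circuit_card sE circE; have := subset_leq_card cov.
  have -> : [set a; b] |: F != set0 by apply/set0Pn; exists [set a; b]; rewrite setU11.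
  move=> leC cE cdel /(_ isT); rewrite /F in cab *.
  by move: cV cab leC cE cdel; clear; card_lia.
have link a b : a \in nbr E v -> b \in nbr E v -> a != b ->
    exists X : {set {set V}}, [/\ X \subset F, tight X, a \in cover X, b \in cover X &
      forall e, e \in X -> e = [set a; b] \/
        (c e = c [set v; a] /\ c e = c [set v; b])].
  move=> aN bN ab; have [sabF abF] := newF a b aN bN ab.
  have [abE|abE] := boolP ([set a; b] \in E).
    exists [set [set a; b]]; rewrite sub1set abF // tight1 ?card_edge // cover1.
    by rewrite set21 set22; split=> // e /set1P; left.
  have [D DF circD] := newC a b aN bN ab abE.
  have [tX cX] := circuit_link sabF indF DF circD.
  have [_ XF] := circuit_through indF DF circD.
  exists (D :\ [set a; b]); split=> //; try by apply: (subsetP cX); rewrite ?set21 ?set22.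
  by move=> e eX; right; apply: bad eX.
have [X1 [s1 t1 x1 y1 col1]] := link x y xN yN xy.
have [X2 [s2 t2 y2 z2 col2]] := link y z yN zN yz.
have [X3 [s3 t3 x3 z3 col3]] := link x z xN zN xz.
have [U [UX tU [xU yU zU]]] :=
  tight_triangle sF indF s1 s2 s3 t1 t2 t3 xy yz xz x1 y1 y2 z2 x3 z3.
have UF : U \subset F by apply: subset_trans UX _; rewrite !subUset s1 s2 s3.
have starU : U :|: star E v = E.
  apply: (dense_sub_eq circE).
  - rewrite subUset (subset_trans UF FE); apply/subsetP => e; rewrite inE; by case/andP.
  - by apply/set0Pn; exists [set v; x]; rewrite !inE (nbr_edge xN) eqxx orbT.
  have Ustar : U :&: star E v = set0.
    apply/setP => e; rewrite !inE; case eU: (e \in U) => //=.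
    by have := subsetP UF e eU; rewrite !inE => /andP[_ /negPf->]; rewrite andbF.
  have covY : cover (U :|: star E v) \subset v |: cover U.
    rewrite coverU subUset subsetUr /=; apply/bigcupsP => e; rewrite starE //.
    case/imsetP=> a; rewrite NE => ain ->; rewrite subUset !sub1set setU11 /= in_setU1.
    by move: ain; rewrite !inE => /or3P[]/eqP->; rewrite ?xU ?yU ?zU ?orbT.
  rewrite cardsU Ustar cards0 subn0 card_star // N3.
  have := subset_leq_card covY.
  have : #|v |: cover U| <= #|cover U|.+1 by rewrite cardsU1; case: (v \notin _).
  by move: tU; rewrite /tight; clear; card_lia.
have uq : uniq [:: v; x; y; z].
  rewrite /= !inE !negb_or xy xz yz ![v == _]eq_sym !nv //.
(* Four mutually adjacent vertices would be a smaller circuit. *)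
have [a [b [aN bN ab abE]]] : exists a b, [/\ a \in nbr E v, b \in nbr E v, a != b
    & [set a; b] \notin E].
  have [xyE|xyE] := boolP ([set x; y] \in E); last by exists x, y.
  have [yzE|yzE] := boolP ([set y; z] \in E); last by exists y, z.
  have [xzE|xzE] := boolP ([set x; z] \in E); last by exists x, z.
  pose Q := [set e in K4_edges v x y z].
  have QE : Q \subset E.
    apply/subsetP => e; rewrite !inE => /or4P[||| /or3P[]] /eqP-> //;
    exact: nbr_edge.
  have cQ : #|Q| = 6 by rewrite cardsE; apply: (card_uniqP (K4_edges_uniq uq)).
  have covQ : cover Q \subset v |: nbr E v.
    apply/bigcupsP => e; rewrite !inE => /or4P[||| /or3P[]] /eqP->;
    by rewrite subUset !sub1set ?setU11 ?in_setU1 ?xN ?yN ?zN ?orbT.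
  have cN : #|v |: nbr E v| <= 4 by rewrite cardsU1 N3; case: (v \notin _).
  have covQ4 := leq_trans (subset_leq_card covQ) cN.
  have QQ : Q = E.
    apply: (dense_sub_eq circE QE); first by rewrite -card_gt0 cQ.
    by rewrite cQ; move: covQ4; clear; card_lia.
  by move: n5 covQ4; rewrite -QQ ltnNge => /negPf->.
have [D DF circD] := newC a b aN bN ab abE.
have [sabF _] := newF a b aN bN ab.
have [abD XF] := circuit_through indF DF circD.
have sD := simple_sub DF sabF.
have cX : 5 <= #|D :\ [set a; b]|.
  have := cardsD1 [set a; b] D; rewrite abD add1n.
  by have := circuit_card sD circD; have := circuit_cover4 sD circD; clear; card_lia.
have badab := bad a b aN bN ab abE D DF circD.
pose r := c [set v; a].
have rb : c [set v; b] = r.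
  have [|e eX] := @card_gt0P _ (mem (D :\ [set a; b])) _; first exact: leq_trans cX.
  by have [ea eb] := badab e eX; rewrite -eb ea.
have pair_color p q e : p \in nbr E v -> q \in nbr E v -> p != q ->
    c e = c [set v; p] -> c e = c [set v; q] -> c e = r.
  move=> pN qN pq ep eq; have [pa|pa] := eqVneq p a; first by rewrite ep pa.
  have [qa|qa] := eqVneq q a; first by rewrite eq qa.
  suff /orP[/eqP pb|/eqP qb] : (p == b) || (q == b); first by rewrite ep pb.
    by rewrite eq qb.
  apply: contraT; rewrite negb_or => /andP[pb qb].
  have : #|[set a; b; p; q]| <= #|nbr E v|.
    by apply: subset_leq_card; rewrite !subUset !sub1set aN bN pN qN.
  rewrite N3 -[[set a; b; p; q]]setUA -setUA !cardsU1 cards1 !inE !negb_or.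
  by rewrite ab ![a == _]eq_sym ![b == _]eq_sym pa qa pb qb pq.
have colU e : e \in E -> c e != r -> e \subset closed_nbr E v.
  rewrite -{1}starU inE => /orP[eU|]; last first.
    rewrite starE // => /imsetP[p pN ->] _.
    by rewrite subUset !sub1set setU11 /closed_nbr in_setU1 pN orbT.
  have inN p q : p \in nbr E v -> q \in nbr E v -> [set p; q] \subset closed_nbr E v.
    by move=> pN qN; rewrite subUset !sub1set !in_setU1 pN qN !orbT.
  move=> er; have := subsetP UX e eU; rewrite !inE => /orP[/orP[]|].
  - case/col1 => [->|[ep eq]]; first exact: inN.
    by rewrite (pair_color _ _ _ xN yN xy ep eq) eqxx in er.
  - case/col2 => [->|[ep eq]]; first exact: inN.
    by rewrite (pair_color _ _ _ yN zN yz ep eq) eqxx in er.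
  case/col3 => [->|[ep eq]]; first exact: inN.
  by rewrite (pair_color _ _ _ xN zN xz ep eq) eqxx in er.
exists r; split=> //; last first.
  have c4 : #|closed_nbr E v| = 4.
    by rewrite cardsU1 N3 inE eqxx.
  apply: (@leq_trans #|[set e in E | e \subset closed_nbr E v]|).
    by apply: subset_leq_card; apply/subsetP => e; rewrite !inE => /andP[eE /colU->]; rewrite ?eE.
  by apply: leq_trans (card_inside _ sE) _; rewrite c4.
have vaX e : e \in D :\ [set a; b] -> v \notin e.
  by move/(subsetP XF); rewrite inE => /andP[].
apply: (@leq_trans #|[set v; a] |: ([set v; b] |: (D :\ [set a; b]))|).
  rewrite !cardsU1 in_setU1 negb_or new_edges_neq //; last by rewrite eq_sym nv.
  have nX p : [set v; p] \notin D :\ [set a; b].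
    by apply/negP => /vaX; rewrite set21.
  by rewrite !nX.
apply: subset_leq_card; apply/subsetP => e; rewrite !in_setU1.
case/or3P=> [/eqP->|/eqP->|eX]; rewrite inE.
- by rewrite (nbr_edge aN) eqxx.
- by rewrite (nbr_edge bN) rb eqxx.
by rewrite (subsetP FE) ?(subsetP XF) //; have [-> _] := badab e eX; rewrite eqxx.
Qed.

(** The vertices of degree three cannot all contain a fixed edge [ab] in their
closed neighborhood: counting degrees leaves only two of them besides [a]
and [b], the degrees of [a] and [b] being three, and then the rest of the
graph would be too dense. *)
Lemma no_universal_edge E a b : simple_graph E -> R2_circuit E ->
  4 < #|cover E| -> [set a; b] \in E ->
  ~ (forall v, #|nbr E v| = 3 -> [set a; b] \subset closed_nbr E v).
Proof.
move=> sE circE n5 abE univ; have cE := circuit_card sE circE.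
have ab : a != b by have := sE _ abE; rewrite cards2; case: (a == b).
pose W := cover E; have [aW bW] : a \in W /\ b \in W.
  by split; apply: cover_edge abE _; rewrite ?set21 ?set22.
pose T := [set v in W | (#|nbr E v| == 3) && (v \notin [set a; b])].
have Tadj t : t \in T -> [/\ t != a, t != b, [set a; t] \in E & [set b; t] \in E].
  rewrite inE in_set2 negb_or => /and3P[tW /eqP t3 /andP[ta tb]].
  have := univ t t3; rewrite subUset !sub1set /closed_nbr !in_setU1 !inE.
  rewrite ![_ == t]eq_sym (negPf ta) (negPf tb) /= (setUC [set t]) (setUC [set t]).
  by case/andP.
have degT x y : x != y -> [set x; y] = [set a; b] -> #|T| < #|nbr E x|.
  move=> xy xyab; have [xT yT] : x \notin T /\ y \notin T.
    by split; rewrite inE -xyab ?set21 ?set22 !andbF.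
  apply: (@leq_trans #|y |: T|); first by rewrite cardsU1 yT.
  apply: subset_leq_card; apply/subsetP => t; rewrite in_setU1 => /orP[/eqP->|tT].
    by rewrite inE eq_sym xy xyab.
  have [ta tb aE bE] := Tadj t tT; rewrite inE.
  have /set2P[->|->] : x \in [set a; b] by rewrite -xyab set21.
    by rewrite ta.
  by rewrite tb.
have dega := degT a b ab erefl.
have degb : #|T| < #|nbr E b| by apply: (degT b a); rewrite 1?eq_sym // setUC.
have sumW : \sum_(v in W) #|nbr E v| = 2 * #|E|.
  under eq_bigr => v _ do rewrite -card_star //.
  rewrite sum_degrees mulnC -sum_nat_const; apply: eq_bigr => e eE.
  by rewrite (setIidPl _) ?sE // bigcup_sup.
pose rest := W :\: (a |: (b |: T)).
have abT : b \notin T /\ a \notin b |: T.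
  by rewrite !inE !eqxx (negPf ab) !orbT !andbF.
have TW : T \subset W by apply/subsetP => t; rewrite inE => /andP[].
have sumE : \sum_(v in W) #|nbr E v| = #|nbr E a| + (#|nbr E b| +
    (\sum_(v in T) #|nbr E v| + \sum_(v in rest) #|nbr E v|)).
  rewrite (big_setID (a |: (b |: T))) /= (setIidPr _); last first.
    by rewrite !subUset !sub1set aW bW TW.
  by rewrite !big_setU1 ?abT.2 ?abT.1 //= !addnA.
have sumT : \sum_(v in T) #|nbr E v| = 3 * #|T|.
  rewrite mulnC -sum_nat_const; apply: eq_bigr => t; rewrite inE.
  by case/and3P => _ /eqP.
have crest : #|rest| + #|T| + 2 = #|W|.
  have := cardsID (a |: (b |: T)) W; rewrite (setIidPr _); last first.
    by rewrite !subUset !sub1set aW bW TW.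
  by rewrite !cardsU1 abT.1 abT.2 /rest /=; clear; card_lia.
have sumrest : 4 * #|rest| <= \sum_(v in rest) #|nbr E v|.
  rewrite mulnC -sum_nat_const; apply: leq_sum => v; rewrite !inE.
  case/andP=> + vW; rewrite vW /= !negb_or => /and3P[va vb].
  rewrite va vb /= !andbT => n3.
  by rewrite ltn_neqAle eq_sym n3 circuit_degree_ge3.
have a3 := circuit_degree_ge3 sE circE aW.
have b3 := circuit_degree_ge3 sE circE bW.
have [T2 na nb] : [/\ #|T| = 2, #|nbr E a| = 3 & #|nbr E b| = 3].
  move: sumrest crest sumT sumE sumW cE a3 b3 dega degb; rewrite -/W.
  move: (\sum_(v in rest) _) (\sum_(v in T) _) (\sum_(v in W) _) => s1 s2 s3.
  by clear; move=> *; split; card_lia.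
have /cards2P[t1 [t2 [t12 TE]]] : #|T| == 2 by rewrite T2.
have [t1a t1b at1 bt1] : [/\ t1 != a, t1 != b, [set a; t1] \in E & [set b; t1] \in E].
  by apply: Tadj; rewrite TE set21.
have [t2a t2b at2 bt2] : [/\ t2 != a, t2 != b, [set a; t2] \in E & [set b; t2] \in E].
  by apply: Tadj; rewrite TE set22.
pose A := a |: (b |: T).
have AW : A \subset W by rewrite !subUset !sub1set aW bW TW.
have uq : uniq [:: a; b; t1; t2].
  rewrite /= !inE !negb_or ab t12 ![a == _]eq_sym ![b == _]eq_sym.
  by rewrite t1a t2a t1b t2b.
pose Q := [set e in take 5 (K4_edges a b t1 t2)].
have cQ : #|Q| = 5.
  rewrite cardsE; apply: (card_uniqP (s := take 5 _)).
  exact: take_uniq (K4_edges_uniq uq).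
have QE e : e \in Q -> e \in E /\ e \subset A.
  rewrite !inE /A TE => /or4P[||| /orP[]] /eqP->; split=> //;
  by rewrite subUset !sub1set !inE !eqxx ?orbT.
have sumA : \sum_(v in A) #|star E v| = 12.
  under eq_bigr => v _ do rewrite card_star //.
  by rewrite /A !big_setU1 ?abT.2 ?abT.1 //= na nb sumT T2.
pose Z := [set e in E | e :&: A == set0].
have ZE : Z \subset E by apply/subsetP => e; rewrite inE => /andP[].
have touch : #|E :\: Z| + 5 <= 12.
  rewrite -sumA sum_degrees (big_setID Z) /= (setIidPr ZE).
  rewrite [X in _ <= X + _]big1 ?add0n; last first.
    by move=> e; rewrite inE => /andP[_ /eqP->]; rewrite cards0.
  have QZ : Q \subset E :\: Z.
    apply/subsetP => e eQ; have [eE eA] := QE e eQ; rewrite !inE eE /= andbT.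
    by rewrite (setIidPl eA) -cards_eq0 (sE e eE).
  rewrite (big_setID Q) /= (setIidPr QZ).
  have -> : \sum_(e in Q) #|e :&: A| = 10.
    rewrite -[10]/(5 * 2) -cQ -sum_nat_const; apply: eq_bigr => e eQ.
    by have [eE eA] := QE e eQ; rewrite (setIidPl eA) (sE e eE).
  have : #|(E :\: Z) :\: Q| <= \sum_(e in (E :\: Z) :\: Q) #|e :&: A|.
    rewrite -sum1_card; apply: leq_sum => e; rewrite !inE.
    by case/and3P => _ + eE; rewrite eE /= -card_gt0.
  have := cardsID Q (E :\: Z); rewrite (setIidPr QZ) cQ.
  by move: (\sum_(e in _) _) => s; clear; card_lia.
have cZ := cardsID Z E; rewrite (setIidPr ZE) in cZ.
have covZ : cover Z \subset W :\: A.
  apply/bigcupsP => e; rewrite inE => /andP[eE /eqP eA]; rewrite subsetD.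
  by rewrite bigcup_sup //= -setI_eq0 eA.
have cA : #|W :\: A| + 4 = #|W|.
  have := cardsID A W; rewrite (setIidPr AW).
  by rewrite {1}/A !cardsU1 abT.1 abT.2 T2 /=; clear; card_lia.
have Z0 : Z != set0.
  by rewrite -card_gt0; move: touch cZ cE n5; clear; card_lia.
have indZ : R2_independent Z.
  apply: (proper_sub_independent circE ZE abE); rewrite inE abE /=.
  by apply/set0Pn; exists a; rewrite !inE !eqxx.
have := (R2_independentP _ indZ) _ (subxx _) Z0.
have := subset_leq_card covZ; move: touch cZ cE cA; rewrite /W; clear; card_lia.
Qed.

Lemma circuit_vset G : well_formed G -> R2_circuit (eset G) -> vset G = cover (eset G).
Proof.
move=> [sG cG nG] circG; apply/esym/eqP; rewrite eqEcard cG /=.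
by move: nG; have := circuit_card sG circG; clear; card_lia.
Qed.

Lemma small_circuit G : well_formed G -> #|colors G| = 2 -> R2_circuit (eset G) ->
  #|vset G| <= 4 -> bichromatic_K4 G.
Proof.
move=> wfG C2 circG le4; have [sG cG nG] := wfG.
have VE := circuit_vset wfG circG.
have V4 : #|vset G| = 4.
  by apply/eqP; rewrite eqn_leq le4 VE circuit_cover4.
split=> //; apply/eqP; rewrite eqEcard; apply/andP; split.
  apply/subsetP => e eG; rewrite inE (sG e eG) eqxx andbT.
  by apply: subset_trans cG; apply: bigcup_sup.
have -> : #|[set e : {set V} | (e \subset vset G) && (#|e| == 2)]| = 6.
  by rewrite cards_draws V4.
by move: nG; rewrite V4; clear; card_lia.
Qed.

(** If no splitting off is possible, all edges but those of one large color class
lie in the closed neighborhood of any given vertex of degree three.  That class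
has more edges than such a neighborhood can hold, so it is the same for all
these vertices, and an edge of the other color contradicts
[no_universal_edge]. *)
Lemma circuit_reduction G : well_formed G -> #|colors G| = 2 ->
  R2_circuit (eset G) -> 4 < #|vset G| ->
  exists H, [/\ color_preserving_one_extension H G, reducible_class H
    & #|vset H| < #|vset G|].
Proof.
move=> wfG C2 circG n5; have [sG cG nG] := wfG.
rewrite (circuit_vset wfG circG) in n5.
apply: boolp.contrapT => stuck.
have bad v : #|nbr (eset G) v| = 3 -> exists r,
    [/\ forall e, e \in eset G -> Defs.col G e != r -> e \subset closed_nbr (eset G) v,
        7 <= #|[set e in eset G | Defs.col G e == r]|
      & #|[set e in eset G | Defs.col G e != r]| <= 6].
  move=> N3; apply: bad_vertex => // x y xN yN xy xyE D DF circD e eX.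
  have [z [yz xz NE]] : exists z, [/\ y != z, x != z & nbr (eset G) v =i [:: x; y; z]].
    have c1 := cardsD1 x (nbr (eset G) v); rewrite xN N3 add1n in c1.
    have yNx : y \in nbr (eset G) v :\ x by rewrite in_setD1 eq_sym xy.
    have c2 := cardsD1 y (nbr (eset G) v :\ x); rewrite yNx add1n in c2.
    have /eqP/cards1P[z zE] : #|nbr (eset G) v :\ x :\ y| = 1.
      by move: c1 c2; clear; card_lia.
    have : z \in nbr (eset G) v :\ x :\ y by rewrite zE set11.
    rewrite in_setD1 in_setD1 => /and3P[zy zx _].
    exists z; rewrite eq_sym zy eq_sym zx; split=> // u.
    by rewrite -[nbr _ _](setD1K xN) -(setD1K yNx) zE !inE.
  have sF := simple_sub (del_sub (eset G) v) sG.
  have indF : R2_independent (del (eset G) v).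
    by apply: (proper_sub_independent circG (del_sub _ _) (nbr_edge xN)); rewrite inE set21 andbF.
  have [xyD XF] := circuit_through indF DF circD.
  have splits k : k = Defs.col G [set v; x] \/ k = Defs.col G [set v; y] ->
      Defs.col G e = k.
    move=> kE; apply: boolp.contrapT => ek; apply: stuck.
    apply: (one_reduction wfG C2 xy yz xz NE xyE kE (D := D)); split=> //=.
      exists [set x; y] => //; rewrite setU1K //.
      by apply: contra xyE; apply: (subsetP (del_sub _ _)).
    move: eX; rewrite in_setD1 => /andP[exy eD].
    exists e, [set x; y]; split=> //; rewrite /recolor eqxx (negPf exy).
    exact/eqP.
  by split; apply: splits; auto.
have [/existsP[u /eqP u3]|/existsPn no3] := boolP [exists u, #|nbr (eset G) u| == 3];
  last first.
  have [e eG] : exists e, e \in eset G.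
    by have := circuit_simple_card sG circG => /card_gt0P.
  have [a [b [ab eab]]] := simple_edge sG eG; rewrite eab in eG.
  apply: (no_universal_edge sG circG n5 eG) => v v3.
  by have := no3 v; rewrite v3 eqxx.
have [r [_ r7 r6]] := bad u u3.
have [e eG er] : exists2 e, e \in eset G & Defs.col G e != r.
  have /cards2P[k [l [kl CE]]] : #|colors G| == 2 by rewrite C2.
  have [m mC mr] : exists2 m, m \in colors G & m != r.
    have [<-|kr] := eqVneq k r; first by exists l; rewrite ?CE ?set22 // eq_sym.
    by exists k; rewrite ?CE ?set21.
  by case/imsetP: mC mr => e eG ->; exists e.
have [a [b [ab eab]]] := simple_edge sG eG; rewrite eab in eG er.
apply: (no_universal_edge sG circG n5 eG) => v v3.
have [s [colv s7 s6]] := bad v v3; apply: colv => //.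
suff -> : s = r by [].
apply/eqP; apply: contraT => sr; move: r7; rewrite leqNgt => /negP[].
apply: leq_ltn_trans (_ : _ <= 6) _ => //; apply: leq_trans s6.
apply: subset_leq_card; apply/subsetP => f; rewrite !inE => /andP[-> /eqP->].
by rewrite eq_sym.
Qed.

Lemma reducible_constructible G : reducible_class G -> constructible G.
Proof.
have [n leG] := ubnP #|vset G|; elim: n G leG => // n IH G leG [wfG C2 [D bcD]].
have [DE|neD] := eqVneq D (eset G); last first.
  have [H [ext rH ltH]] := reduction_outside wfG C2 bcD neD.
  have cH : constructible H by apply: IH rH; apply: leq_trans ltH _.
  by case: ext; [apply: Constr_zero | apply: Constr_one].
have circG : R2_circuit (eset G) by case: bcD => _; rewrite DE.
have [le4|n5] := leqP #|vset G| 4.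
  exact/Constr_K4/small_circuit.
have [H [ext rH ltH]] := circuit_reduction wfG C2 circG n5.
by apply: Constr_one ext; apply: IH rH; apply: leq_trans ltH _.
Qed.

Lemma count_constructible E (c : {set V} -> K) : simple_graph E ->
  #|c @: E| = 2 -> #|E| = 2 * #|V| - 2 ->
  (exists D : {set {set V}}, unique (R2_circuit_in E) D
     /\ forall k, k \in c @: E -> exists2 e, e \in D & c e = k) ->
  constructible (CGraph [set: V] E c).
Proof.
move=> sE C2 nE [D [[[DE circD] uniqD] colD]].
have V0 : 0 < #|V|.
  have /card_gt0P[k /imsetP[e eE _]] : 0 < #|c @: E| by rewrite C2.
  have [a _] := simple_edge sE eE; by apply/card_gt0P; exists a.
apply: reducible_constructible; split=> //.
  split=> //=; rewrite ?subsetT // cardsT.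
  by move: nE V0; clear; card_lia.
exists D; split=> //=.
  have /card_gt0P[e0 e0D] := circuit_simple_card (simple_sub DE sE) circD.
  exists e0 => //; apply: contraT => /dependent_circuit[D' [D'E circD']].
  have DD' : D = D'.
    by apply: uniqD; split=> //; apply: subset_trans D'E (subsetDl _ _).
  by have := subsetP D'E e0; rewrite -DD' e0D !inE eqxx => /(_ isT).
have /cards2P[k [l [kl CE]]] : #|c @: E| == 2 by rewrite C2.
have [|e1 e1D c1] := colD k; first by rewrite CE set21.
have [|e2 e2D c2] := colD l; first by rewrite CE set22.
by exists e1, e2; rewrite c1 c2.
Qed.

End CircuitReduction.

(** * The characterization *)

Theorem theorem4p4 (R : realType) (V K : finType)
    (E : {set {set V}}) (c : {set V} -> K)
    (simpleE : simple_graph E) (two_colors : #|c @: E| = 2%N) :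
  (minimally_angle_rigid R E c
   <-> [/\ #|E| = (2 * #|V| - 2)%N
         & exists D : {set {set V}}, unique (R2_circuit_in E) D
             /\ forall k, k \in c @: E -> exists2 e, e \in D & c e = k])
  /\
  (minimally_angle_rigid R E c <-> constructible (CGraph [set: V] E c)).
Proof.
have necessity := @minimally_angle_rigid_count R V K E c simpleE two_colors.
have construct := @count_constructible V K E c simpleE two_colors.
have sufficiency := @constructible_minimally_angle_rigid R V K E c two_colors.
split; split.
- by case/necessity => nE circuit; split.
- by case=> nE circuit; apply/sufficiency/construct.
- by case/necessity => nE circuit; apply: construct.
exact: sufficiency.
Qed.
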